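(* Let $A(z,t)=\sum_{j\ge0}A_j(t)z^{-j}$ be an $n\times n$ matrix holomorphic in $(z,t)$ for $|z|\ge N_0>0$, $|t|\le\epsilon_0$, $t\in\mathbb C^m$, with $A_0(0)=\Lambda=\lambda_1I_{p_1}\oplus\cdots\oplus\lambda_sI_{p_s}$, $\lambda_1,\dots,\lambda_s$ distinct, and consider $\frac{dY}{dz}=A(z,t)Y$. Let $\overline S(\alpha,\beta)$ be a proper closed subsector of a sector $\mathcal S_\nu$ (see context). Then there exist an invertible block-diagonal matrix $\Delta_0$ and a matrix $\mathcal G(z)$, holomorphic for $|z|>N$ (for some sufficiently large $N$), $z\in\overline S(\alpha,\beta)$, with asymptotic expansion $$\mathcal G(z)\sim I+\sum_{k=1}^\infty\mathring F_kz^{-k},\qquad z\to\infty,\ z\in\overline S(\alpha,\beta),$$ such that the gauge transformation $Y(z,0)=\Delta_0\mathcal G(z)\mathcal Y(z)$ transforms the system at $t=0$ into the block-diagonal system $$\frac{d\mathcal Y}{dz}=\Big[\Lambda+\frac1z\Big(J+\frac{R_{(1)}}z+\cdots+\frac{R_{(\overline m)}}{z^{\overline m}}\Big)\Big]\mathcal Y,\qquad J=J_1\oplus\cdots\oplus J_s,$$ where $J_i$ is a Jordan form of the $i$-th diagonal block $A^{(1)}_{ii}(0)$ of $A_1(0)$, $1\le i\le s$, and the $R_{(l)}$, $1\le l\le\overline m$, are as described in the context. This system has the fundamental solution $\mathcal Y(z)=z^Dz^Le^{\Lambda z}$; hence the original system restricted at $t=0$ has a fundamental solution $$\mathring Y(z)=\Delta_0\mathcal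 G(z)z^Dz^Le^{\Lambda z}.$$ The matrix $\Delta_0$ is such that $\Delta_0^{-1}A_1(0)\Delta_0$ has diagonal blocks $J_1,\dots,J_s$ (in the block partition $p_1,\dots,p_s$).
   Context: Blocks are relative to the partition $n=p_1+\cdots+p_s$ of $\Lambda$; $\Delta_0$ is block-diagonal with respect to it. $\mathcal R$ is the universal covering of $\mathbb C\setminus\{0\}$; $S(\alpha,\beta)=\{z\in\mathcal R:\alpha<\arg z<\beta\}$ and $\overline S(\alpha,\beta)=\{\alpha\le\arg z\le\beta\}$. The directions $\arg z$ of the Stokes rays $\Re[(\lambda_j-\lambda_k)z]=0$, $j\ne k$, are labelled increasingly $\cdots<\tau_\sigma<\tau_{\sigma+1}<\cdots$, $\sigma\in\mathbb Z$, and $\mathcal S_\nu=S(\tau_\nu-\pi,\tau_{\nu+1})$ (if $s=1$, $\mathcal S_\nu=\mathcal R$). Each $J_i$ is a direct sum of Jordan blocks $J^{(i)}_1\oplus\cdots\oplus J^{(i)}_{h_i}$, $J^{(i)}_a$ having the single eigenvalue $\mu_a^{(i)}$. Decompose uniquely $J_i=D_i+S_i$, with $D_i$ a diagonal matrix of integers and $S_i$ a Jordan matrix with diagonal elements of real part in $[0,1)$. Let $m_i\ge0$ be the maximum integer difference between eigenvalues of $J_i$ ($m_i=0$ if none differ by integers), $\overline m=\max_im_i$. $R_{(l)}=R_{(l),1}\oplus\cdots\oplus R_{(l),s}$, where $R_{(l),i}$ (zero if $m_i<l\leq\overline m$), partitioned according to the Jordan blocks of $J_i$, has block $[R_{(l),i}]_{a,b}\ne0$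 only if $\mu_b^{(i)}-\mu_a^{(i)}=l>0$. Set $D=D_1\oplus\cdots\oplus D_s$, $S=S_1\oplus\cdots\oplus S_s$, $R=R_{(1)}+\cdots+R_{(\overline m)}$, $L=S+R$. *)

(* Defs.v *)
From HB Require Import structures.
From mathcomp Require Import all_boot all_order all_algebra.
From mathcomp Require Import mxred complex.
From mathcomp Require Import all_classical all_reals all_analysis.

Set Implicit Arguments.
Unset Strict Implicit.
Unset Printing Implicit Defensive.

Import Order.TTheory GRing.Theory Num.Theory.
Import numFieldNormedType.Exports.

Local Open Scope classical_set_scope.
Local Open Scope complex_scope.
Local Open Scope ring_scope.

(* [R[i]] packaged so that the normed-module structures of numeric fields are
   inferred for it; derivatives over [Cx R] are complex derivatives. *)
Definition Cx (R : realType) : numClosedFieldType := R[i].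

Definition ofR (R : realType) (x : R) : Cx R := x%:C.

Section UniversalCover.
Variable R : realType.
Notation C := (Cx R).

(* A point z of the universal cover of C \ {0} is represented by its logarithm
   w = ln |z| + i arg z, ranging over all of C; [proj w] = exp w is the point
   of C \ {0} below it. *)
Definition proj (w : C) : C :=
  (expR (complex.Re w) * cos (complex.Im w))
    +i* (expR (complex.Re w) * sin (complex.Im w)).

Definition arg (w : C) : R := complex.Im w.

Definition open_sector (a b : R) : set C := [set w | a < arg w < b].
Definition closed_sector (a b : R) : set C := [set w | a <= arg w <= b].

Definition closed_sector_end (N a b : R) : set C :=
  [set w | ofR N < `|proj w| /\ closed_sector a b w].

(* Holomorphic on some open neighbourhood of U.  Being holomorphic in z and in
   the chart w = log z are the same thing. *)
Definition holomorphic_on m n (U : set C) (F : C -> 'M[C]_(m, n)) : Prop :=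
  forall w, U w -> \forall u \near w, derivable F u 1.

(* d/dz in the chart w = log z: since dz = z dw, dF/dz = z^-1 dF/dw. *)
Definition ddz m n (F : C -> 'M[C]_(m, n)) (w : C) : 'M[C]_(m, n) :=
  (proj w)^-1 *: derive1 F w.

(* G ~ I + \sum_(k >= 1) F_k z^-k as z -> oo in U, in the sense of Poincare. *)
Definition asymptotic_id_series n (U : set C) (G : C -> 'M[C]_n)
    (F : nat -> 'M[C]_n) : Prop :=
  forall K : nat, exists M r : R, forall w, U w -> ofR r <= `|proj w| ->
    `|G w - (1%:M + \sum_(1 <= k < K.+1) (proj w) ^- k *: F k)|
      <= ofR M * `|proj w| ^- K.+1.

End UniversalCover.

Section MatrixFunctions.
Variable R : realType.
Notation C := (Cx R).

Definition expmx n (A : 'M[C]_n) : 'M[C]_n :=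
  limn (series (fun k : nat => (k`!%:R)^-1 *: A ^+ k)).

(* z ^ A = exp (A log z), with log z = w. *)
Definition zpowmx n (A : 'M[C]_n) (w : C) : 'M[C]_n := expmx (w *: A).

(* e ^ (A z). *)
Definition expzmx n (A : 'M[C]_n) (w : C) : 'M[C]_n := expmx (proj w *: A).

End MatrixFunctions.

Section LinearSystems.
Variables (R : realType) (n : nat).
Notation C := (Cx R).

(* Y is a fundamental matrix solution on U of dY/dz = B(z) Y. *)
Definition fundamental_solution (U : set C) (B : C -> 'M[C]_n)
    (Y : C -> 'M[C]_n) : Prop :=
  holomorphic_on U Y /\
  forall w, U w -> ddz Y w = B (proj w) *m Y w /\ Y w \in unitmx.

(* Y = T(z) Y' is an invertible change of unknown on U turning
   dY/dz = A(z) Y into dY'/dz = B(z) Y', B = T^-1 A T - T^-1 dT/dz. *)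
Definition gauge_transforms (U : set C) (T : C -> 'M[C]_n)
    (A B : C -> 'M[C]_n) : Prop :=
  holomorphic_on U T /\
  forall w, U w -> T w \in unitmx /\
    B (proj w) = invmx (T w) *m A (proj w) *m T w - invmx (T w) *m ddz T w.

End LinearSystems.

Section Stokes.
Variables (R : realType) (s : nat) (lambda : 'I_s -> Cx R).
Notation C := (Cx R).

Definition stokes_directions : set R :=
  [set theta | exists w : C, theta = arg w /\
     exists j k, j != k /\ complex.Re ((lambda j - lambda k) * proj w) = 0].

Definition stokes_labelling (tau : int -> R) : Prop :=
  (forall k l, k < l -> tau k < tau l) /\ range tau = stokes_directions.

(* For s = 1 there is no Stokes ray, and tau plays no role. *)
Definition stokes_sector (tau : int -> R) (nu : int) : set C :=
  if s == 1%N then setT else open_sector (tau nu - pi) (tau (nu + 1)).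

End Stokes.

(* Sizes and eigenvalues of the blocks of a Jordan matrix of size p. *)
Record jordan_data (R : realType) (p : nat) := JordanData {
  jnum : nat;
  jsize : 'I_jnum -> nat;
  jeig : 'I_jnum -> Cx R;
  jsize_gt0 : forall a, (0 < jsize a)%N;
  jsize_sum : (\sum_(a < jnum) jsize a)%N = p
}.
Arguments jsize {R p} d a : rename.
Arguments jeig {R p} d a : rename.

Section Jordan.
Variable R : realType.
Notation C := (Cx R).

Definition jordan_block n (mu : C) : 'M[C]_n :=
  \matrix_(i < n, j < n) (mu *+ (i == j) + (i.+1 == j :> nat)%:R).

Definition jordan_mx p (d : jordan_data R p) : 'M[C]_p :=
  castmx (jsize_sum d, jsize_sum d)
    (\mxdiag_(a < jnum d) jordan_block (jsize d a) (jeig d a)).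

(* The (a, b) block of M in the partition given by the Jordan blocks of d. *)
Definition jordan_subblock p (d : jordan_data R p) (M : 'M[C]_p)
    (a b : 'I_(jnum d)) : 'M[C]_(jsize d a, jsize d b) :=
  submxblock (castmx (esym (jsize_sum d), esym (jsize_sum d)) M) a b.

Definition resonant_of_order p (d : jordan_data R p) (l : nat)
    (M : 'M[C]_p) : Prop :=
  forall a b : 'I_(jnum d),
    jordan_subblock M a b != 0 -> jeig d b - jeig d a = l%:R.

(* J = D + S, D diagonal with integer entries, S a Jordan matrix whose
   diagonal entries have real part in [0, 1). *)
Definition integer_part_decomposition p (J D S : 'M[C]_p) : Prop :=
  [/\ J = D + S,
      is_diag_mx D,
      (forall k, exists d : int, D k k = d%:~R),
      (exists d : jordan_data R p, S = jordan_mx d) &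
      (forall k, 0 <= complex.Re (S k k) < 1)].

(* m is the maximal integer difference between eigenvalues of J; as an
   eigenvalue differs from itself by 0, this is 0 if no two distinct
   eigenvalues differ by an integer. *)
Definition max_integer_difference p (J : 'M[C]_p) (m : nat) : Prop :=
  (exists x y, [/\ eigenvalue J x, eigenvalue J y & x - y = m%:R]) /\
  (forall x y (k : nat), eigenvalue J x -> eigenvalue J y ->
     x - y = k%:R -> (k <= m)%N).

End Jordan.

Definition block_diagonal (R : realType) s (p : 'I_s -> nat)
    (M : 'M[Cx R]_(\sum_(i < s) p i)) : Prop :=
  forall i j, i != j -> submxblock M i j = 0.

(* Main.v *)
(** Only [t = 0] matters. A formal series [F] with [F 0 = 1] taking the system
    to its normal form is found coefficient by coefficient: off-diagonal blocks
    are solved for because the [lambda i] are distinct, and on diagonal blocks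
    [X |-> J X - X J + k X] is invertible on a pair [(a, b)] of Jordan blocks
    unless [mu_b - mu_a = k], where the obstruction is absorbed into [R_(k)].

    Truncating [F] at order [K] leaves a linear system
    [H' = A H - H B + O(|z|^-(K+1))], solved entry by entry by integrating along
    rays [z + r e] on which [exp (- (lambda_a - lambda_b) r e)] stays bounded.
    The estimates are made in powers of a function [l] with
    [l (z + r e) >= l z + c r], the larger of the distances to two lines, which
    is comparable to [|z|] in the subsector. For large [K] the integral operator
    is a contraction on functions [O(l^-K)]. Uniqueness of its fixed point makes
    the solution independent of [K], which gives the expansion to all orders,
    and glues solutions on overlapping half-planes when [s = 1].

    Holomorphy is carried through limits and integrals by quadratic remainder
    bounds [|f u - f z - (u - z) f' z| <= |u - z|^2 w(u, z)], so that no contour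
    integration is needed. Finally [[D, R_(l)] = - l R_(l)] gives
    [z^D L = (S + \sum_l z^-l R_(l)) z^D], hence the fundamental solution. *)
From Pilot Require Import Defs.
From HB Require Import structures.
From mathcomp Require Import all_boot all_order all_algebra.
From mathcomp Require Import mxred complex ring lra zify.
From mathcomp Require Import all_classical all_reals all_analysis.

Set Implicit Arguments.
Unset Strict Implicit.
Unset Printing Implicit Defensive.

Import Order.TTheory GRing.Theory Num.Theory.
Import numFieldNormedType.Exports.

Local Open Scope classical_set_scope.
Local Open Scope complex_scope.
Local Open Scope ring_scope.

(** Smallness comes from the order of truncation and not from the domain. Integrating [l^-(k+2)]
    along a ray on which [l] grows at rate [c] gives [l^-(k+1) / (c (k+1))], and the coupling
    coefficients, being [O(1/l)], raise the order by one again: the contraction factor is a constant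
    times [1/(k+1)]. One domain [N <= l] thus carries the solutions of all orders, which is what
    makes them comparable. For [s > 1] the subsector may be wider than a half-plane, so two
    half-planes are needed to cover it. Two directions of integration serve all pairs of
    eigenvalues, because each makes less than a right angle with both normals and the Stokes rays
    leave one of the two with the right sign. For [s = 1] no exponential occurs, but the opening on
    the cover is arbitrary; the weight then moves with the point, and every constant has to be fixed
    before the weight. The domains are not convex, so a bound on a derivative does not bound
    differences. Estimates are therefore carried for pairs of points from the start. *)

Notation cexp := Pilot.Defs.proj.

(** * A real-valued modulus on the complex numbers *)

Section Modulus.
Variable R : realType.
Notation C := (Cx R).

(** The norm on [Cx R] takes its values in [Cx R]; a modulus with values in [R] lets the estimates
    be closed by real arithmetic. *)
Definition nrm (z : C) : R := Normc.normc z.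

Lemma normE (z : C) : `|z| = ofR (nrm z).
Proof. by case: z. Qed.

Lemma nrm_ge0 z : 0 <= nrm z.
Proof. by rewrite -ler0c -/(ofR (nrm z)) -normE. Qed.

Lemma nrmM x y : nrm (x * y) = nrm x * nrm y.
Proof. exact: Normc.normcM. Qed.

Lemma nrmD x y : nrm (x + y) <= nrm x + nrm y.
Proof. exact: le_normcD. Qed.

Lemma nrmN x : nrm (- x) = nrm x.
Proof. exact: normcN. Qed.

Lemma nrmB x y : nrm (x - y) <= nrm x + nrm y.
Proof. by rewrite -(nrmN y) nrmD. Qed.

Lemma nrmBC x y : nrm (x - y) = nrm (y - x).
Proof. by rewrite -nrmN opprB. Qed.

Lemma nrm0 : nrm 0 = 0.
Proof. exact: Normc.normc0. Qed.

Lemma nrm1 : nrm 1 = 1.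
Proof. exact: Normc.normc1. Qed.

Lemma nrm_eq0 x : nrm x = 0 -> x = 0.
Proof. exact: Normc.eq0_normc. Qed.

Lemma nrmV x : nrm x^-1 = (nrm x)^-1.
Proof. exact: Normc.normcV. Qed.

Lemma nrmX x n : nrm (x ^+ n) = nrm x ^+ n.
Proof. by elim: n => [|n IH]; rewrite ?expr0 ?nrm1 // !exprS nrmM IH. Qed.

Lemma ofRM (a b : R) : ofR (a * b) = ofR a * ofR b.
Proof. exact: rmorphM. Qed.
Lemma ofRD (a b : R) : ofR (a + b) = ofR a + ofR b.
Proof. exact: rmorphD. Qed.
Lemma ofRX (a : R) n : ofR (a ^+ n) = ofR a ^+ n.
Proof. exact: rmorphXn. Qed.
Lemma ofRV (a : R) : ofR a^-1 = (ofR a)^-1.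
Proof. exact: fmorphV. Qed.
Lemma ofR_nat n : ofR n%:R = n%:R :> C.
Proof. exact: rmorph_nat. Qed.
Lemma ofR0 : ofR 0 = 0 :> C. Proof. by []. Qed.
Lemma ofR1 : ofR 1 = 1 :> C. Proof. by []. Qed.
Lemma ler_ofR (a b : R) : (ofR a <= ofR b) = (a <= b).
Proof. exact: lecR. Qed.
Lemma ltr_ofR (a b : R) : (ofR a < ofR b) = (a < b).
Proof. exact: ltcR. Qed.

Lemma nrm_ofR (a : R) : nrm (ofR a) = `|a|.
Proof. by rewrite /nrm /= expr0n addr0 sqrtr_sqr. Qed.

Lemma nrm_nat n : nrm n%:R = n%:R.
Proof. by rewrite -ofR_nat nrm_ofR normr_nat. Qed.

Lemma nrm_sum (I : Type) (r : seq I) (P : pred I) (f : I -> C) :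
  nrm (\sum_(i <- r | P i) f i) <= \sum_(i <- r | P i) nrm (f i).
Proof.
elim/big_rec2: _ => [|i a b _ h]; first by rewrite nrm0.
by apply: le_trans (nrmD _ _) _; rewrite lerD2l.
Qed.

Lemma Re_nrm z : `|complex.Re z| <= nrm z.
Proof. by rewrite -ler_ofR -normE; exact: normc_ge_Re. Qed.

Lemma Im_nrm z : `|complex.Im z| <= nrm z.
Proof.
have := Re_nrm (z * 'i); rewrite ReiNIm normrN nrmM => h.
apply: le_trans h _; suff -> : nrm 'i = 1 by rewrite mulr1.
by rewrite /nrm /= expr0n add0r expr1n sqrtr1.
Qed.

Lemma nrm_ReIm z : nrm z <= `|complex.Re z| + `|complex.Im z|.
Proof.
case: z => a b; rewrite /nrm /=.
rewrite -[leRHS]ger0_norm ?addr_ge0 // -sqrtr_sqr ler_sqrt ?sqr_ge0 //.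
rewrite sqrrD -(real_normK (num_real a)) -(real_normK (num_real b)).
by rewrite -addrA lerD2l lerDr mulrn_wge0 // mulr_ge0.
Qed.

Lemma cReD (x y : C) : complex.Re (x + y) = complex.Re x + complex.Re y.
Proof. by case: x; case: y. Qed.
Lemma cImD (x y : C) : complex.Im (x + y) = complex.Im x + complex.Im y.
Proof. by case: x; case: y. Qed.
Lemma cReN (x : C) : complex.Re (- x) = - complex.Re x.
Proof. by case: x. Qed.
Lemma cImN (x : C) : complex.Im (- x) = - complex.Im x.
Proof. by case: x. Qed.
Lemma cReM (x y : C) :
  complex.Re (x * y) = complex.Re x * complex.Re y - complex.Im x * complex.Im y.
Proof. by case: x; case: y. Qed.
Lemma cImM (x y : C) :
  complex.Im (x * y) = complex.Re x * complex.Im y + complex.Im x * complex.Re y.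
Proof. by case: x; case: y. Qed.
Lemma ReMofR (a : R) (x : C) : complex.Re (ofR a * x) = a * complex.Re x.
Proof. by case: x => u v /=; rewrite mul0r subr0. Qed.
Lemma ImMofR (a : R) (x : C) : complex.Im (ofR a * x) = a * complex.Im x.
Proof. by case: x => u v /=; rewrite mul0r addr0. Qed.

Lemma complex_ext (x y : C) : complex.Re x = complex.Re y ->
  complex.Im x = complex.Im y -> x = y.
Proof. by case: x; case: y => a b c d /= -> ->. Qed.

End Modulus.

(** * Convergence of complex sequences *)

Section Sequences.
Variable R : realType.
Notation C := (Cx R).

Definition clim (u : nat -> C) (l : C) :=
  forall e : R, 0 < e -> exists N, forall n, (N <= n)%N -> nrm (u n - l) <= e.

Lemma clim_uniq u l l' : clim u l -> clim u l' -> l = l'.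
Proof.
move=> h h'; apply/subr0_eq/nrm_eq0/eqP; rewrite eq_le nrm_ge0 andbT.
apply/ler_addgt0Pr => e e0; rewrite add0r.
have [N hN] := h (e / 2) ltac:(lra); have [N' hN'] := h' (e / 2) ltac:(lra).
have := hN (maxn N N') (leq_maxl _ _); have := hN' (maxn N N') (leq_maxr _ _).
set x := u _; have -> : l - l' = (x - l') - (x - l) by ring.
have := nrmB (x - l') (x - l); lra.
Qed.

Lemma climD u v a b : clim u a -> clim v b -> clim (fun n => u n + v n) (a + b).
Proof.
move=> h h' e e0.
have [N hN] := h (e / 2) ltac:(lra); have [N' hN'] := h' (e / 2) ltac:(lra).
exists (maxn N N') => n; rewrite geq_max => /andP[/hN h1 /hN' h2].
have -> : u n + v n - (a + b) = (u n - a) + (v n - b) by ring.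
have := nrmD (u n - a) (v n - b); lra.
Qed.

Lemma climZ c u a : clim u a -> clim (fun n => c * u n) (c * a).
Proof.
move=> h e e0; have c0 := nrm_ge0 c.
have [N hN] := h (e / (1 + nrm c)) ltac:(by rewrite divr_gt0 // ltr_wpDr).
exists N => n /hN h1; rewrite -mulrBr nrmM.
have : nrm c * nrm (u n - a) <= nrm c * (e / (1 + nrm c)) by rewrite ler_wpM2l.
move/le_trans; apply; rewrite mulrCA ler_piMr ?(ltW e0) // ler_pdivrMr; lra.
Qed.

Lemma clim_cst a : clim (fun=> a) a.
Proof. by move=> e e0; exists 0%N => n _; rewrite subrr nrm0 ltW. Qed.

Lemma clim_le u l (v : nat -> R) : clim u l ->
  forall B, (forall e, 0 < e -> exists N, forall n, (N <= n)%N -> nrm (u n) <= B + e) ->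
  nrm l <= B.
Proof.
move=> h B hB; apply/ler_addgt0Pr => e e0.
have [N hN] := h (e / 2) ltac:(lra); have [N' hN'] := hB (e / 2) ltac:(lra).
have := hN (maxn N N') (leq_maxl _ _); have := hN' (maxn N N') (leq_maxr _ _).
set x := u _ => h1 h2; have -> : l = x - (x - l) by ring.
have := nrmB x (x - l); lra.
Qed.

Lemma clim_bound u l B : clim u l -> (forall n, nrm (u n) <= B) -> nrm l <= B.
Proof.
move=> h hB; apply: (clim_le (fun=> 0) h) => e e0; exists 0%N => n _.
have := hB n; lra.
Qed.

Lemma clim_sum (I : finType) (u : I -> nat -> C) (l : I -> C) :
  (forall i, clim (u i) (l i)) -> clim (fun n => \sum_i u i n) (\sum_i l i).
Proof.
move=> h; elim: (index_enum I) => [|i s IH].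
  by under eq_fun do rewrite big_nil; rewrite big_nil; exact: clim_cst.
under eq_fun do rewrite big_cons; rewrite big_cons.
exact: climD.
Qed.

Lemma clim_ReIm (u : nat -> C) (a b : R) :
  (fun n => complex.Re (u n)) @ \oo --> a ->
  (fun n => complex.Im (u n)) @ \oo --> b -> clim u (a +i* b).
Proof.
move=> /cvgrPdist_le ha /cvgrPdist_le hb e e0.
have e2 : 0 < e / 2 by lra.
have [N _ hN] := ha _ e2; have [N' _ hN'] := hb _ e2.
exists (maxn N N') => n; rewrite geq_max => /andP[/hN h1 /hN' h2].
apply: le_trans (nrm_ReIm _) _; rewrite cReD cImD cReN cImN /=.
by rewrite [in X in X + _]distrC [in X in _ + X]distrC [leRHS]splitr lerD.
Qed.

(* Fast Cauchy sequences: the only form of completeness used. *)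
Lemma clim_ex (u : nat -> C) (b : nat -> R) (B : R) :
  (forall n, nrm (u n.+1 - u n) <= b n) ->
  (forall n, \sum_(k < n) b k <= B) -> exists l, clim u l.
Proof.
move=> hu hB.
(* Real completeness is applied to a contractive additive functional, so that real and imaginary
   parts are covered at once. *)
have H (f : C -> R) : (forall x, `|f x| <= nrm x) ->
    (forall x y, f (x - y) = f x - f y) ->
    exists l : R, (fun n => f (u n)) @ \oo --> l.
  move=> f1 fB.

  suff : cvgn (series (fun n => f (u n.+1) - f (u n))).
    move/cvg_ex=> [l hl]; exists (l + f (u 0%N)).
    have -> : (fun n => f (u n)) =
        series (fun n => f (u n.+1) - f (u n)) \+ cst (f (u 0%N)).
      apply/funext => n /=; rewrite seriesEnat /= telescope_sumr //; ring.
    by apply: cvgD => //; exact: cvg_cst.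
  apply: normed_cvg; apply: nondecreasing_is_cvgn.
    by apply: nondecreasing_series => n _ _ /=.
  exists B => _ [n _ <-] /=; apply: le_trans (hB n).
  rewrite seriesEord; apply: ler_sum => i _.
  by apply: le_trans (hu i); rewrite /= -fB.
have [a ha] := H (fun x => complex.Re x) (@Re_nrm R) (fun x y => etrans (cReD _ _) (congr1 _ (cReN _))).
have [a' ha'] := H (fun x => complex.Im x) (@Im_nrm R) (fun x y => etrans (cImD _ _) (congr1 _ (cImN _))).
by exists (a +i* a'); apply: clim_ReIm.
Qed.

End Sequences.

(** * Quadratic remainder bounds *)

Section WeightedC1.
Variable R : realType.
Notation C := (Cx R).

(** A pointwise derivative with local constants, suited to the chain rule; [cls] below asks for the
    same remainder uniformly on [D] and with decay. *)
Definition qder (f : C -> C) (z d : C) :=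
  exists K r : R, 0 < r /\ forall u, nrm (u - z) <= r ->
    nrm (f u - f z - (u - z) * d) <= nrm (u - z) ^+ 2 * K.

(** [q u z] bounds the decay at both points of a pair. The two instances are [lq], the reciprocal of
    the smaller of [l u] and [l z], and the constant 1 on a disk. *)
Record weight (D : set C) (q : C -> C -> R) : Prop := Weight {
  wge0 : forall z, D z -> 0 <= q z z;
  wl : forall u z, D u -> D z -> q u u <= q u z;
  wr : forall u z, D u -> D z -> q z z <= q u z;
  wle1 : forall u z, D u -> D z -> q u z <= 1
}.

(* [f'] stands for the derivative of [f]; the quadratic remainder bound passes
   to limits and integrals, which makes Cauchy's theorem unnecessary. *)
Record cls (D : set C) (q : C -> C -> R) k (M : R) (f f' : C -> C) : Prop := Cls {
  clsge0 : 0 <= M;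
  cls0 : forall z, D z -> nrm (f z) <= M * q z z ^+ k;
  cls1 : forall z, D z -> nrm (f' z) <= M * q z z ^+ k;
  clsL : forall u z, D u -> D z ->
    nrm (f u - f z) <= nrm (u - z) * (M * q u z ^+ k);
  clsQ : forall u z, D u -> D z ->
    nrm (f u - f z - (u - z) * f' z) <= nrm (u - z) ^+ 2 * (M * q u z ^+ k)
}.

Variables (D : set C) (q : C -> C -> R) (wq : weight D q).

Lemma wge0u u z : D u -> D z -> 0 <= q u z.
Proof. by move=> hu hz; apply: le_trans (wl wq hu hz); exact: wge0 wq _ hu. Qed.

Lemma wXge0 k u z : D u -> D z -> 0 <= q u z ^+ k.
Proof. by move=> hu hz; rewrite exprn_ge0 // wge0u. Qed.

Lemma wXl k u z : D u -> D z -> q u u ^+ k <= q u z ^+ k.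
Proof. by move=> hu hz; rewrite lerXn2r ?nnegrE ?wge0u // (wl wq). Qed.

Lemma wXr k u z : D u -> D z -> q z z ^+ k <= q u z ^+ k.
Proof. by move=> hu hz; rewrite lerXn2r ?nnegrE ?wge0u // (wr wq). Qed.

Lemma wXle j k u z : (j <= k)%N -> D u -> D z -> q u z ^+ k <= q u z ^+ j.
Proof. by move=> jk hu hz; rewrite ler_wiXn2l ?wge0u ?(wle1 wq). Qed.

Lemma cls_le k M M' f f' : M <= M' -> cls D q k M f f' -> cls D q k M' f f'.
Proof.
move=> MM [h0 h1 h2 h3 h4].
have hm u z : D u -> D z -> M * q u z ^+ k <= M' * q u z ^+ k.
  by move=> hu hz; rewrite ler_wpM2r // wXge0.
split=> [|z hz|z hz|u z hu hz|u z hu hz].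
- exact: le_trans MM.
- exact: le_trans (h1 z hz) (hm _ _ hz hz).
- exact: le_trans (h2 z hz) (hm _ _ hz hz).
- apply: le_trans (h3 u z hu hz) _.
  by rewrite ler_wpM2l ?nrm_ge0 ?hm.
- apply: le_trans (h4 u z hu hz) _.
  by rewrite ler_wpM2l ?exprn_ge0 ?nrm_ge0 ?hm.
Qed.

Lemma cls_weak j k M f f' : (j <= k)%N -> cls D q k M f f' -> cls D q j M f f'.
Proof.
move=> jk [h0 h1 h2 h3 h4].
have hm u z : D u -> D z -> M * q u z ^+ k <= M * q u z ^+ j.
  by move=> hu hz; rewrite ler_wpM2l // wXle.
split=> [//|z hz|z hz|u z hu hz|u z hu hz].
- exact: le_trans (h1 z hz) (hm _ _ hz hz).
- exact: le_trans (h2 z hz) (hm _ _ hz hz).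
- apply: le_trans (h3 u z hu hz) _.
  by rewrite ler_wpM2l ?nrm_ge0 ?hm.
- apply: le_trans (h4 u z hu hz) _.
  by rewrite ler_wpM2l ?exprn_ge0 ?nrm_ge0 ?hm.
Qed.

Lemma cls_eq k M f f' g g' : (forall z, D z -> f z = g z) ->
  (forall z, D z -> f' z = g' z) -> cls D q k M f f' -> cls D q k M g g'.
Proof.
move=> hf hg [h0 h1 h2 h3 h4]; split=> [//|z hz|z hz|u z hu hz|u z hu hz].
- by rewrite -hf // h1.
- by rewrite -hg // h2.
- by rewrite -!hf // h3.
- by rewrite -!hf // -hg // h4.
Qed.

Lemma cls_cst (a : C) : cls D q 0 (nrm a) (fun=> a) (fun=> 0).
Proof.
have a0 := nrm_ge0 a.
split=> [//|z hz|z hz|u z hu hz|u z hu hz]; rewrite expr0 mulr1 ?subrr ?mulr0 ?subr0 ?nrm0 //.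
- by rewrite mulr_ge0 ?nrm_ge0.
- by rewrite mulr_ge0 ?exprn_ge0 ?nrm_ge0.
Qed.

Lemma cls_0 k : cls D q k 0 (fun=> 0) (fun=> 0).
Proof.
by split=> [//|z hz|z hz|u z hu hz|u z hu hz]; rewrite ?subrr ?mulr0 ?subr0 ?nrm0 ?mul0r ?mulr0.
Qed.

Let mulrDlr (a b c d : R) : a * ((b + c) * d) = a * (b * d) + a * (c * d).
Proof. by ring. Qed.

Lemma clsD k M N f f' g g' : cls D q k M f f' -> cls D q k N g g' ->
  cls D q k (M + N) (fun z => f z + g z) (fun z => f' z + g' z).
Proof.
move=> [h0 h1 h2 h3 h4] [k0 k1 k2 k3 k4].
split=> [|z hz|z hz|u z hu hz|u z hu hz].
- exact: addr_ge0.
- by rewrite mulrDl; apply: le_trans (nrmD _ _) _; rewrite lerD ?h1 ?k1.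
- by rewrite mulrDl; apply: le_trans (nrmD _ _) _; rewrite lerD ?h2 ?k2.
- have -> : f u + g u - (f z + g z) = (f u - f z) + (g u - g z) by ring.
  by rewrite mulrDlr; apply: le_trans (nrmD _ _) _; rewrite lerD ?h3 ?k3.
- have -> : f u + g u - (f z + g z) - (u - z) * (f' z + g' z) =
    (f u - f z - (u - z) * f' z) + (g u - g z - (u - z) * g' z) by ring.
  by rewrite mulrDlr; apply: le_trans (nrmD _ _) _; rewrite lerD ?h4 ?k4.
Qed.

(** The 3 counts the terms in the remainder of a product: one remainder for each factor and the
    cross term [(f u - f z) (u - z) g' z]. Values at [u] are weighted through [wl], values at [z]
    through [wr]. *)
Lemma clsM j k M N f f' g g' : cls D q j M f f' -> cls D q k N g g' ->
  cls D q (j + k) (3 * M * N) (fun z => f z * g z)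
    (fun z => f' z * g z + f z * g' z).
Proof.
move=> [h0 h1 h2 h3 h4] [k0 k1 k2 k3 k4].
have MN := mulr_ge0 h0 k0.
have nn := @nrm_ge0 R.
have key u v w x a b : D u -> D v -> D w -> D x -> nrm a <= M * q u u ^+ j ->
  nrm b <= N * q u v ^+ k -> nrm (a * b) <= M * N * q u v ^+ (j + k).
  move=> hu hv hw hx ha hb; rewrite nrmM exprD mulrACA.
  apply: ler_pM => //; apply: le_trans ha _.
  by rewrite ler_wpM2l ?wXl.
split=> [|z hz|z hz|u z hu hz|u z hu hz].
- by rewrite -mulrA mulr_ge0.
- apply: le_trans (_ : M * N * q z z ^+ (j + k) <= _); last first.
    by rewrite ler_wpM2r ?wXge0 // -mulrA ler_peMl //; lra.
  by rewrite nrmM exprD mulrACA ler_pM ?h1 ?k1.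
- apply: le_trans (_ : 2 * (M * N * q z z ^+ (j + k)) <= _); last first.
    rewrite -[3 * M * N]mulrA -[leRHS]mulrA ler_wpM2r ?mulr_ge0 ?wXge0 //; lra.
  have : nrm (f' z * g z) <= M * N * q z z ^+ (j + k).
    by rewrite nrmM exprD mulrACA ler_pM ?h2 ?k1.
  have : nrm (f z * g' z) <= M * N * q z z ^+ (j + k).
    by rewrite nrmM exprD mulrACA ler_pM ?h1 ?k2.
  by have := nrmD (f' z * g z) (f z * g' z); lra.
- have -> : f u * g u - f z * g z = f u * (g u - g z) + (f u - f z) * g z by ring.
  have h : nrm (f u * (g u - g z)) <= nrm (u - z) * (M * N * q u z ^+ (j + k)).
    rewrite nrmM exprD [leRHS](_ : _ = (M * q u z ^+ j) * (nrm (u - z) * (N * q u z ^+ k))).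
      apply: ler_pM => //; last exact: k3.
      by apply: le_trans (h1 _ hu) _; rewrite ler_wpM2l ?wXl.
    by ring.
  have h' : nrm ((f u - f z) * g z) <= nrm (u - z) * (M * N * q u z ^+ (j + k)).
    rewrite nrmM exprD [leRHS](_ : _ = (nrm (u - z) * (M * q u z ^+ j)) * (N * q u z ^+ k)).
      apply: ler_pM => //; first exact: h3.
      by apply: le_trans (k1 _ hz) _; rewrite ler_wpM2l ?wXr.
    by ring.
  apply: le_trans (_ : 2 * (nrm (u - z) * (M * N * q u z ^+ (j + k))) <= _).
    by have := nrmD (f u * (g u - g z)) ((f u - f z) * g z); lra.
  rewrite [leRHS](_ : _ = 3 * (nrm (u - z) * (M * N * q u z ^+ (j + k)))); last by ring.
  by rewrite ler_wpM2r ?mulr_ge0 ?wXge0 //; lra.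
- have -> : f u * g u - f z * g z - (u - z) * (f' z * g z + f z * g' z) =
    f u * (g u - g z - (u - z) * g' z) + (f u - f z - (u - z) * f' z) * g z
    + (f u - f z) * ((u - z) * g' z) by ring.
  set W := nrm (u - z) ^+ 2 * (M * N * q u z ^+ (j + k)).
  have h : nrm (f u * (g u - g z - (u - z) * g' z)) <= W.
    rewrite nrmM /W exprD [leRHS](_ : _ = (M * q u z ^+ j) * (nrm (u - z) ^+ 2 * (N * q u z ^+ k))).
      apply: ler_pM => //; last exact: k4.
      by apply: le_trans (h1 _ hu) _; rewrite ler_wpM2l ?wXl.
    by ring.
  have h' : nrm ((f u - f z - (u - z) * f' z) * g z) <= W.
    rewrite nrmM /W exprD [leRHS](_ : _ = (nrm (u - z) ^+ 2 * (M * q u z ^+ j)) * (N * q u z ^+ k)).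
      apply: ler_pM => //; first exact: h4.
      by apply: le_trans (k1 _ hz) _; rewrite ler_wpM2l ?wXr.
    by ring.
  have h'' : nrm ((f u - f z) * ((u - z) * g' z)) <= W.
    rewrite !nrmM /W exprD [leRHS](_ : _ = (nrm (u - z) * (M * q u z ^+ j)) * (nrm (u - z) * (N * q u z ^+ k))).
      apply: ler_pM => //; [by rewrite mulr_ge0|exact: h3|].
      by rewrite ler_wpM2l //; apply: le_trans (k2 _ hz) _; rewrite ler_wpM2l ?wXr.
    by ring.
  rewrite [leRHS](_ : _ = 3 * W); last by rewrite /W; ring.
  set a := f u * _ in h *; set b := _ * g z in h' *; set c := _ * _ in h'' *.
  have := nrmD (a + b) c; have := nrmD a b; lra.
Qed.

Lemma clsZ k M c f f' : cls D q k M f f' ->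
  cls D q k (nrm c * M) (fun z => c * f z) (fun z => c * f' z).
Proof.
move=> [h0 h1 h2 h3 h4]; have c0 := nrm_ge0 c.
split=> [|z hz|z hz|u z hu hz|u z hu hz].
- exact: mulr_ge0.
- by rewrite nrmM -mulrA ler_wpM2l ?h1.
- by rewrite nrmM -mulrA ler_wpM2l ?h2.
- by rewrite -mulrBr nrmM -mulrA mulrCA ler_wpM2l ?h3.
- rewrite mulrCA -!mulrBr nrmM -mulrA mulrCA ler_wpM2l ?h4 //.
Qed.

Lemma clsN k M f f' : cls D q k M f f' ->
  cls D q k M (fun z => - f z) (fun z => - f' z).
Proof.
move=> /(clsZ (-1)); rewrite nrmN nrm1 mul1r.
by apply: cls_eq => z _; rewrite mulN1r.
Qed.

Lemma cls_sum (I : Type) (r : seq I) (P : pred I) k (M : I -> R) (f f' : I -> C -> C) :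
  (forall i, P i -> cls D q k (M i) (f i) (f' i)) ->
  cls D q k (\sum_(i <- r | P i) M i) (fun z => \sum_(i <- r | P i) f i z)
    (fun z => \sum_(i <- r | P i) f' i z).
Proof.
move=> h; elim: r => [|i r IH].
  rewrite big_nil; apply: cls_eq (cls_0 k) => z _; by rewrite big_nil.
have E (g : I -> C -> C) z : \sum_(j <- i :: r | P j) g j z =
    (if P i then g i z else 0) + \sum_(j <- r | P j) g j z.
  by rewrite big_cons; case: ifP => // _; rewrite add0r.
rewrite big_cons; case: ifP => Pi.
  by apply: cls_eq (clsD (h i Pi) IH) => z _; rewrite E Pi.
by apply: cls_eq IH => z _; rewrite E Pi add0r.
Qed.

(** Every condition of [cls] is a closed inequality between values of [f] and [f'] at one or two
    points, so pointwise limits suffice and no uniform convergence enters. *)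
Lemma cls_lim k M (f f' : nat -> C -> C) (g g' : C -> C) :
  (forall n, cls D q k M (f n) (f' n)) ->
  (forall z, D z -> clim (f^~ z) (g z)) ->
  (forall z, D z -> clim (f'^~ z) (g' z)) -> cls D q k M g g'.
Proof.
move=> h hg hg'; split=> [|z hz|z hz|u z hu hz|u z hu hz].
- exact: clsge0 (h 0%N).
- by apply: clim_bound (hg z hz) _ => n; exact: cls0 (h n) _ hz.
- by apply: clim_bound (hg' z hz) _ => n; exact: cls1 (h n) _ hz.
- have H : clim (fun n => f n u + (-1) * f n z) (g u + (-1) * g z).
    by apply: climD; [|apply: climZ]; exact: hg.
  rewrite mulN1r in H; apply: clim_bound H _ => n.
  by rewrite mulN1r; exact: clsL (h n) _ _ hu hz.
- have H : clim (fun n => f n u + (-1) * f n z + (- (u - z)) * f' n z)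
      (g u + (-1) * g z + (- (u - z)) * g' z).
    apply: climD; [apply: climD|]; [|apply: climZ|apply: climZ];
      [exact: hg|exact: hg|exact: hg'].
  rewrite mulN1r mulNr in H; apply: clim_bound H _ => n.
  by rewrite mulN1r mulNr; exact: clsQ (h n) _ _ hu hz.
Qed.

(** The Weierstrass test for a series together with its derivatives: since [q <= 1], the constants
    [b] majorize both. *)
Lemma cls_series k (b : nat -> R) (B : R) (f f' : nat -> C -> C) :
  (forall n, cls D q k (b n) (f n) (f' n)) ->
  (forall n, \sum_(i < n) b i <= B) ->
  exists g g', [/\ cls D q k B g g',
    forall z, D z -> clim (fun n => \sum_(i < n) f i z) (g z) &
    forall z, D z -> clim (fun n => \sum_(i < n) f' i z) (g' z)].
Proof.
move=> h hB.
have ex (a : nat -> C -> C) : (forall n z, D z -> nrm (a n z) <= b n) ->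
    exists g : C -> C, forall z, D z -> clim (fun n => \sum_(i < n) a i z) (g z).
  move=> ha; suff : forall z, exists l, D z -> clim (fun n => \sum_(i < n) a i z) l.
    by move/choice => [g hg]; exists g => z; exact: hg.
  move=> z; have [hz|hz] := pselect (D z); last by exists 0.
  have [l hl] : exists l, clim (fun n => \sum_(i < n) a i z) l; last by exists l.
  apply: (@clim_ex _ _ b B) => // n; rewrite big_ord_recr /= addrAC subrr add0r; exact: ha.
have le1 n z : D z -> b n * q z z ^+ k <= b n.
  move=> hz; rewrite ler_piMr ?(clsge0 (h n)) // exprn_ile1 ?wge0u //.
  by apply: (wle1 wq).
have [g hg] := ex f (fun n z hz => le_trans (cls0 (h n) hz) (le1 n z hz)).
have [g' hg'] := ex f' (fun n z hz => le_trans (cls1 (h n) hz) (le1 n z hz)).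
exists g, g'; split=> //.
apply: (@cls_lim k B (fun n z => \sum_(i < n) f i z) (fun n z => \sum_(i < n) f' i z)) => // n.
apply: cls_le (hB n) _; exact: cls_sum.
Qed.

Lemma cls_qder k M f f' z r : cls D q k M f f' -> D z -> 0 < r ->
  (forall u, nrm (u - z) <= r -> D u) -> qder f z (f' z).
Proof.
move=> h hz r0 hr; exists M, r; split=> // u hu.
apply: le_trans (clsQ h (hr _ hu) hz) _.
rewrite ler_wpM2l ?exprn_ge0 ?nrm_ge0 // ler_piMr ?(clsge0 h) //.
by rewrite exprn_ile1 ?wge0u ?(wle1 wq) //; exact: hr.
Qed.

End WeightedC1.

(** * The exponential and Riemann sums *)

Section Exponential.
Variable R : realType.
Notation C := (Cx R).

Lemma cexpD (u v : C) : cexp (u + v) = cexp u * cexp v.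
Proof.
apply: complex_ext; rewrite ?cReM ?cImM /cexp /= cReD cImD expRD ?cosD ?sinD; ring.
Qed.

Lemma cexp0 : cexp 0 = 1 :> C.
Proof. by apply: complex_ext; rewrite /cexp /= expR0 ?cos0 ?sin0 !mul1r. Qed.

Lemma nrm_cexp (w : C) : nrm (cexp w) = expR (complex.Re w).
Proof.
rewrite /nrm /cexp /= !exprMn -mulrDr cos2Dsin2 mulr1 sqrtr_sqr.
by rewrite ger0_norm ?expR_ge0.
Qed.

Lemma cexp_neq0 (w : C) : cexp w != 0.
Proof.
apply/eqP => h; have := nrm_cexp w; rewrite h nrm0 => /esym/eqP.
by rewrite expR_eq0.
Qed.

Lemma cexpN (w : C) : cexp (- w) = (cexp w)^-1.
Proof.
apply: (mulfI (cexp_neq0 w)); rewrite -cexpD subrr cexp0 divff //; exact: cexp_neq0.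
Qed.

Lemma mvt_abs (f df : R -> R) (a B : R) : (forall x : R, is_derive x (1 : R) f (df x)) ->
  (forall x, `|x| <= `|a| -> `|df x| <= B) -> `|f a - f 0| <= B * `|a|.
Proof.
move=> hf hB.
have cf : forall x, {for x, continuous f}.
  move=> x; apply: differentiable_continuous.
  by apply/derivable1_diffP; have := hf x; case.
have cw b c : {within `[b, c], continuous f}.
  by apply: continuous_subspaceT => x; exact: cf.
have [a0|a0] := leP 0 a.
  have [c + ->] := MVT_segment a0 (fun x _ => hf x) (cw 0 a).
  rewrite in_itv /= => /andP[c0 ca]; rewrite subr0 normrM ler_wpM2r //.
  by apply: hB; rewrite !ger0_norm.
have [c + h] := MVT_segment (ltW a0) (fun x _ => hf x) (cw a 0).
rewrite in_itv /= => /andP[c0 ca]; rewrite distrC h sub0r normrM normrN ler_wpM2r //.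
by apply: hB; rewrite !ler0_norm // ?lerN2 // ltW.
Qed.

Lemma sin_abs (y : R) : `|sin y| <= `|y|.
Proof.
have := @mvt_abs sin cos y 1 (fun x => is_derive_sin x) (fun x _ => cos_max x).
by rewrite sin0 subr0 mul1r.
Qed.

Lemma cos_quad (y : R) : `|cos y - 1| <= y ^+ 2.
Proof.
have := @mvt_abs cos (fun x => - sin x) y `|y| (fun x => is_derive_cos x).
rewrite cos0 -expr2 real_normK ?num_real //; apply=> x hx.
by rewrite normrN; apply: le_trans (sin_abs x) hx.
Qed.

Lemma sin_quad (y : R) : `|y| <= 1 -> `|sin y - y| <= y ^+ 2.
Proof.
move=> hy; have hd (x : R) : is_derive x (1 : R) (fun t : R => sin t - t) (cos x - 1).
  by apply: is_deriveB.
have := @mvt_abs _ (fun x => cos x - 1) y `|y| hd.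
rewrite sin0 !subr0 -expr2 real_normK ?num_real //; apply=> x hx.
apply: le_trans (cos_quad x) _.
rewrite -(real_normK (num_real x)) expr2.
by rewrite -[leRHS]mulr1 ler_pM // (le_trans hx).
Qed.

(** Both sides come from [1 + t <= expR t], at [t = x] and, after inversion, at [t = - x]. *)
Lemma expR_quad (x : R) : `|x| <= 1 / 2 -> `|expR x - 1 - x| <= 2 * x ^+ 2.
Proof.
rewrite ler_norml => /andP[h1 h2].
have l := expR_ge1Dx x; have := expR_ge1Dx (- x); rewrite expRN => l'.
have e0 := expR_gt0 x.
have : expR x * (1 - x) <= 1.
  have := ler_wpM2l (ltW e0) l'; by rewrite mulfV ?gt_eqF.
move=> h; rewrite ger0_norm; last by lra.
nra.
Qed.

Lemma cexp_quad (w : C) : nrm w <= 1 / 2 ->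
  nrm (cexp w - 1 - w) <= nrm w ^+ 2 * 4.
Proof.
move=> hw; have hx := le_trans (Re_nrm w) hw; have hy := le_trans (Im_nrm w) hw.
have N2 : nrm w ^+ 2 = complex.Re w ^+ 2 + complex.Im w ^+ 2.
  by case: (w) => a b /=; rewrite /nrm /= sqr_sqrtr // addr_ge0 ?sqr_ge0.
apply: le_trans (nrm_ReIm _) _; rewrite N2 !cReD !cImD !cReN !cImN /=.
move: (complex.Re w) (complex.Im w) hx hy => x y hx hy.
have hy1 : `|y| <= 1 by lra.
have hs := sin_quad hy1; have hc := cos_quad y.
have he := expR_quad hx; have c1 := cos_max y; have s1 := sin_abs y.
have E1 : expR x * cos y - 1 - x = (expR x - 1 - x) * cos y + (1 + x) * (cos y - 1) by ring.
have E2 : expR x * sin y - 0 - y = (expR x - 1 - x) * sin y + (x * sin y + (sin y - y)) by ring.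
rewrite oppr0 addr0 in E2 *; rewrite E1 {E1}.
have X : `|1 + x| <= 3 / 2.
  by apply: le_trans (ler_normD _ _) _; rewrite normr1; lra.
have A1 : `|(expR x - 1 - x) * cos y| <= 2 * x ^+ 2.
  by rewrite normrM -[leRHS]mulr1 ler_pM.
have A2 : `|(1 + x) * (cos y - 1)| <= 3 / 2 * y ^+ 2 by rewrite normrM ler_pM.
have A3 : `|(expR x - 1 - x) * sin y| <= 2 * x ^+ 2 * (1 / 2).
  by rewrite normrM ler_pM // (le_trans s1).
have A4 : `|x * sin y| <= `|x| * `|y| by rewrite normrM ler_pM.
rewrite E2.
have T1 := ler_normD ((expR x - 1 - x) * cos y) ((1 + x) * (cos y - 1)).
have T2 := ler_normD ((expR x - 1 - x) * sin y) (x * sin y + (sin y - y)).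
have T3 := ler_normD (x * sin y) (sin y - y).
have q : `|x| * `|y| <= (x ^+ 2 + y ^+ 2) / 2.
  rewrite -(real_normK (num_real x)) -(real_normK (num_real y)).
  have := sqr_ge0 (`|x| - `|y|); lra.
have := sqr_ge0 x; have := sqr_ge0 y; lra.
Qed.

Lemma nrm_cexp_le1 (w : C) : complex.Re w <= 0 -> nrm (cexp w) <= 1.
Proof. by rewrite nrm_cexp expR_le1. Qed.

(** Steps along a ray may be long, so [w] is not assumed small. Beyond [1/2] the three terms are at
    most [2 + |w|], with [2 <= 8 |w|^2] and [|w| <= 2 |w|^2], whence 10. *)
Lemma cexp_quad_half (w : C) : complex.Re w <= 0 ->
  nrm (cexp w - 1 - w) <= nrm w ^+ 2 * 10.
Proof.
move=> hw; have n0 := nrm_ge0 w; have [h|h] := leP (nrm w) (1 / 2).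
  by have := cexp_quad h; have := sqr_ge0 (nrm w); lra.
have := nrm_cexp_le1 hw; have := nrmB (cexp w - 1) w; have := nrmB (cexp w) 1.
by rewrite nrm1; nra.
Qed.

Lemma cexp_lip_half (w : C) : complex.Re w <= 0 ->
  nrm (cexp w - 1) <= nrm w * 6.
Proof.
move=> hw; have n0 := nrm_ge0 w; have [h|h] := leP (nrm w) (1 / 2).
  have := cexp_quad h; have := nrmD (cexp w - 1 - w) w.
  by rewrite subrK; nra.
have := nrm_cexp_le1 hw; have := nrmB (cexp w) 1.
by rewrite nrm1; nra.
Qed.

Lemma qder_cexp (z : C) : qder (@cexp R) z (cexp z).
Proof.
exists (nrm (cexp z) * 4), (1 / 2); split; first by lra.
move=> u hu.
have -> : cexp u - cexp z - (u - z) * cexp z = cexp z * (cexp (u - z) - 1 - (u - z)).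
  have -> : cexp u = cexp z * cexp (u - z) by rewrite -cexpD addrC subrK.
  by ring.
rewrite nrmM mulrCA ler_wpM2l ?nrm_ge0 //; exact: cexp_quad.
Qed.

End Exponential.

Section RayIntegral.
Variable R : realType.
Notation C := (Cx R).

(** The tangent bound for a convex power; it replaces differentiating [(x + c r)^-(k+1)] when a
    primitive is compared with its integrand. *)
Lemma sub_pow_ge (a b : R) m : 0 <= a -> a <= b ->
  m.+1%:R * ((b - a) * a ^+ m) <= b ^+ m.+1 - a ^+ m.+1.
Proof.
move=> a0 ab; elim: m => [|m IH]; first by rewrite !expr1 expr0; lra.
have am := exprn_ge0 m a0.
have H0 : 0 <= m.+1%:R * ((b - a) * a ^+ m) by rewrite !mulr_ge0 // subr_ge0.
rewrite -(natr1 m.+1) mulrDl mul1r.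
have -> : b ^+ m.+2 - a ^+ m.+2 = b * (b ^+ m.+1 - a ^+ m.+1) + (b - a) * a ^+ m.+1.
  by rewrite (exprS b m.+1) (exprS a m.+1); ring.
rewrite lerD2r; apply: le_trans (ler_pM a0 H0 ab IH).
by rewrite exprS le_eqVlt; apply/orP; left; apply/eqP; ring.
Qed.

(* [Phi] dominates the integrand and [Psi] its tail integrals. *)
Record majorant (Phi Psi : R -> R) (B : R) : Prop := Majorant {
  maj0 : forall r, 0 <= r -> 0 <= Phi r;
  majT0 : forall r, 0 <= r -> 0 <= Psi r;
  majB : forall r, 0 < r -> Psi r <= B / r;
  majS : forall r d, 0 <= r -> 0 <= d -> d * Phi (r + d) <= Psi r - Psi (r + d)
}.

(** [Psi r] is the exact integral of [Phi] over [[r, +oo[]. Its factor [1 / (c (k + 1))] is the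
    source of every contraction below. *)
Lemma majorant_pow (M x c : R) k : 0 <= M -> 1 <= x -> 0 < c ->
  majorant (fun r => M * (x + c * r)^-1 ^+ k.+2)
    (fun r => M / (c * k.+1%:R) * (x + c * r)^-1 ^+ k.+1)
    (M / (c * k.+1%:R) / c).
Proof.
move=> M0 x1 c0; have x0 : 0 < x by lra.
have y1 r : 0 <= r -> 1 <= x + c * r by move=> r0; rewrite ler_wpDr // mulr_ge0 // ltW.
have y0 r : 0 <= r -> 0 < x + c * r by move=> /y1; lra.
have i0 r : 0 <= r -> 0 <= (x + c * r)^-1 by move=> /y0; rewrite invr_ge0 => /ltW.
have K0 : 0 < c * k.+1%:R by rewrite mulr_gt0.
have Q0 : 0 <= M / (c * k.+1%:R) by rewrite divr_ge0 // ltW.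
split=> [r r0|r r0|r r0|r d r0 d0].
- by rewrite mulr_ge0 ?exprn_ge0 ?i0.
- by rewrite mulr_ge0 ?exprn_ge0 ?i0.
- rewrite -[leRHS]mulrA -invfM ler_wpM2l // exprS -[leRHS]mulr1 ler_pM ?exprn_ge0 ?i0 ?(ltW r0) //.
    by rewrite lef_pV2 ?posrE ?y0 ?mulr_gt0 ?(ltW r0) // ler_wpDl // ltW.
  by rewrite exprn_ile1 ?i0 ?(ltW r0) // invf_le1 ?y0 ?y1 ?(ltW r0).
have rd0 : 0 <= r + d by lra.
rewrite -mulrBr; set b := (x + c * r)^-1; set a := (x + c * (r + d))^-1.
have a0 : 0 <= a by exact: i0.
have hb : 0 < x + c * r by exact: y0.
have ha : 0 < x + c * (r + d) by exact: y0.
have ab : a <= b by rewrite /a /b lef_pV2 ?posrE // lerD2l ler_wpM2l ?(ltW c0) //; lra.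
have h := sub_pow_ge k a0 ab.
apply: le_trans (_ : M / (c * k.+1%:R) * (k.+1%:R * ((b - a) * a ^+ k)) <= _); last first.
  by rewrite ler_wpM2l.
have E : b - a = c * d * b * a.
  rewrite /a /b; field; rewrite !gt_eqF //.
rewrite E exprSr exprSr.
have -> : M / (c * k.+1%:R) * (k.+1%:R * (c * d * b * a * a ^+ k)) = d * (M * (a ^+ k * a * b)).
  by field; rewrite gt_eqF //= gt_eqF.
by rewrite ler_wpM2l // ler_wpM2l // ler_wpM2l // mulr_ge0 // exprn_ge0.
Qed.

Variables (Phi Psi : R -> R) (B : R) (mj : majorant Phi Psi B).

Lemma maj_sum (d : R) a m : 0 <= d ->
  \sum_(j < m) d * Phi ((a + j.+1)%:R * d) <= Psi (a%:R * d).
Proof.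
move=> d0; apply: le_trans (_ : Psi (a%:R * d) - Psi ((a + m)%:R * d) <= _); last first.
  by rewrite gerBl; apply: (majT0 mj); rewrite mulr_ge0.
elim: m => [|m IH]; first by rewrite big_ord0 addn0 subrr.
rewrite big_ord_recr /=.
have := majS mj (mulr_ge0 (ler0n R (a + m)) d0) d0.
have -> : (a + m)%:R * d + d = (a + m.+1)%:R * d by rewrite addnS -natr1; ring.
lra.
Qed.

Lemma maj_sum0 (d : R) m : 0 <= d ->
  \sum_(j < m) d * Phi (j%:R * d) <= d * Phi 0 + Psi 0.
Proof.
move=> d0; case: m => [|m].
  by rewrite big_ord0 addr_ge0 ?mulr_ge0 ?(maj0 mj) ?(majT0 mj).
rewrite big_ord_recl /= mul0r lerD2l.
by have := maj_sum 0 m d0; rewrite mul0r.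
Qed.

Let dl n : R := 2^-1 ^+ n.
Let dl0 n : 0 < dl n. Proof. by rewrite exprn_gt0 // invr_gt0. Qed.
Let dlS n : dl n = 2 * dl n.+1.
Proof. by rewrite /dl exprS mulrA mulfV ?mul1r. Qed.

(* Riemann sums of mesh [2^-n] on the growing interval [[0, 2^n]], whose limit is
   the integral over [[0, +oo[]. *)
Definition rsum (g : R -> C) n : C :=
  ofR (2^-1 ^+ n) * \sum_(j < 4 ^ n) g (j%:R * 2^-1 ^+ n).

Lemma dl_small (K e : R) : 0 < e -> exists N, forall n, (N <= n)%N -> dl n * K <= e.
Proof.
move=> e0; have [N hN] : exists N : nat, K / e <= N%:R.
  exists (Num.truncn `|K / e|).+1; apply: le_trans (ler_norm _) _; apply: ltW.
  exact: truncnS_gt.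
exists N => n Nn; rewrite ler_pdivrMr // in hN.
apply: le_trans (ler_wpM2l (ltW (dl0 n)) hN) _; rewrite mulrA ler_piMl ?(ltW e0) //.
rewrite /dl exprVn ler_pdivrMl ?exprn_gt0 // mulr1 -natrX ler_nat.
by apply: leq_trans Nn _; apply: ltnW; exact: ltn_expl.
Qed.

Lemma rsum_bound (g : R -> C) n : (forall r, 0 <= r -> nrm (g r) <= Phi r) ->
  nrm (rsum g n) <= dl n * Phi 0 + Psi 0.
Proof.
move=> hg; rewrite /rsum nrmM nrm_ofR ger0_norm ?(ltW (dl0 n)) //.
apply: le_trans (maj_sum0 (4 ^ n) (ltW (dl0 n))); rewrite -mulr_sumr.
rewrite ler_wpM2l ?(ltW (dl0 n)) //; apply: le_trans (nrm_sum _ _ _) _.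
by apply: ler_sum => i _; rewrite hg // mulr_ge0 // ltW.
Qed.

Lemma rsum_lim_bound (g : R -> C) l : (forall r, 0 <= r -> nrm (g r) <= Phi r) ->
  clim (rsum g) l -> nrm l <= Psi 0.
Proof.
move=> hg hl; apply: (clim_le (fun=> 0) hl) => e e0.
have [N hN] := dl_small (Phi 0) e0; exists N => n /hN h.
by have := rsum_bound n hg; lra.
Qed.

(** The Riemann sum of [h] telescopes to [g (2^n) - g 0] up to the mesh times a bounded sum of
    [Phi], and [majB] makes [g (2^n)] at most [B / 2^n]. *)
Lemma rsum_primitive (g h : R -> C) :
  (forall r, 0 <= r -> nrm (g r) <= Psi r) ->
  (forall r d, 0 <= r -> 0 <= d -> nrm (g (r + d) - g r - ofR d * h r) <= d ^+ 2 * Phi r) ->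
  clim (rsum h) (- g 0).
Proof.
move=> hg hh e e0.
have e2 : 0 < e / 2 by lra.
have [N1 hN1] := dl_small (dl 0 * Phi 0 + Psi 0) e2.
have [N2 hN2] := dl_small B e2.
exists (maxn N1 N2) => n; rewrite geq_max => /andP[/hN1 h1 /hN2 h2].
have d0 := ltW (dl0 n).
have E m : nrm (g (m%:R * dl n) - g 0 - \sum_(j < m) ofR (dl n) * h (j%:R * dl n)) <=
    \sum_(j < m) dl n * (dl n * Phi (j%:R * dl n)).
  elim: m => [|m IH]; first by rewrite !big_ord0 mul0r subrr subr0 nrm0.
  rewrite !big_ord_recr /=; have := hh (m%:R * dl n) (dl n) (mulr_ge0 (ler0n R m) d0) d0.
  have -> : m%:R * dl n + dl n = m.+1%:R * dl n by rewrite -natr1; ring.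
  rewrite expr2 -mulrA => H; set S := \sum_(i < m) ofR _ * _ in IH *.
  rewrite [X in nrm X](_ : _ = (g (m%:R * dl n) - g 0 - S) +
    (g (m.+1%:R * dl n) - g (m%:R * dl n) - ofR (dl n) * h (m%:R * dl n))); last by ring.
  by apply: le_trans (nrmD _ _) _; rewrite lerD.
have {E} := E (4 ^ n)%N; rewrite -!mulr_sumr -/(rsum h n) mulr_sumr.
set G := g _ => E.
have HG : nrm G <= dl n * B.
  have p4 : (4 ^ n)%:R * dl n = 2 ^+ n :> R.
    rewrite natrX /dl -exprMn (_ : 4%:R * 2^-1 = 2 :> R) //.
    by rewrite (_ : 4%:R = 2 * 2 :> R) ?mulfK // -natrM.
  have p0 : 0 < (4 ^ n)%:R * dl n by rewrite p4 exprn_gt0.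
  apply: le_trans (hg _ (ltW p0)) _; apply: le_trans (majB mj p0) _.
  by rewrite p4 /dl exprVn mulrC.
have -> : rsum h n - - g 0 = G - (G - g 0 - rsum h n) by ring.
have : nrm (G - g 0 - rsum h n) <= e / 2.
  apply: le_trans E _; apply: le_trans h1.
  rewrite ler_wpM2l // (le_trans (maj_sum0 _ d0)) // lerD2r.
  rewrite ler_wpM2r ?(maj0 mj) // /dl expr0 exprn_ile1 ?invr_ge0 // invf_le1 // ler1n //.
by have := nrmB G (G - g 0 - rsum h n); lra.
Qed.

Lemma sum_pairs (V : zmodType) (F : nat -> V) m :
  \sum_(j < 2 * m) F j = \sum_(j < m) (F (2 * j)%N + F (2 * j).+1).
Proof.
elim: m => [|m IH]; first by rewrite muln0 !big_ord0.
by rewrite mulnS [(2 + _)%N]addnC addn2 !big_ord_recr /= IH addrA.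
Qed.

(** From [n] to [n + 1] the mesh is halved and the interval doubled. The Lipschitz bound controls
    the first change and [majB] the second, both by a multiple of [2^-n], so the sums form a fast
    Cauchy sequence. *)
Lemma rsum_cvg (g : R -> C) :
  (forall r, 0 <= r -> nrm (g r) <= Phi r) ->
  (forall r d, 0 <= r -> 0 <= d -> nrm (g (r + d) - g r) <= d * Phi r) ->
  exists l, clim (rsum g) l.
Proof.
move=> hg hL; set K := Phi 0 + Psi 0 + 2 * B.
have B0 : 0 <= B.
  by have := majB mj ltr01; rewrite divr1; apply: le_trans; apply: (majT0 mj).
apply: (@clim_ex _ _ (fun n => dl n * K) (2 * K)) => [n|n]; last first.
  rewrite -mulr_suml ler_wpM2r //.
    by rewrite /K !addr_ge0 ?(maj0 mj) ?(majT0 mj) ?mulr_ge0.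
  have -> : \sum_(i < n) dl i = 2 - 2 * dl n.
    elim: n => [|n IH]; first by rewrite big_ord0 /dl expr0; ring.
    by rewrite big_ord_recr /= IH (dlS n); ring.
  by have := dl0 n; lra.
set d := dl n.+1; have d0 : 0 <= d by exact: ltW (dl0 n.+1).
have dn : dl n = 2 * d by exact: dlS.
(* The first sum refines the old interval, the second covers the new half [[2^n, 2^(n+1)[]. *)
have -> : rsum g n.+1 - rsum g n =
    ofR d * (\sum_(j < 4 ^ n) (g (j%:R * dl n + d) - g (j%:R * dl n)) +
      \sum_(j < 2 * 4 ^ n) g ((2 * 4 ^ n + j)%:R * d)).
  have -> : rsum g n = ofR d * \sum_(j < 4 ^ n) (g (j%:R * dl n) + g (j%:R * dl n)).
    by rewrite /rsum -/(dl n) big_split /= dn ofRM ofR_nat; ring.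
  rewrite /rsum -/(dl n.+1) -/d -mulrBr; congr (_ * _).
  rewrite (_ : (4 ^ n.+1 = 2 * 4 ^ n + 2 * 4 ^ n)%N); last by rewrite expnS; lia.
  rewrite big_split_ord /= addrAC; congr (_ + _).
  rewrite (sum_pairs (fun j => g (j%:R * d))) -sumrB; apply: eq_bigr => j _.
  have -> : (2 * j)%:R * d = j%:R * dl n by rewrite dn natrM; ring.
  have -> : (2 * j).+1%:R * d = j%:R * dl n + d by rewrite dn -natr1 natrM; ring.
  by ring.
rewrite nrmM nrm_ofR ger0_norm //; set S1 := \sum_(_ < 4 ^ n) _; set S2 := \sum_(_ < _) _.
have H1 : nrm S1 <= Phi 0 + Psi 0.
  apply: le_trans (_ : \sum_(j < 4 ^ n) dl n * Phi (j%:R * dl n) <= _).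
    apply: le_trans (nrm_sum _ _ _) _; apply: ler_sum => j _.
    have j0 : 0 <= j%:R * dl n by rewrite mulr_ge0 // ltW.
    apply: le_trans (hL _ _ j0 d0) _; rewrite ler_wpM2r ?(maj0 mj) // dn; lra.
  apply: le_trans (maj_sum0 _ (ltW (dl0 n))) _; rewrite lerD2r ler_piMl ?(maj0 mj) //.
  by rewrite /dl exprn_ile1 ?invr_ge0 // invf_le1 // ler1n.
have p4 : (4 ^ n)%:R * dl n = 2 ^+ n :> R.
  rewrite natrX /dl -exprMn (_ : 4%:R * 2^-1 = 2 :> R) //.
  by rewrite (_ : 4%:R = 2 * 2 :> R) ?mulfK // -natrM.
have H2 : d * nrm S2 <= dl n * (2 * B).
  have p0 : (0 < 2 * 4 ^ n)%N by rewrite muln_gt0 expn_gt0.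
  apply: le_trans (_ : \sum_(j < 2 * 4 ^ n) d * Phi ((2 * 4 ^ n - 1 + j.+1)%:R * d) <= _).
    rewrite -mulr_sumr ler_wpM2l //; apply: le_trans (nrm_sum _ _ _) _.
    apply: ler_sum => j _; rewrite [(2 * 4 ^ n - 1 + j.+1)%N](_ : _ = 2 * 4 ^ n + j)%N; last by lia.
    by rewrite hg // mulr_ge0.
  apply: le_trans (maj_sum _ _ d0) _.
  (* [maj_sum] bounds sums over right endpoints, so the tail is started one mesh before [2^n]; that
     point is still at least [2^n / 2]. *)
  have E : (2 * 4 ^ n - 1)%:R * d = 2 ^+ n - d.
    by rewrite natrB // natrM -p4 dn; ring.
  have pn : 1 <= 2 ^+ n :> R by rewrite exprn_ege1 // ler1n.
  have d12 : d <= 1 / 2.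
    rewrite /d /dl exprS mul1r ler_piMr ?invr_ge0 //.
    by rewrite exprn_ile1 ?invr_ge0 // invf_le1 // ler1n.
  have q0 : 0 < 2 ^+ n - d by lra.
  rewrite E; apply: le_trans (majB mj q0) _.
  rewrite [leRHS](_ : _ = B * (2 * dl n)); last by ring.
  rewrite ler_wpM2l // /dl exprVn; set x := _ ^+ n in pn q0 *.
  rewrite (_ : 2 * x^-1 = (x / 2)^-1); last by rewrite invfM invrK mulrC.
  rewrite lef_pV2 ?posrE; lra.
apply: le_trans (ler_wpM2l d0 (nrmD _ _)) _; rewrite mulrDr /K mulrDr.
apply: lerD H2; apply: ler_pM; rewrite ?nrm_ge0 // dn; lra.
Qed.

End RayIntegral.

(** * Linear systems solved along rays *)

Section RaySolution.
Variable R : realType.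
Notation C := (Cx R).

Lemma rsumD (f g : R -> C) n : rsum (fun r => f r + g r) n = rsum f n + rsum g n.
Proof. by rewrite /rsum big_split mulrDr. Qed.

Lemma rsumZ a (f : R -> C) n : rsum (fun r => a * f r) n = a * rsum f n.
Proof. by rewrite /rsum -mulr_sumr mulrCA. Qed.

(** Total, with value 0 where no limit exists, so that [raysol] and [psum] are functions on all of
    [C]. *)
Definition Clim (u : nat -> C) : C := xget 0 [set l | clim u l].

Lemma ClimP (u : nat -> C) l : clim u l -> clim u (Clim u).
Proof. by move=> h; exact: (xgetI 0 h). Qed.

Variables (l : C -> R) (c N : R).
Hypotheses (c0 : 0 < c) (N1 : 1 <= N).

Definition lset : set C := [set z | N <= l z].
Definition lq (u z : C) : R := (Num.min (l u) (l z))^-1.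

Lemma lq_weight : weight lset lq.
Proof.
have l1 z : lset z -> 1 <= l z by move=> h; exact: le_trans h.
have l0 z : lset z -> 0 < l z by move=> /l1; lra.
split=> [z hz|u z hu hz|u z hu hz|u z hu hz]; rewrite /lq ?minxx.
- by rewrite invr_ge0 ltW // l0.
- by rewrite lef_pV2 ?posrE ?lt_min ?l0 // ge_min lexx.
- by rewrite lef_pV2 ?posrE ?lt_min ?l0 // ge_min lexx orbT.
- by rewrite invf_le1 ?lt_min ?l0 // le_min !l1.
Qed.

Section OneRay.
Variables mu e : C.
Hypothesis e1 : nrm e <= 1.
Hypothesis le : forall z r, 0 <= r -> l z + c * r <= l (z + ofR r * e).
Hypothesis mue : 0 <= complex.Re (mu * e).

Let kern (r : R) : C := cexp (- (ofR r * (mu * e))).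

Lemma kern_re r : 0 <= r -> complex.Re (- (ofR r * (mu * e))) <= 0.
Proof. by move=> r0; rewrite cReN ReMofR oppr_le0 mulr_ge0. Qed.

Lemma kern_le1 r : 0 <= r -> nrm (kern r) <= 1.
Proof. by move=> r0; exact: nrm_cexp_le1 (kern_re r0). Qed.

Lemma kernD r d : kern (r + d) = kern r * kern d.
Proof. by rewrite /kern ofRD mulrDl opprD cexpD. Qed.

Lemma nrm_kern_arg d : 0 <= d -> nrm (- (ofR d * (mu * e))) <= d * nrm mu.
Proof.
move=> d0; rewrite nrmN !nrmM nrm_ofR ger0_norm // ler_wpM2l //.
by rewrite ler_piMr ?nrm_ge0.
Qed.

Lemma kern_lip d : 0 <= d -> nrm (kern d - 1) <= d * nrm mu * 6.
Proof.
move=> d0; apply: le_trans (cexp_lip_half (kern_re d0)) _.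
by rewrite ler_wpM2r ?nrm_kern_arg.
Qed.

Lemma kern_quad d : 0 <= d ->
  nrm (kern d - 1 + ofR d * (mu * e)) <= (d * nrm mu) ^+ 2 * 10.
Proof.
move=> d0; rewrite -[ofR d * _]opprK.
apply: le_trans (cexp_quad_half (kern_re d0)) _.
by rewrite ler_wpM2r // lerXn2r ?nnegrE ?nrm_ge0 ?mulr_ge0 ?nrm_ge0 ?nrm_kern_arg.
Qed.

Lemma lset_ray z r : lset z -> 0 <= r -> lset (z + ofR r * e).
Proof.
move=> hz r0; apply: le_trans (le z r0); apply: le_trans hz _.
by rewrite lerDl mulr_ge0 // ltW.
Qed.

(** Translating both points along [e] raises [l] at rate [c] at each of them, so the weight of the
    pair decays like that of one point. The extra [d] serves the comparison of two sample points of
    the same ray. *)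
Lemma lq_ray u z r d k : lset u -> lset z -> 0 <= r -> 0 <= d ->
  lq (u + ofR (r + d) * e) (z + ofR r * e) ^+ k <= ((lq u z)^-1 + c * r)^-1 ^+ k.
Proof.
move=> hu hz r0 d0.
have rd0 : 0 <= r + d by lra.
have l0 x : lset x -> 0 < l x by move=> h; have := le_trans N1 h; lra.
have m0 : 0 < Num.min (l u) (l z) by rewrite lt_min !l0.
have cr : 0 <= c * r by rewrite mulr_ge0 // ltW.
have h1 := l0 _ (lset_ray hu rd0); have h2 := l0 _ (lset_ray hz r0).
rewrite /lq invrK lerXn2r ?nnegrE ?invr_ge0 ?le_min ?(ltW h1) ?(ltW h2) ?addr_ge0 ?(ltW m0) //.
rewrite lef_pV2 ?posrE ?lt_min ?h1 ?h2 //; last by rewrite ltr_wpDr.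
rewrite le_min; apply/andP; split.
  apply: le_trans (le u rd0); apply: lerD; first by rewrite ge_min lexx.
  by rewrite ler_wpM2l ?(ltW c0) // lerDl.
by apply: le_trans (le z r0); rewrite lerD2r ge_min lexx orbT.
Qed.

Lemma lqV_ge1 u z : lset u -> lset z -> 1 <= (lq u z)^-1.
Proof. by move=> hu hz; rewrite /lq invrK le_min (le_trans N1 hu) (le_trans N1 hz). Qed.

Lemma ray_bound (M : R) k u z (phi : R -> C) L : 0 <= M -> lset u -> lset z ->
  (forall r, 0 <= r -> nrm (phi r) <= M * ((lq u z)^-1 + c * r)^-1 ^+ k.+2) ->
  clim (rsum (fun r => kern r * phi r)) L ->
  nrm L <= M / (c * k.+1%:R) * lq u z ^+ k.+1.
Proof.
move=> M0 hu hz hphi hL.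
have mj := majorant_pow k M0 (lqV_ge1 hu hz) c0.
have := rsum_lim_bound mj _ hL; rewrite mulr0 addr0 invrK; apply=> r r0.
by apply: le_trans (hphi r r0); rewrite nrmM ler_piMl ?nrm_ge0 ?kern_le1.
Qed.

Section Fun.
Variables (k : nat) (M : R) (f f' : C -> C).
Hypothesis hf : cls lset lq k.+2 M f f'.

Let ray z r := z + ofR r * e.

Lemma ray_cls0 z r : lset z -> 0 <= r ->
  nrm (f (ray z r)) <= M * ((lq z z)^-1 + c * r)^-1 ^+ k.+2.
Proof.
move=> hz r0; apply: le_trans (cls0 hf (lset_ray hz r0)) _.
have := lq_ray k.+2 hz hz r0 (lexx 0); rewrite addr0 => h.
by rewrite ler_wpM2l // (clsge0 hf).
Qed.

Lemma ray_cls1 z r : lset z -> 0 <= r ->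
  nrm (f' (ray z r)) <= M * ((lq z z)^-1 + c * r)^-1 ^+ k.+2.
Proof.
move=> hz r0; apply: le_trans (cls1 hf (lset_ray hz r0)) _.
have := lq_ray k.+2 hz hz r0 (lexx 0); rewrite addr0 => h.
by rewrite ler_wpM2l // (clsge0 hf).
Qed.

Lemma ray_step z r d : ray z (r + d) - ray z r = ofR d * e.
Proof. by rewrite /ray ofRD; ring. Qed.

Lemma nrm_step d : 0 <= d -> nrm (ofR d * e) <= d.
Proof. by move=> d0; rewrite nrmM nrm_ofR ger0_norm // ler_piMr. Qed.

Lemma ray_clsL z r d : lset z -> 0 <= r -> 0 <= d ->
  nrm (f (ray z (r + d)) - f (ray z r)) <=
    d * (M * ((lq z z)^-1 + c * r)^-1 ^+ k.+2).
Proof.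
move=> hz r0 d0; have rd0 : 0 <= r + d by lra.
have hu := lset_ray hz rd0; have hv := lset_ray hz r0.
apply: le_trans (clsL hf hu hv) _; rewrite -/(ray z _) -/(ray z r) ray_step.
have wk := wXge0 lq_weight k.+2 hu hv.
apply: ler_pM; rewrite ?nrm_ge0 ?nrm_step ?(mulr_ge0 (clsge0 hf) wk) //.
by rewrite ler_wpM2l ?(clsge0 hf) ?lq_ray.
Qed.

Lemma ray_clsQ z r d : lset z -> 0 <= r -> 0 <= d ->
  nrm (f (ray z (r + d)) - f (ray z r) - ofR d * e * f' (ray z r)) <=
    d ^+ 2 * (M * ((lq z z)^-1 + c * r)^-1 ^+ k.+2).
Proof.
move=> hz r0 d0; have rd0 : 0 <= r + d by lra.
have hu := lset_ray hz rd0; have hv := lset_ray hz r0.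
have := clsQ hf hu hv; rewrite -/(ray z _) -/(ray z r) ray_step => h.
apply: le_trans h _; have wk := wXge0 lq_weight k.+2 hu hv.
apply: ler_pM; rewrite ?exprn_ge0 ?nrm_ge0 ?(mulr_ge0 (clsge0 hf) wk) //.
  by rewrite lerXn2r ?nnegrE ?nrm_ge0 ?nrm_step.
by rewrite ler_wpM2l ?(clsge0 hf) ?lq_ray.
Qed.

Lemma ray_cvg z : lset z -> exists L, clim (rsum (fun r => kern r * f (ray z r))) L.
Proof.
move=> hz; set K := 1 + nrm mu * 6.
have m0 := nrm_ge0 mu; have M0 := clsge0 hf.
have K1 : 1 <= K by rewrite /K; lra.
have MK : 0 <= M * K by rewrite mulr_ge0 //; lra.
have mj := majorant_pow k MK (lqV_ge1 hz hz) c0.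
have x0 r : 0 <= r -> 0 <= ((lq z z)^-1 + c * r)^-1 ^+ k.+2.
  move=> r0; rewrite exprn_ge0 // invr_ge0 addr_ge0 ?mulr_ge0 ?(ltW c0) //.
  by apply: le_trans (lqV_ge1 hz hz).
apply: (rsum_cvg mj) => [r r0|r d r0 d0].
  rewrite nrmM; apply: le_trans (ler_piMl (nrm_ge0 _) (kern_le1 r0)) _.
  apply: le_trans (ray_cls0 hz r0) _.
  by rewrite -mulrA ler_wpM2l // ler_peMl ?x0.
rewrite kernD.
have -> : kern r * kern d * f (ray z (r + d)) - kern r * f (ray z r) =
  kern r * (kern d * (f (ray z (r + d)) - f (ray z r)) + (kern d - 1) * f (ray z r)) by ring.
rewrite nrmM; apply: le_trans (ler_piMl (nrm_ge0 _) (kern_le1 r0)) _.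
apply: le_trans (nrmD _ _) _; rewrite !nrmM.
have h1 : nrm (kern d) * nrm (f (ray z (r + d)) - f (ray z r)) <=
    d * (M * ((lq z z)^-1 + c * r)^-1 ^+ k.+2).
  by apply: le_trans (ler_piMl (nrm_ge0 _) (kern_le1 d0)) _; exact: ray_clsL.
have h2 : nrm (kern d - 1) * nrm (f (ray z r)) <=
    d * nrm mu * 6 * (M * ((lq z z)^-1 + c * r)^-1 ^+ k.+2).
  by apply: ler_pM; rewrite ?nrm_ge0 ?kern_lip ?ray_cls0.
apply: le_trans (lerD h1 h2) _.
by rewrite /K le_eqVlt; apply/orP; left; apply/eqP; ring.
Qed.

(** The integrand is the derivative of [kern r * f (z + r e)] in [r], a function that decays at
    infinity. This is the integration by parts that differentiates [raysol], and also the source of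
    the a priori bound. *)
Lemma ray_ftc z : lset z ->
  clim (rsum (fun r => kern r * (e * (f' (ray z r) - mu * f (ray z r))))) (- f z).
Proof.
move=> hz; set m := nrm mu; have m0 : 0 <= m := nrm_ge0 mu; have M0 := clsge0 hf.
(* The first three summands bound the errors of one step; the last makes [M * K / (c (k + 1))] at
   least [M], as needed to dominate [f] itself by [Psi]. *)
set K := 1 + m ^+ 2 * 10 + m * 6 + c * k.+1%:R.
have ck : 0 < c * k.+1%:R by rewrite mulr_gt0.
have K1 : 1 + m ^+ 2 * 10 + m * 6 <= K by rewrite /K; lra.
have K2 : c * k.+1%:R <= K by rewrite /K; have := sqr_ge0 m; lra.
have MK : 0 <= M * K by rewrite mulr_ge0 // (le_trans _ K2) ?ltW.
have mj := majorant_pow k MK (lqV_ge1 hz hz) c0.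
have y0 r : 0 <= r -> 0 < (lq z z)^-1 + c * r.
  by move=> r0; rewrite ltr_wpDr ?mulr_ge0 ?(ltW c0) // (lt_le_trans ltr01) // lqV_ge1.
have x0 r j : 0 <= r -> 0 <= ((lq z z)^-1 + c * r)^-1 ^+ j.
  by move=> r0; rewrite exprn_ge0 // invr_ge0 ltW ?y0.
have kr0 : kern 0 = 1 by rewrite /kern ofR0 mul0r oppr0 cexp0.
have := @rsum_primitive _ _ _ _ mj (fun r => kern r * f (ray z r))
  (fun r => kern r * (e * (f' (ray z r) - mu * f (ray z r)))).
have rz0 : ray z 0 = z by rewrite /ray ofR0 mul0r addr0.
rewrite /= kr0 mul1r rz0; apply=> [r r0|r d r0 d0].
  rewrite nrmM; apply: le_trans (ler_piMl (nrm_ge0 _) (kern_le1 r0)) _.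
  apply: le_trans (ray_cls0 hz r0) _.
  rewrite exprS mulrA ler_wpM2r ?x0 //.
  apply: le_trans (_ : M <= _).
    rewrite ler_piMr // invf_le1 ?y0 //.
    by apply: le_trans (lqV_ge1 hz hz) _; rewrite lerDl mulr_ge0 // ltW.
  by rewrite ler_pdivlMr // ler_wpM2l.
rewrite kernD; set F := f (ray z r); set F' := f' (ray z r).
set Fd := f (ray z (r + d)).
have -> : kern r * kern d * Fd - kern r * F - ofR d * (kern r * (e * (F' - mu * F))) =
  kern r * (kern d * (Fd - F - ofR d * e * F') + (kern d - 1 + ofR d * (mu * e)) * F
    + (kern d - 1) * (ofR d * e * F')) by ring.
rewrite nrmM; apply: le_trans (ler_piMl (nrm_ge0 _) (kern_le1 r0)) _.
set W := M * ((lq z z)^-1 + c * r)^-1 ^+ k.+2.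

have h1 : nrm (kern d * (Fd - F - ofR d * e * F')) <= d ^+ 2 * W.
  rewrite nrmM; apply: le_trans (ler_piMl (nrm_ge0 _) (kern_le1 d0)) _.
  exact: ray_clsQ.
have h2 : nrm ((kern d - 1 + ofR d * (mu * e)) * F) <= (d * m) ^+ 2 * 10 * W.
  by rewrite nrmM; apply: ler_pM; rewrite ?nrm_ge0 ?kern_quad ?ray_cls0.
have h3 : nrm ((kern d - 1) * (ofR d * e * F')) <= d * m * 6 * (d * W).
  rewrite [nrm (_ * _)]nrmM; apply: ler_pM; rewrite ?nrm_ge0 ?kern_lip //.
  by rewrite nrmM; apply: ler_pM; rewrite ?nrm_ge0 ?nrm_step ?ray_cls1.
apply: le_trans (_ : d ^+ 2 * ((1 + m ^+ 2 * 10 + m * 6) * W) <= _); last first.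
  by rewrite ler_wpM2l ?sqr_ge0 // /W mulrA [_ * M]mulrC ler_wpM2r ?x0 // ler_wpM2l.
move: h1 h2 h3; set A := kern d * _; set B := (_ + _) * F; set E := _ * (_ * F').
move=> h1 h2 h3; have := nrmD (A + B) E; have := nrmD A B.
rewrite (_ : d ^+ 2 * _ = d ^+ 2 * W + (d * m) ^+ 2 * 10 * W + d * m * 6 * (d * W)); last by ring.
lra.
Qed.

End Fun.

(* The decaying solution of [x' = mu x + f]: minus the integral of
   [exp (mu (z - u)) f u] along the ray from [z] in the direction [e]. *)
Definition raysol (f : C -> C) (z : C) : C :=
  - e * Clim (rsum (fun r => kern r * f (z + ofR r * e))).

(** The derivative is first obtained as the ray integral of [- e f'], and [ray_ftc] identifies it
    with [mu x + f]. Differences and remainders of the solution are then ray integrals of those of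
    [f], since translation along the ray keeps [u - z]; nothing is differentiated under the
    integral. *)
Lemma raysolP k M f f' : cls lset lq k.+2 M f f' ->
  cls lset lq k.+1 (M / (c * k.+1%:R)) (raysol f) (fun z => mu * raysol f z + f z).
Proof.
move=> hf; have M0 := clsge0 hf.
have ck : 0 < c * k.+1%:R by rewrite mulr_gt0.
have H0 z : lset z -> clim (rsum (fun r => kern r * (- e * f (z + ofR r * e)))) (raysol f z).
  move=> hz; have [L /ClimP /(climZ (- e))] := ray_cvg hf hz.
  congr clim; apply/funext => n; rewrite -rsumZ; congr (rsum _ n).
  by apply/funext => r; rewrite mulrCA.
have H1 z : lset z -> clim (rsum (fun r => kern r * (- e * f' (z + ofR r * e))))
    (mu * raysol f z + f z).
  move=> hz; have := climD (climZ mu (H0 z hz)) (climZ (-1) (ray_ftc hf hz)).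
  rewrite mulN1r opprK; congr clim; apply/funext => n; rewrite -!rsumZ -rsumD; congr (rsum _ n).
  by apply/funext => r; ring.
have ne : nrm (- e) <= 1 by rewrite nrmN.
split=> [|z hz|z hz|u z hu hz|u z hu hz].
- by rewrite divr_ge0 // ltW.
- apply: (ray_bound M0 hz hz _ (H0 z hz)) => r r0; rewrite nrmM.
  by apply: le_trans (ler_piMl (nrm_ge0 _) ne) _; exact: ray_cls0 hf _ _ hz r0.
- apply: (ray_bound M0 hz hz _ (H1 z hz)) => r r0; rewrite nrmM.
  by apply: le_trans (ler_piMl (nrm_ge0 _) ne) _; exact: ray_cls1 hf _ _ hz r0.
- have := climD (H0 u hu) (climZ (-1) (H0 z hz)); rewrite mulN1r.
  rewrite (_ : (fun n => _) = rsum (fun r => kern r *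
    (- e * (f (u + ofR r * e) - f (z + ofR r * e))))); last first.
    by apply/funext => n; rewrite -rsumZ -rsumD; congr (rsum _ n); apply/funext => r; ring.
  have W0 : 0 <= nrm (u - z) * M by rewrite mulr_ge0 ?nrm_ge0.
  move/(ray_bound (k := k) W0 hu hz); rewrite !mulrA; apply=> r r0; rewrite nrmM.
  apply: le_trans (ler_piMl (nrm_ge0 _) ne) _.
  apply: le_trans (clsL hf (lset_ray hu r0) (lset_ray hz r0)) _.
  rewrite (_ : u + _ - _ = u - z); last by ring.
  rewrite -mulrA ler_wpM2l ?nrm_ge0 // ler_wpM2l //.
  by have := lq_ray k.+2 hu hz r0 (lexx 0); rewrite addr0.
- have := climD (climD (H0 u hu) (climZ (-1) (H0 z hz))) (climZ (- (u - z)) (H1 z hz)).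
  rewrite mulN1r mulNr.
  rewrite (_ : (fun n => _) = rsum (fun r => kern r *
    (- e * (f (u + ofR r * e) - f (z + ofR r * e) - (u - z) * f' (z + ofR r * e)))));
    last first.
    apply/funext => n; rewrite -!rsumZ -!rsumD; congr (rsum _ n); apply/funext => r; ring.
  have W0 : 0 <= nrm (u - z) ^+ 2 * M by rewrite mulr_ge0 ?exprn_ge0 ?nrm_ge0.
  move/(ray_bound (k := k) W0 hu hz); rewrite !mulrA; apply=> r r0; rewrite nrmM.
  apply: le_trans (ler_piMl (nrm_ge0 _) ne) _.
  have := clsQ hf (lset_ray hu r0) (lset_ray hz r0).
  rewrite (_ : u + _ - _ = u - z); last by ring.
  move=> h; apply: le_trans h _.
  rewrite -mulrA ler_wpM2l ?exprn_ge0 ?nrm_ge0 // ler_wpM2l //.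
  by have := lq_ray k.+2 hu hz r0 (lexx 0); rewrite addr0.
Qed.

(** [ray_ftc] represents [x] by [x' - mu x = h] alone, which excludes the solutions [exp (mu z)] of
    the homogeneous equation. If [h] is one order better than [x], the order of [x] comes back with
    a new constant. *)
Lemma ray_apriori k M x x' (h : C -> C) z m : cls lset lq k.+2 M x x' -> 0 <= m ->
  (forall u, lset u -> x' u = mu * x u + h u) ->
  (forall u, lset u -> nrm (h u) <= m * lq u u ^+ k.+3) ->
  lset z -> nrm (x z) <= m / (c * k.+2%:R) * lq z z ^+ k.+2.
Proof.
move=> hx m0 eqx hm hz; rewrite -nrmN.
apply: (ray_bound m0 hz hz _ (ray_ftc hx hz)) => r r0.
have hu := lset_ray hz r0.
rewrite eqx // addrAC subrr add0r nrmM.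
apply: le_trans (ler_piMl (nrm_ge0 _) e1) _.
apply: le_trans (hm _ hu) _; rewrite ler_wpM2l //.
by have := lq_ray k.+3 hz hz r0 (lexx 0); rewrite addr0.
Qed.

End OneRay.

Section System.
Variables (I : finType) (mu e : I -> C) (a a' : I -> I -> C -> C) (Ca : R).
Hypothesis e1 : forall i, nrm (e i) <= 1.
Hypothesis le : forall i z r, 0 <= r -> l z + c * r <= l (z + ofR r * e i).
Hypothesis mue : forall i, 0 <= complex.Re (mu i * e i).
Hypothesis ha : forall i j, cls lset lq 1 Ca (a i j) (a' i j).
Hypothesis Ca0 : 0 <= Ca.

(** A Neumann series. Multiplication by [a], of order 1, lifts order [k + 1] to [k + 2] at the cost
    [3 Ca] for each index, and [raysol] returns to order [k + 1]; the hypothesis says that one round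
    at least halves the constant. *)
Theorem system_solution k M (s s' : I -> C -> C) :
  (#|I|%:R * (3 * Ca)) / (c * k.+1%:R) <= 1 / 2 ->
  (forall i, cls lset lq k.+2 M (s i) (s' i)) ->
  exists x x' : I -> C -> C, forall i,
    cls lset lq k.+1 (2 * (M / (c * k.+1%:R))) (x i) (x' i) /\
    forall z, lset z -> x' i z = mu i * x i z + \sum_j a i j z * x j z + s i z.
Proof.
move=> hk hs; set M1 := M / (c * k.+1%:R).

(* [dlt n] is the n-th term of the Neumann series: the source is integrated once, then the coupling
   is applied again and again. *)
pose dlt := fix dlt n : I -> C -> C := fun i =>
  raysol (mu i) (e i) (fun z => if n is m.+1 then \sum_j a i j z * dlt m j z else s i z).
pose sr n i z := if n is m.+1 then \sum_j a i j z * dlt m j z else s i z.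
pose dlt' n i z := mu i * dlt n i z + sr n i z.
have dE n i : dlt n i = raysol (mu i) (e i) (sr n i) by case: n.
have M0 (i : I) : 0 <= M by exact: clsge0 (hs i).
have hd n i : cls lset lq k.+1 (M1 * 2^-1 ^+ n) (dlt n i) (dlt' n i).
  elim: n i => [|n IH] i.
    by rewrite expr0 mulr1 /dlt' dE; have := raysolP (e1 i) (le i) (mue i) (hs i); exact.
  have hsr : cls lset lq k.+2 (#|I|%:R * (3 * Ca) * (M1 * 2^-1 ^+ n)) (sr n.+1 i)
      (fun z => \sum_j (a' i j z * dlt n j z + a i j z * dlt' n j z)).
    have h0 := @cls_sum R _ _ I (index_enum I) xpredT k.+2 _ _ _
      (fun j _ => clsM lq_weight (ha i j) (IH j)).
    apply: (cls_le lq_weight _ h0); by rewrite sumr_const -[leLHS]mulr_natl !mulrA.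
  rewrite /dlt' dE; apply: (cls_le lq_weight _ (raysolP (e1 i) (le i) (mue i) hsr)).
  have M10 : 0 <= M1 * 2^-1 ^+ n.
    rewrite mulr_ge0 ?exprn_ge0 ?invr_ge0 // divr_ge0 ?(M0 i) //.
    by rewrite mulr_ge0 // ltW.
  rewrite exprS; set t := 2^-1 ^+ n in M10 *.
  rewrite mulrAC [leRHS](_ : _ = 1 / 2 * (M1 * t)); last by field.
  exact: ler_wpM2r.
have sumb (i : I) n : \sum_(m < n) M1 * 2^-1 ^+ m <= 2 * M1.
  have M10 : 0 <= M1 by rewrite divr_ge0 ?(M0 i) // mulr_ge0 // ltW.
  rewrite -mulr_sumr mulrC ler_wpM2r //.
  have -> : \sum_(m < n) 2^-1 ^+ m = 2 - 2 * 2^-1 ^+ n :> R.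
    elim: n => [|n IHn]; first by rewrite big_ord0 expr0; ring.
    by rewrite big_ord_recr /= IHn exprS; field.
  have h0 : 0 <= 2^-1 ^+ n :> R by rewrite exprn_ge0 // invr_ge0.
  by rewrite gerBl mulr_ge0.
have ex i : exists gg : (C -> C) * (C -> C), [/\ cls lset lq k.+1 (2 * M1) gg.1 gg.2,
    forall z, lset z -> clim (fun n => \sum_(m < n) dlt m i z) (gg.1 z) &
    forall z, lset z -> clim (fun n => \sum_(m < n) dlt' m i z) (gg.2 z)].
  have [g [g' hg]] := cls_series lq_weight (hd^~ i) (sumb i); by exists (g, g').
have [x hx] := choice ex.
exists (fun i => (x i).1), (fun i => (x i).2) => i; split; first by case: (hx i).
move=> z hz; case: (hx i) => _ h1 h2.
have sh (u : nat -> C) L : clim u L -> clim (fun n => u n.+1) L.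
  by move=> hu eps e0; have [K hK] := hu eps e0; exists K => n Kn; apply: hK; exact: leqW.
have H2 := sh _ _ (h2 z hz); apply: (clim_uniq H2).
(* The term of index 0 contributes the source and the others the coupling, which is why [n + 1]
   derivatives meet only [n] coupled terms. *)
have -> : (fun n => \sum_(m < n.+1) dlt' m i z) = (fun n =>
    (mu i * (\sum_(m < n.+1) dlt m i z) + \sum_j (a i j z * \sum_(m < n) dlt m j z)) + s i z).
  apply/funext => n; rewrite /dlt' big_split /= -mulr_sumr -addrA; congr (_ + _).
  rewrite big_ord_recl /= addrC; congr (_ + _).
  under [RHS]eq_bigr do rewrite mulr_sumr.
  by rewrite exchange_big.
apply: climD (clim_cst _); apply: climD.
  by apply: climZ; exact: (sh _ _ (h1 z hz)).
by apply: clim_sum => j; apply: climZ; case: (hx j) => _ + _; apply.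
Qed.

(** Each application of the a priori bound halves the constant in front of [lq^(k+2)]. *)
Theorem system_unique k M (x x' : I -> C -> C) :
  (#|I|%:R * Ca) / (c * k.+2%:R) <= 1 / 2 ->
  (forall i, cls lset lq k.+2 M (x i) (x' i)) ->
  (forall i z, lset z -> x' i z = mu i * x i z + \sum_j a i j z * x j z) ->
  forall i z, lset z -> x i z = 0.
Proof.
move=> hk hx eqx i z hz.
have M0 : 0 <= M by exact: clsge0 (hx i).
have q0 u (hu : lset u) j := wXge0 lq_weight j hu hu.
have H n : forall i u, lset u -> nrm (x i u) <= M * 2^-1 ^+ n * lq u u ^+ k.+2.
  elim: n => [|n IH] j u hu; first by rewrite expr0 mulr1; exact: cls0 (hx j) _ hu.
  have m0 : 0 <= M * 2^-1 ^+ n by rewrite mulr_ge0 // exprn_ge0 // invr_ge0.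
  have C0 : 0 <= #|I|%:R * Ca * (M * 2^-1 ^+ n) by rewrite !mulr_ge0.
  apply: le_trans (ray_apriori (e1 j) (le j) (mue j) (hx j) C0 (eqx j) _ hu) _.
    move=> v hv; apply: le_trans (nrm_sum _ _ _) _.
    apply: le_trans (_ : \sum_(i0 : I) Ca * (M * 2^-1 ^+ n) * lq v v ^+ k.+3 <= _).
      apply: ler_sum => i0 _; rewrite nrmM exprS mulrACA.
      apply: ler_pM; rewrite ?nrm_ge0 ?IH //.
      by have := cls0 (ha j i0) hv; rewrite expr1.
    by rewrite sumr_const -[leLHS]mulr_natl !mulrA.
  rewrite ler_wpM2r ?q0 // exprS; set t := 2^-1 ^+ n in m0 *.
  rewrite mulrAC [leRHS](_ : _ = 1 / 2 * (M * t)); last by field.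
  exact: ler_wpM2r.
apply: nrm_eq0; apply/eqP; rewrite eq_le nrm_ge0 andbT.
apply/ler_addgt0Pr => eps e0; rewrite add0r.
have [n hn] := dl_small (M * lq z z ^+ k.+2) e0.
by apply: le_trans (H n i z hz) _; rewrite mulrAC mulrC; exact: hn.
Qed.

End System.
End RaySolution.

(** * Jordan forms *)

Section JordanForm.
Variable R : realType.
Notation C := (Cx R).

(** The sum has at most one term; written as a sum, it needs no separate case for the last row. *)
Lemma mul_jordan_block m n mu (X : 'M[C]_(m, n)) i j :
  (jordan_block m mu *m X) i j =
    mu * X i j + \sum_(l < m | l == i.+1 :> nat) X l j.
Proof.
rewrite mxE; under eq_bigr do rewrite mxE mulrDl.
rewrite big_split /=; congr (_ + _).
  rewrite (bigD1 i) //= eqxx mulr1n big1 ?addr0 // => l /negPf li.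
  by rewrite eq_sym li mulr0n mul0r.
rewrite [RHS]big_mkcond; apply: eq_bigr => l _.
by rewrite eq_sym; case: eqP; rewrite ?mul1r ?mul0r.
Qed.

Lemma mul_mx_jordan_block m n mu (X : 'M[C]_(m, n)) i j :
  (X *m jordan_block n mu) i j =
    mu * X i j + \sum_(l < n | l.+1 == j :> nat) X i l.
Proof.
rewrite mxE; under eq_bigr do rewrite mxE mulrDr.
rewrite big_split /=; congr (_ + _).
  rewrite (bigD1 j) //= eqxx mulr1n mulrC big1 ?addr0 // => l /negPf li.
  by rewrite li mulr0n mulr0.
rewrite [RHS]big_mkcond; apply: eq_bigr => l _.
by case: eqP; rewrite ?mulr1 ?mulr0.
Qed.

Lemma mulmx_col m n p (A : 'M[C]_(m, n)) (B : 'M[C]_(n, p)) j :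
  A *m col j B = col j (A *m B).
Proof. by rewrite !colE mulmxA. Qed.

(** The operator is a square matrix on [mxvec], so injectivity is enough. A kernel element vanishes
    entry by entry from the bottom left corner: the nilpotent parts bring in only the entry below
    and the entry to the left, where [m - i + j] is smaller, and [mua - mub + c] is nonzero. *)
Lemma jordan_sylvester m n (mua mub c : C) (Y : 'M[C]_(m, n)) :
  mub - mua != c -> exists X : 'M[C]_(m, n),
    jordan_block m mua *m X - X *m jordan_block n mub + c *: X + Y = 0.
Proof.
move=> hc.
pose M := lin_mulmx (jordan_block m mua) - lin_mulmxr (jordan_block n mub) + c%:M
  : 'M[C]_(m * n).
have ME X : mxvec X *m M =
    mxvec (jordan_block m mua *m X - X *m jordan_block n mub + c *: X).
  by rewrite mulmxDr mulmxBr !mul_vec_lin /= mul_mx_scalar !linearD linearN linearZ.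
suff MU : M \in unitmx.
  exists (vec_mx (mxvec (- Y) *m invmx M)); apply: (can_inj (@mxvecK _ _ _)).
  by rewrite raddfD /= -ME vec_mxK mulmxKV // linearN addNr linear0.
rewrite -row_free_unit -kermx_eq0; apply/rowV0P => v /sub_kermxP.
rewrite -(vec_mxK v); set X := vec_mx v; rewrite ME => /eqP.
rewrite mxvec_eq0 => /eqP H.
suff -> : X = 0 by rewrite linear0.
suff Z t : forall (i : 'I_m) (j : 'I_n), (m - i + j <= t)%N -> X i j = 0.
  by apply/matrixP => i j; rewrite [RHS]mxE (Z (m - i + j)%N).
elim: t => [|t IH] i j hij.
  by move: hij; rewrite leqn0 addn_eq0 subn_eq0 leqNgt ltn_ord.
have E (A1 A2 A3 : 'M[C]_(m, n)) : A1 - A2 + c *: A3 = 0 -> A1 i j - A2 i j + c * A3 i j = 0.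
  by move/matrixP/(_ i j); rewrite !mxE.
have {E} := E _ _ _ H; rewrite mul_jordan_block mul_mx_jordan_block.
rewrite big1 ?addr0; last by move=> l /eqP li; apply: IH; have := ltn_ord i; have := ltn_ord l; lia.
rewrite big1 ?addr0; last by move=> l /eqP li; apply: IH; have := ltn_ord i; lia.
rewrite -mulrBl -mulrDl => /eqP; rewrite mulf_eq0 => /orP[|/eqP //].
rewrite -[_ + c]opprK oppr_eq0 opprD opprB subr_eq0 => /eqP E.
by rewrite E eqxx in hc.
Qed.

(* A vector [v] generating a Jordan chain of maximal length [h + 1], paired
   with a functional [psi] that is nonzero at the end of the chain: the chain
   has an invariant complement because the Gram matrix [v N^a N^b psi] vanishes
   for [a + b > h] and is nonzero for [a + b = h]. *)
Lemma jordan_chain n (A : 'M[C]_n.+1) :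
  exists h mu (P : 'M[C]_(h.+1, n.+1)) (Q : 'M[C]_(n.+1, h.+1)),
    [/\ P *m A = jordan_block h.+1 mu *m P, P *m Q \in unitmx &
      (kermx Q *m A <= kermx Q)%MS].
Proof.
set p := mxminpoly A.
have pn0 : p != 0 by rewrite monic_neq0 ?mxminpoly_monic.
have [mu pmu] : exists mu, root p mu.
  apply/closed_rootP; rewrite size_mxminpoly eqSS -lt0n; exact: mxminpoly_nonconstant.
have [m [r]] := multiplicity_XsubC p mu; rewrite pn0 /= => rmu pE.
case: m pE => [|h] pE; first by rewrite pE expr0 mulr1 (negPf rmu) in pmu.
(* With [p = r (X - mu)^(h+1)], the matrix [q = r(A)] satisfies [q N^(h+1) = 0], while [q N^h] is
   nonzero by minimality of [p]. Some row of [q] thus starts a chain of full length. *)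
set N := horner_mx A ('X - mu%:P); set q := horner_mx A r.
have NE : N = A - mu%:M by rewrite /N rmorphB /= horner_mx_X horner_mx_C.
have qN : q *m N ^+ h.+1 = 0.
  have := mx_root_minpoly A; rewrite -/p pE rmorphM rmorphXn /=; exact.
have hN a b : N ^+ a *m N ^+ b = N ^+ (a + b) by rewrite exprD.
have cqN a : q *m N ^+ a = N ^+ a *m q.
  by rewrite /q /N -rmorphXn; change (horner_mx A r * horner_mx A (('X - mu%:P) ^+ a) = horner_mx A (('X - mu%:P) ^+ a) * horner_mx A r); rewrite -!rmorphM mulrC.
have Z0 : q *m N ^+ h != 0.
  apply/eqP => Z; have : p %| r * ('X - mu%:P) ^+ h.
    by apply: mxminpoly_min; rewrite rmorphM rmorphXn.
  have r0 : r != 0 by apply: contraNneq rmu => ->; rewrite root0.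
  have e0 : r * ('X - mu%:P) ^+ h != 0 by rewrite mulf_neq0 ?expf_neq0 ?polyXsubC_eq0.
  move/(dvdp_leq e0); rewrite pE exprSr mulrA size_Mmonic ?monicXsubC // size_XsubC addn2 /=.
  by rewrite ltnn.
(* Modulo [X - mu] the polynomial [r] is the nonzero constant [r(mu)], so [q] multiplies [q N^h] by
   a nonzero scalar. This gives the value of the Gram matrix on its antidiagonal. *)
have [s rE] : exists s, r = r.[mu]%:P + s * ('X - mu%:P).
  have : root (r - r.[mu]%:P) mu by rewrite /root hornerD hornerN hornerC subrr.
  by move/factor_theorem => [s sE]; exists s; rewrite -sE addrC subrK.
have HM x y : horner_mx A x *m horner_mx A y = horner_mx A (x * y) by rewrite rmorphM.
have NX a : N ^+ a = horner_mx A (('X - mu%:P) ^+ a) by rewrite rmorphXn.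
have qE : q = r.[mu]%:M + horner_mx A s *m N.
  by rewrite /q {1}rE rmorphD rmorphM /= horner_mx_C.
have [i [j Zij]] : exists i j, (q *m N ^+ h) i j != 0.
  apply: contrapT => H; move/eqP: Z0; apply; apply/matrixP => i j; rewrite [RHS]mxE.
  by apply/eqP/negPn/negP => nz; apply: H; exists i, j.
pose P := \matrix_(a < h.+1) (row i q *m N ^+ a).
pose Q := (\matrix_(b < h.+1) (N ^+ b *m col j q)^T)^T.
have PQ a b : (P *m Q) a b = (q *m N ^+ (a + b) *m q) i j.
  have -> : (P *m Q) a b = (row a P *m col b Q) 0 0.
    by rewrite !mxE; apply: eq_bigr => l _; rewrite !mxE.
  rewrite rowK -tr_row rowK trmxK -mulmxA (mulmxA (N ^+ a)) hN.
  by rewrite mulmxA -row_mul mulmx_col -row_mul !mxE.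
have PQ0 (a b : 'I_h.+1) : (h < a + b)%N -> (P *m Q) a b = 0.
  move=> hab; rewrite PQ -(subnKC hab) -hN [q *m (_ *m _)]mulmxA qN !mul0mx.
  by rewrite mxE.
have PQ1 (a b : 'I_h.+1) : (a + b = h)%N -> (P *m Q) a b = r.[mu] * (q *m N ^+ h) i j.
  move=> hab; rewrite PQ hab {2}qE mulmxDr mul_mx_scalar.
  rewrite (_ : q *m N ^+ h *m (horner_mx A s *m N) = 0) ?addr0 1?mxE //.
  have qN' : horner_mx A (r * ('X - mu%:P) ^+ h.+1) = 0 by rewrite -HM -NX.
  rewrite NX /q /N !HM.
  rewrite (_ : _ * _ = (r * ('X - mu%:P) ^+ h.+1) * s); last by rewrite exprSr; ring.
  by rewrite -HM qN' mul0mx.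
have Gij : r.[mu] * (q *m N ^+ h) i j != 0 by rewrite mulf_neq0.
have AE : A = N + mu%:M by rewrite NE subrK.
exists h, mu, P, Q; split.
- apply/matrixP => a b; rewrite mul_jordan_block.
  have PE (a' : 'I_h.+1) : P a' b = (row i q *m N ^+ a') 0 b.
    by rewrite -[in RHS](rowK (fun a => row i q *m N ^+ a)) [RHS]mxE.
  have -> : (P *m A) a b = (row i q *m N ^+ a *m A) 0 b.
    by rewrite -(rowK (fun a => row i q *m N ^+ a)) -row_mul [RHS]mxE.
  rewrite {1}AE mulmxDr mul_mx_scalar -mulmxA mxE [X in _ + X]mxE addrC PE; congr (_ + _).
  rewrite (_ : N ^+ a *m N = N ^+ a.+1); last by rewrite exprSr.
  have [ah|ah] := ltnP a h.
    rewrite (big_pred1 (Ordinal (n := h.+1) (m := a.+1) ah)) ?PE //.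
  have ae : a = h :> nat by apply/eqP; rewrite eqn_leq ah -ltnS ltn_ord.
  rewrite ae -row_mul qN row0 mxE big1 // => l /eqP El.
  by have := ltn_ord l; rewrite El ltnn.
- rewrite -row_free_unit -kermx_eq0; apply/rowV0P => v /sub_kermxP vG.
  (* Column [h - t] of the relation isolates the entry [t]: later entries meet zeros of the Gram
     matrix, earlier ones vanish by induction. *)
  suff Z t : forall a : 'I_h.+1, a = t :> nat -> v 0 a = 0.
    by apply/matrixP => x a; rewrite mxE ord1 (Z a).
  elim/ltn_ind: t => t IH a at_.
  have hb : (h - a < h.+1)%N by rewrite ltnS leq_subr.
  have ah : (a <= h)%N by rewrite -ltnS ltn_ord.
  have := congr1 (fun M : 'rV_h.+1 => M 0 (Ordinal hb)) vG; rewrite mxE [RHS]mxE.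
  rewrite (bigD1 a) //= PQ1 ?subnKC // big1 ?addr0 => [/eqP|l la].
    by rewrite mulf_eq0 (negPf Gij) orbF => /eqP.
  have [l_a|l_a] := ltnP l a; first by rewrite (IH l) ?mul0r // -at_.
  have {}la : (l : nat) != a by [].
  by rewrite PQ0 ?mulr0 //=; lia.
- apply/sub_kermxP; apply/matrixP => x b; rewrite [RHS]mxE.
  have QE (b' : 'I_h.+1) : col b' Q = N ^+ b' *m col j q by rewrite -tr_row rowK trmxK.
  have KQ (b' : 'I_h.+1) : kermx Q *m (N ^+ b' *m col j q) = 0.
    by rewrite -QE mulmx_col mulmx_ker col0.
  have -> : (kermx Q *m A *m Q) x b = (kermx Q *m A *m (N ^+ b *m col j q)) x 0.
    by rewrite -QE mulmx_col [RHS]mxE.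
  rewrite {1}AE -mulmxA mulmxDl mul_scalar_mx mulmxDr -scalemxAr KQ scaler0 addr0.
  rewrite [N *m (_ *m _)]mulmxA (_ : N *m N ^+ b = N ^+ b.+1); last by rewrite exprS.
  have [bh|bh] := ltnP b h.
    by rewrite (KQ (Ordinal (n := h.+1) (m := b.+1) bh)) mxE.
  have be : b = h :> nat by apply/eqP; rewrite eqn_leq bh -ltnS ltn_ord.
  by rewrite be mulmx_col -cqN qN col0 mulmx0 mxE.
Qed.

(** Spanning is asked instead of a direct sum: since the sizes add up to [n], the stacked matrix is
    square and row fullness makes it invertible. *)
Lemma jordan_basis n (A : 'M[C]_n) :
  exists k (sz : 'I_k -> nat) (eg : 'I_k -> C) (P : forall a, 'M[C]_(sz a, n)),
    [/\ forall a, (0 < sz a)%N, (\sum_a sz a)%N = n,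
      forall a, P a *m A = jordan_block (sz a) (eg a) *m P a &
      (1%:M <= \sum_a <<P a>>)%MS].
Proof.
elim/ltn_ind: n A => -[|n] IH A.
  exists 0%N, (fun=> 0%N), (fun=> 0), (fun=> 0); split=> [[]//||[]//|].
    by rewrite big_ord0.
  by rewrite thinmx0 sub0mx.
have [h [mu [P [Q [PA PQ KA]]]]] := jordan_chain A.
pose W := row_base (kermx Q).
have rQ : \rank Q = h.+1.
  apply/eqP; rewrite eqn_leq rank_leq_col /=.
  by have := mxrankM_maxr P Q; rewrite (mxrank_unit PQ).
have rK : \rank (kermx Q) = (n - h)%N by rewrite mxrank_ker rQ subSS.
have hn : (h <= n)%N by have := rank_leq_row Q; rewrite rQ.
have WA : stablemx W A.
  by rewrite (eqmxMr _ (eq_row_base _)) eq_row_base.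
have sim : W *m A = conjmx W A *m W.
  by apply: similarPp WA _; rewrite /similar_to /= eqxx.
have := IH (\rank (kermx Q)) _ (conjmx W A).
rewrite {1}rK ltnS leq_subr => /(_ isT) [k [sz [eg [P' [sz0 szn PA' P1]]]]].
pose sz' (o : option 'I_k) := oapp sz h.+1 o.
pose eg' (o : option 'I_k) := oapp eg mu o.
pose Po (o : option 'I_k) : 'M[C]_(sz' o, n.+1) :=
  match o with Some a => P' a *m W | None => P end.
exists k.+1, (sz' \o unlift ord0), (eg' \o unlift ord0), (fun a => Po (unlift ord0 a)).
split.
- by move=> a /=; case: (unlift ord0 a) => [b|] //=.
- rewrite big_ord_recl /= unlift_none /=.
  under eq_bigr do rewrite liftK /=.
  by rewrite szn rK addSn subnKC.
- move=> a /=; case: (unlift ord0 a) => [b|] //=.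
  by rewrite -[LHS]mulmxA sim [LHS]mulmxA PA' -mulmxA.
- pose F o := <<Po o>>%MS; rewrite -/(F _).
  rewrite (eq_bigr (fun a => F (unlift ord0 a))) // big_ord_recl unlift_none.
  under eq_bigr do rewrite liftK.
  have hW : (kermx Q <= \sum_(i < k) F (Some i))%MS.
    rewrite -(eq_row_base (kermx Q)) -/W -[W]mul1mx.
    apply: submx_trans (submxMr W P1) _; rewrite sumsmxMr_gen.
    apply/sumsmx_subP => i _; apply: submx_trans (sumsmx_sup i _ (submx_refl _)) => //.
    by rewrite /F !genmxE /= (eqmxMr _ (genmxE _)).
  (* The projection onto the chain along the left kernel of [Q]; [1 - G] then has its rows in that
     kernel. *)
  pose G := Q *m invmx (P *m Q) *m P.
  have -> : 1%:M = G + (1%:M - G) by rewrite addrC subrK.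
  apply: addmx_sub_adds; first by rewrite /F genmxE submxMl.
  apply: submx_trans hW; apply/sub_kermxP.
  by rewrite mulmxBl mul1mx /G -!mulmxA mulVmx // mulmx1 subrr.
Qed.

Lemma jordan_form n (A : 'M[C]_n) :
  exists d : jordan_data R n, similar_in unitmx A (jordan_mx d).
Proof.
have [k [sz [eg [P [sz0 szn PA P1]]]]] := jordan_basis A.
subst n; exists (JordanData eg sz0 erefl).
have fullP : row_full (\mxcol_a P a).
  by rewrite -sub1mx eqmx_col.
exists (\mxcol_a P a); first by rewrite -row_full_unit.
apply/similarP; first by rewrite -row_full_unit.
rewrite /jordan_mx castmx_id mxcol_mul mul_mxdiag_mxcol.
by apply: eq_mxcol => a; exact: PA.
Qed.

End JordanForm.

Section JordanData.
Variable R : realType.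
Notation C := (Cx R).

Lemma jordan_eigenvalue p (d : jordan_data R p) a :
  eigenvalue (jordan_mx d) (jeig d a).
Proof.
case: d a => k sz eg sz0 e; subst p => a /=; rewrite /jordan_mx castmx_id /=.
set J := \mxdiag_(a < k) _.
pose V := submxcol (1%:M : 'M[C]_(\sum_a sz a)) a.
have VJ : V *m J = jordan_block (sz a) (eg a) *m V.
  by rewrite submxcol_mul mul1mx -[J]mulmx1 -(submxcolK 1%:M) mul_mxdiag_mxcol mxcolK.
have V1 : V *m submxrow 1%:M a = 1%:M.
  rewrite submxcol_mul mul1mx -submxblockEh.
  by rewrite -mxdiagZ submxblock_diag.
have [n sn] : exists n, sz a = n.+1 by move: (sz0 a); case: (sz a) => // n _; exists n.
have hl : (n < sz a)%N by rewrite sn.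
(* For row vectors and ones above the diagonal, the eigenvector of a block is the last basis
   vector. *)
pose u : 'rV[C]_(sz a) := delta_mx 0 (Ordinal hl).
have uJ : u *m jordan_block (sz a) (eg a) = eg a *: u.
  apply/matrixP => x j; rewrite mul_mx_jordan_block [RHS]mxE big1 ?addr0 // => l /eqP lj.
  rewrite mxE (_ : (l == Ordinal hl) = false) ?andbF //.
  by apply/eqP => /(congr1 val) /= ln; have := ltn_ord j; rewrite -lj ln sn ltnn.
apply/eigenvalueP; exists (u *m V); first by rewrite -mulmxA VJ mulmxA uJ scalemxAl.
apply/eqP => u0; have : u *m V *m submxrow 1%:M a = 0 by rewrite u0 mul0mx.
rewrite -mulmxA V1 mulmx1 => /matrixP/(_ 0 (Ordinal hl)); rewrite !mxE !eqxx /= => /eqP.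
by rewrite oner_eq0.
Qed.

Lemma jordan_max_difference p (d : jordan_data R p) : (0 < p)%N ->
  exists m, max_integer_difference (jordan_mx d) m.
Proof.
move=> p0.
have [a _] : exists a : 'I_(jnum d), true.
  have := jsize_sum d; case: (jnum d) (jsize d) => [|n] sz; last by exists ord0.
  by rewrite big_ord0 => e; rewrite -e in p0.
pose P k := `[< exists x y, [/\ eigenvalue (jordan_mx d) x, eigenvalue (jordan_mx d) y
  & x - y = k%:R :> C] >].
have P0 : exists k, P k.
  exists 0%N; apply/asboolP; exists (jeig d a), (jeig d a).
  by rewrite jordan_eigenvalue subrr.
have [s sE] := closed_field_poly_normal (char_poly (jordan_mx d)).
have se x : eigenvalue (jordan_mx d) x -> x \in s.
  rewrite eigenvalue_root_char sE rootZ ?root_prod_XsubC //.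
  by rewrite lead_coef_eq0 monic_neq0 ?char_poly_monic.
(* Every integer difference occurs among the summands, so their sum is an upper bound. *)
pose B := (\sum_(x <- s) \sum_(y <- s) (Num.truncn (nrm (x - y))))%N.
have PB k : P k -> (k <= B)%N.
  move=> /asboolP[x [y [/se xs /se ys xy]]].
  have -> : k = Num.truncn (nrm (x - y)) by rewrite xy nrm_nat natrK.
  rewrite /B (big_rem x) //= (big_rem y) //= -addnA; exact: leq_addr.
pose m := ex_maxn P0 PB; exists m; rewrite /m; case: ex_maxnP => i /asboolP Pi Hi.
split=> // x y k hx hy xy; apply: Hi; apply/asboolP; by exists x, y.
Qed.

(** [D] is the floor of the real part of the eigenvalue, hence scalar on each Jordan block, so it
    commutes with [S]. On a resonant block the eigenvalues differ by exactly [l], and so do their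
    floors, which gives the commutator. *)
Lemma jordan_integer_part p (d : jordan_data R p) :
  exists D S, [/\ integer_part_decomposition (jordan_mx d) D S, D *m S = S *m D &
    forall l M, resonant_of_order d l M -> D *m M = M *m D - l%:R *: M].
Proof.
case: d => k sz eg sz0 e; subst p.
pose fl a : int := Num.floor (complex.Re (eg a)).
pose dS := JordanData (fun a => eg a - (fl a)%:~R) sz0 erefl.
exists (\mxdiag_a ((fl a)%:~R)%:M), (jordan_mx dS).
rewrite /jordan_mx castmx_id; split; last first.
- move=> l M hM; have {}hM a b : submxblock M a b != 0 -> eg b - eg a = l%:R.
    by have := hM a b; rewrite /jordan_subblock /= castmx_id.
  rewrite -[M]submxblockK mul_mxdiag_mxblock mul_mxblock_mxdiag -mul_scalar_mx.
  rewrite -mxdiagZ mul_mxdiag_mxblock -mxblockB; apply: eq_mxblock => a b.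
  have [->|/hM ba] := eqVneq (submxblock M a b) 0.
    by rewrite !(mulmx0, mul0mx) subrr.
  rewrite !mul_scalar_mx mul_mx_scalar -scalerBl; congr (_ *: _).
  have -> : fl b = fl a + l%:Z; last by rewrite rmorphD /= addrK.
  rewrite /fl (_ : eg b = eg a + l%:R); last by rewrite -ba addrC subrK.
  rewrite cReD (_ : complex.Re l%:R = l%:~R); last by rewrite -ofR_nat.
  by rewrite floorDrz ?rpred_int // intrKfloor.
- rewrite [_ *m \mxdiag_i _]mul_mxblock_mxdiag mul_mxdiag_mxblock; apply: eq_mxblock => a b.
  case: eqVneq => [ab|ab]; last by rewrite mulmx0 mul0mx.
  by case: _ / ab; rewrite conform_mx_id scalar_mxC.
split.
- rewrite -mxdiagD; apply: eq_mxdiag => a; apply/matrixP => i j; rewrite !mxE.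
  case: (i == j); rewrite ?mulr1n ?mulr0n ?add0r //=.
  by rewrite addrA [_ + (_ - _)]addrC subrK.
- apply/is_diag_mxblockP; split=> [a b /negPf ab|a]; first by rewrite ab.
  by rewrite eqxx conform_mx_id scalar_mx_is_diag.
- move=> i; exists (fl (tagnat.sig1 i)); by rewrite mxE eqxx conform_mx_id mxE eqxx mulr1n.
- by exists dS; rewrite /jordan_mx castmx_id.
- have ne1 m : (m.+1 == m) = false by apply/eqP; lia.
  move=> i; rewrite castmx_id mxE eqxx conform_mx_id !mxE eqxx mulr1n ne1 addr0 /=.
  rewrite cReD cReN -/(fl _) (_ : complex.Re (fl _)%:~R = (fl (tagnat.sig1 i))%:~R); last first.
    by rewrite -(rmorph_int (real_complex R)).
  have := floor_itv (complex.Re (eg (tagnat.sig1 i))); rewrite -/(fl _) rmorphD /=.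
  by move=> /andP[h1 h2]; rewrite subr_ge0 h1 ltrBlDl.
Qed.

Lemma jordan_homological p (d : jordan_data R p) (k : nat) (Y : 'M[C]_p) :
  exists X Z, jordan_mx d *m X - X *m jordan_mx d + k%:R *: X + Y = Z /\
    resonant_of_order d k Z.
Proof.
case: d => n sz eg sz0 e; subst p.
have ex a b : exists XZ : 'M[C]_(sz a, sz b) * 'M[C]_(sz a, sz b),
   jordan_block (sz a) (eg a) *m XZ.1 - XZ.1 *m jordan_block (sz b) (eg b)
     + k%:R *: XZ.1 + submxblock Y a b = XZ.2 /\ (XZ.2 != 0 -> eg b - eg a = k%:R).
  have [h|h] := eqVneq (eg b - eg a) k%:R.
    by exists (0, submxblock Y a b); rewrite mulmx0 mul0mx scaler0 subrr !add0r.
  have [X hX] := jordan_sylvester (submxblock Y a b) h.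
  by exists (X, 0); rewrite hX eqxx.
pose f a b := sval (cid (ex a b)).
have fP a b := svalP (cid (ex a b)).
exists (\mxblock_(a, b) (f a b).1), (\mxblock_(a, b) (f a b).2); split.
  rewrite /jordan_mx castmx_id /= mul_mxdiag_mxblock mul_mxblock_mxdiag.
  rewrite -mul_scalar_mx -mxdiagZ mul_mxdiag_mxblock -{1}[Y]submxblockK.
  rewrite -mxblockB -!mxblockD; apply: eq_mxblock => a b.
  by rewrite mul_scalar_mx; case: (fP a b).
move=> a b; rewrite /jordan_subblock /= castmx_id mxblockK; exact: (fP a b).2.
Qed.

End JordanData.

(** * Formal normal form *)

Section FormalSolution.
Variable R : realType.
Notation C := (Cx R).

(** Course-of-values recursion for a relation. The history is masked by [x0] from [k] on, so the
    value at [k] can depend on earlier values only; it is built by extending the list of the first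
    [k] values. *)
Lemma strong_choice (T : Type) (x0 : T) (P : nat -> (nat -> T) -> T -> Prop) :
  (forall k h, exists x, P k h x) ->
  exists f : nat -> T, forall k, P k (fun j => if (j < k)%N then f j else x0) (f k).
Proof.
move=> hP; have /choice[g hg] : forall kh, exists x, P kh.1 kh.2 x.
  by move=> [k h]; exact: hP.
pose l := fix l k := if k is k'.+1 then rcons (l k') (g (k', nth x0 (l k'))) else [::].
have sl k : size (l k) = k by elim: k => //= k IH; rewrite size_rcons IH.
pose f k := nth x0 (l k.+1) k.
have lf k j : nth x0 (l k) j = if (j < k)%N then f j else x0.
  elim: k => [|k IH]; first by rewrite /= nth_nil.
  rewrite /= nth_rcons sl IH ltnS; case: (ltngtP j k) => [//|//|->].
  by rewrite /f /= nth_rcons sl ltnn eqxx.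
exists f => k; rewrite (_ : (fun j => _) = nth x0 (l k)); last by apply/funext => j; rewrite lf.
have -> : f k = g (k, nth x0 (l k)) by rewrite /f /= nth_rcons sl ltnn eqxx.
exact: (hg (k, nth x0 (l k))).
Qed.

Variables (s : nat) (p : 'I_s -> nat).
Notation n := (\sum_(i < s) p i)%N.

Lemma submxblock_mul_diagr (A : 'M[C]_n) (D : forall i, 'M[C]_(p i)) i j :
  submxblock (A *m \mxdiag_i D i) i j = submxblock A i j *m D j.
Proof. by rewrite -{1}[A]submxblockK mul_mxblock_mxdiag mxblockK. Qed.

Lemma submxblock_mul_diagl (A : 'M[C]_n) (D : forall i, 'M[C]_(p i)) i j :
  submxblock (\mxdiag_i D i *m A) i j = D i *m submxblock A i j.
Proof. by rewrite -{1}[A]submxblockK mul_mxdiag_mxblock mxblockK. Qed.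

Variables (lambda : 'I_s -> C) (hl : injective lambda).
Variables (Jd : forall i, jordan_data R (p i)) (At : nat -> 'M[C]_n).

Notation Lambda := (\mxdiag_(i < s) ((lambda i)%:M : 'M[C]_(p i))).
Notation J := (\mxdiag_(i < s) jordan_mx (Jd i)).

(** The factor [1/z] in front of the bracket puts [R_(l)] at index [l + 1]. *)
Definition normal_form_coef (Rr : nat -> forall i, 'M[C]_(p i)) j : 'M[C]_n :=
  match j with 0%N => Lambda | 1%N => J | j'.+2 => \mxdiag_i Rr j'.+1 i end.

Lemma submxblock_commutator (F : 'M[C]_n) i j :
  submxblock (Lambda *m F - F *m Lambda) i j = (lambda i - lambda j) *: submxblock F i j.
Proof.
rewrite submxblockB submxblock_mul_diagl submxblock_mul_diagr.
by rewrite mul_scalar_mx mul_mx_scalar scalerBl.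
Qed.

Hypotheses (A0 : At 0%N = Lambda)
  (A1 : forall i, submxblock (At 1%N) i i = jordan_mx (Jd i)).

(** [F k] is fixed by two consecutive equations. Order [k] determines its off-diagonal blocks [O],
    through the commutator with [Lambda], which vanishes on diagonal blocks; the diagonal blocks of
    order [k + 1] then determine its diagonal part, with [O] entering through [At 1] and [R_(k)]
    taking up the obstruction. *)
Lemma formal_step k (W V : 'M[C]_n) :
  exists FR : 'M[C]_n * (forall i, 'M[C]_(p i)),
    [/\ forall i j, i != j ->
          submxblock (Lambda *m FR.1 - FR.1 *m Lambda + W) i j = 0,
        forall i, submxblock (At 1%N *m FR.1 - FR.1 *m J + k%:R *: FR.1 + V) i i = FR.2 i &
        forall i, resonant_of_order (Jd i) k (FR.2 i)].
Proof.
pose O : 'M[C]_n := \mxblock_(i, j)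
  (if i == j then 0 else (lambda j - lambda i)^-1 *: submxblock W i j).
pose Y i := submxblock (At 1%N *m O + V) i i.
pose XZ i := cid (jordan_homological (Jd i) k (Y i)).
pose X i := sval (XZ i); pose Z i := sval (cid (svalP (XZ i))).
have hXZ i : jordan_mx (Jd i) *m X i - X i *m jordan_mx (Jd i) + k%:R *: X i + Y i = Z i
  /\ resonant_of_order (Jd i) k (Z i) := svalP (cid (svalP (XZ i))).
exists (O + \mxdiag_i X i, Z); split=> [i j ij|i|i] /=; last exact: (hXZ i).2.
  rewrite submxblockD submxblock_commutator submxblockD mxblockK (negPf ij).
  rewrite (_ : submxblock (\mxdiag_i X i) i j = 0) ?addr0; last first.
    by rewrite mxblockK (negPf ij).
  rewrite scalerA -[lambda j - _]opprB invrN mulrN mulfV ?scaleN1r ?addNr //.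
  by rewrite subr_eq0 (inj_eq hl).
have O0 : submxblock O i i = 0 by rewrite mxblockK eqxx.
rewrite -(hXZ i).1 /Y mulmxDr mulmxDl scalerDr !submxblockD !submxblockN !submxblockD.
rewrite !submxblock_mul_diagr A1 O0 mul0mx add0r submxblock_diag.
have sZ (M : 'M[C]_n) : submxblock (k%:R *: M) i i = k%:R *: submxblock M i i.
  by apply/matrixP => a b; rewrite !mxE.
rewrite !sZ O0 scaler0 add0r submxblock_diag -!addrA.
move: (submxblock _ _ _) (submxblock _ _ _) => a b.
by rewrite addrCA; congr (_ + _); rewrite addrCA; congr (_ + _); rewrite addrCA.
Qed.

(** The equation of order [k] without the commutator of [Lambda] and [F k]. *)
Definition known_part k (F B : nat -> 'M[C]_n) : 'M[C]_n :=
  \sum_(i < k) (At i.+1 *m F (k - i.+1)%N - F (k - i.+1)%N *m B i.+1) + k.-1%:R *: F k.-1.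

(** What remains of the equation of order [k + 1] once the commutator with [F (k + 1)] and all terms
    in [F k] and [B (k + 1)] are removed. *)
Definition next_part k (F B : nat -> 'M[C]_n) : 'M[C]_n :=
  \sum_(i < k) At i.+2 *m F (k - i.+1)%N - \sum_(i < k.-1) F (k - i.+1)%N *m B i.+2.

Lemma known_part_ext k F F' B B' : (forall j, (j < k.+1)%N -> F j = F' j) ->
  (forall j, (j < k.+1)%N -> B j.+1 = B' j.+1) -> known_part k.+1 F B = known_part k.+1 F' B'.
Proof.
move=> hF hB; rewrite /known_part [F k.+1.-1]hF //; congr (_ + _).
by apply: eq_bigr => i _; rewrite hF ?hB // ltn_subrL.
Qed.

Lemma next_part_ext k F F' B B' : (forall j, (j < k.+1)%N -> F j = F' j) ->
  (forall j, (j < k.+1)%N -> B j.+1 = B' j.+1) -> next_part k.+1 F B = next_part k.+1 F' B'.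
Proof.
move=> hF hB; rewrite /next_part; congr (_ - _); apply: eq_bigr => i _.
  by rewrite hF // ltn_subrL.
by rewrite hF ?hB // ?ltn_subrL //; have := ltn_ord i.
Qed.

Lemma known_partS k F B : F 0%N = 1%:M ->
  known_part k.+2 F B =
    At 1%N *m F k.+1 - F k.+1 *m B 1%N + k.+1%:R *: F k.+1 + next_part k.+1 F B - B k.+2.
Proof.
move=> F0; rewrite /known_part big_ord_recl /= subSS subn0 -!addrA; congr (_ + (_ + _)).
rewrite addrC; congr (_ + _); rewrite sumrB /next_part; congr (_ + _).
rewrite [X in - X = _]big_ord_recr /= !subSS subnn F0 mul1mx opprD.
by congr (- _ - _); apply: eq_bigr => i _; rewrite subSS.
Qed.

Theorem formal_solution : exists (F : nat -> 'M[C]_n) (Rr : nat -> forall i, 'M[C]_(p i)),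
  [/\ F 0%N = 1%:M, forall k i, (0 < k)%N -> resonant_of_order (Jd i) k (Rr k i) &
    forall k, \sum_(j < k.+1)
       (At j *m F (k - j)%N - F (k - j)%N *m normal_form_coef Rr j) + k.-1%:R *: F k.-1 = 0].
Proof.
pose T := ('M[C]_n * (forall i, 'M[C]_(p i)))%type.
pose fF (h : nat -> T) j := (h j).1.
pose fB (h : nat -> T) := normal_form_coef (fun j => (h j).2).
pose P k (h : nat -> T) (x : T) := if k is 0%N then x.1 = 1%:M else
  [/\ forall i j, i != j ->
        submxblock (Lambda *m x.1 - x.1 *m Lambda + known_part k (fF h) (fB h)) i j = 0,
      forall i, submxblock (At 1%N *m x.1 - x.1 *m J + k%:R *: x.1 +
        next_part k (fF h) (fB h)) i i = x.2 i &
      forall i, resonant_of_order (Jd i) k (x.2 i)].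
pose x0 : T := (0, fun i => 0).
have [f hf] : exists f : nat -> T, forall k, P k (fun j => if (j < k)%N then f j else x0) (f k).
  apply: strong_choice => -[|k] h; first by exists (1%:M, fun i => 0).
  exact: formal_step.
have f0 : fF f 0%N = 1%:M := hf 0%N.
have EF k j : (j < k.+1)%N -> fF (fun j => if (j < k.+1)%N then f j else x0) j = fF f j.
  by rewrite /fF => ->.
have EB k j : (j < k.+1)%N -> fB (fun j => if (j < k.+1)%N then f j else x0) j.+1 = fB f j.+1.
  by case: j => [//|j] hj; apply: eq_mxdiag => i; rewrite hj.
exists (fF f), (fun k => (f k).2); split=> //.
  by move=> [//|k] i _; case: (hf k.+1) => _ _; apply.
rewrite -/(fB f) => -[|k].
  by rewrite big_ord1 /= scale0r addr0 A0 f0 mul1mx mulmx1 subrr.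
rewrite big_ord_recl /= subn0 A0.
have -> : \sum_(i < k.+1) (At (bump 0 i) *m fF f (k.+1 - bump 0 i)%N -
  fF f (k.+1 - bump 0 i)%N *m fB f (bump 0 i)) =
  known_part k.+1 (fF f) (fB f) - k%:R *: fF f k by rewrite /known_part /= addrK.
rewrite addrA subrK; apply/mxblockP => i j; rewrite submxblock0.
have [<-{j}|ij] := eqVneq i j; last first.
  have [h _ _] := hf k.+1; have := h _ _ ij.
  by rewrite (known_part_ext (EF k) (EB k)).
rewrite submxblockD submxblock_commutator subrr scale0r add0r.
(* The diagonal blocks of order 1 vanish because [J] is the diagonal of [At 1]; those of any later
   order were arranged one step earlier. *)
case: k => [|k].
  rewrite /known_part big_ord1 /= f0 scale0r addr0 mulmx1 mul1mx.
  by rewrite submxblockB A1 submxblock_diag subrr.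
have [_ h _] := hf k.+1; rewrite known_partS // submxblockB submxblock_diag.
by have := h i; rewrite (next_part_ext (EF k) (EB k)) => ->; rewrite subrr.
Qed.

End FormalSolution.

(** * Rules for pointwise complex derivatives *)

Section ComplexDerivative.
Variable R : realType.
Notation C := (Cx R).

Lemma qder_lip (f : C -> C) z d : qder f z d ->
  exists K r : R, [/\ 0 < r, 0 <= K & forall u, nrm (u - z) <= r ->
    nrm (f u - f z) <= nrm (u - z) * K].
Proof.
move=> [K [r [r0 h]]]; exists (r * `|K| + nrm d), r.
have d0 := nrm_ge0 d; split=> //; first by rewrite addr_ge0 ?mulr_ge0 // ltW.
move=> u hu; have u0 := nrm_ge0 (u - z).
have -> : f u - f z = (f u - f z - (u - z) * d) + (u - z) * d by rewrite subrK.
apply: le_trans (nrmD _ _) _; rewrite nrmM [leRHS]mulrDr; apply: lerD => //.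
apply: le_trans (h u hu) _; rewrite expr2 -mulrA ler_wpM2l //.
apply: le_trans (_ : nrm (u - z) * `|K| <= _); first by rewrite ler_wpM2l // ler_norm.
by rewrite ler_wpM2r.
Qed.

Lemma qder_cst (a z : C) : qder (fun=> a) z 0.
Proof.
exists 0, 1; split=> // u _; by rewrite subrr mulr0 subr0 nrm0 mulr0.
Qed.

Lemma qder_id (z : C) : qder id z 1.
Proof. by exists 0, 1; split=> // u _; rewrite mulr1 subrr nrm0 mulr0. Qed.

Lemma qderD f g z a b : qder f z a -> qder g z b ->
  qder (fun w : C => f w + g w) z (a + b).
Proof.
move=> [K [r [r0 h]]] [K' [r' [r0' h']]]; exists (K + K'), (Num.min r r').
split=> [|u]; first by rewrite lt_min r0.
rewrite le_min => /andP[/h h1 /h' h2].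
have -> : f u + g u - (f z + g z) - (u - z) * (a + b) =
  (f u - f z - (u - z) * a) + (g u - g z - (u - z) * b) by ring.
by rewrite [leRHS]mulrDr; apply: le_trans (nrmD _ _) _; exact: lerD.
Qed.

Lemma qderM f g z a b : qder f z a -> qder g z b ->
  qder (fun w : C => f w * g w) z (a * g z + f z * b).
Proof.
move=> hf hg; have [L [s [s0 L0 hL]]] := qder_lip hf; have [L' [s' [s0' L0' hL']]] := qder_lip hg.
case: hf => [K [r [r0 h]]]; case: hg => [K' [r' [r0' h']]].
exists (nrm (f z) * K' + K * nrm (g z) + L * L').
exists (Num.min (Num.min r r') (Num.min s s')).
split=> [|u]; first by rewrite !lt_min r0 r0' s0 s0'.
rewrite !le_min => /andP[/andP[/h h1 /h' h2] /andP[/hL h3 /hL' h4]].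
have -> : f u * g u - f z * g z - (u - z) * (a * g z + f z * b) =
  f z * (g u - g z - (u - z) * b) + (f u - f z - (u - z) * a) * g z
    + (f u - f z) * (g u - g z) by ring.
apply: le_trans (nrmD _ _) _; rewrite [leRHS]mulrDr; apply: lerD.
  apply: le_trans (nrmD _ _) _; rewrite [leRHS]mulrDr !nrmM; apply: lerD.
    by rewrite mulrCA ler_wpM2l ?nrm_ge0.
  by rewrite mulrA ler_wpM2r ?nrm_ge0.
rewrite nrmM expr2 mulrACA; apply: ler_pM; rewrite ?nrm_ge0 //.
Qed.

Lemma qder_comp f g z a b : qder f (g z) a -> qder g z b ->
  qder (fun w : C => f (g w)) z (a * b).
Proof.
move=> [K [r [r0 h]]] hg; have [L [s [s0 L0 hL]]] := qder_lip hg.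
case: hg => [K' [r' [r0' h']]].
exists (L ^+ 2 * `|K| + nrm a * K'), (Num.min r' (Num.min s (r / (L + 1)))).
have L1 : 0 < L + 1 by lra.
split=> [|u]; first by rewrite !lt_min r0' s0 divr_gt0.
rewrite !le_min => /and3P[/h' h1 /hL h2 h3].
have u0 := nrm_ge0 (u - z).
have h4 : nrm (g u - g z) <= r.
  apply: le_trans h2 _; rewrite ler_pdivlMr // in h3.
  by apply: le_trans h3; rewrite ler_wpM2l //; lra.
have := h _ h4 => {}h.
have -> : f (g u) - f (g z) - (u - z) * (a * b) =
  (f (g u) - f (g z) - (g u - g z) * a) + a * (g u - g z - (u - z) * b) by ring.
apply: le_trans (nrmD _ _) _; rewrite [leRHS]mulrDr nrmM; apply: lerD.
  apply: le_trans h _; apply: le_trans (_ : nrm (g u - g z) ^+ 2 * `|K| <= _).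
    by rewrite ler_wpM2l ?exprn_ge0 ?nrm_ge0 // ler_norm.
  rewrite mulrA ler_wpM2r // -exprMn lerXn2r ?nnegrE ?mulr_ge0 ?nrm_ge0 //.
by rewrite mulrCA ler_wpM2l ?nrm_ge0.
Qed.

Lemma qder_local (f g : C -> C) z d r : 0 < r ->
  (forall u, nrm (u - z) <= r -> f u = g u) -> qder f z d -> qder g z d.
Proof.
move=> r0 e [K [s [s0 h]]]; exists K, (Num.min r s); split=> [|u].
  by rewrite lt_min r0.
rewrite le_min => /andP[h1 h2]; rewrite -!e //; first exact: h.
by rewrite subrr nrm0 ltW.
Qed.

Lemma qder_sum (I : Type) (s : seq I) (P : pred I) (f : I -> C -> C) (d : I -> C) z :
  (forall i, P i -> qder (f i) z (d i)) ->
  qder (fun w => \sum_(i <- s | P i) f i w) z (\sum_(i <- s | P i) d i).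
Proof.
move=> h; elim: s => [|i s IH].
  rewrite big_nil; apply: (@qder_local (fun=> 0) _ _ _ 1) => // [u _|].
    by rewrite big_nil.
  exact: qder_cst.
rewrite big_cons; case: ifP => Pi; last first.
  by apply: (@qder_local _ _ _ _ 1 ltr01) IH => u _; rewrite big_cons Pi.
by apply: (@qder_local _ _ _ _ 1 ltr01) (qderD (h i Pi) IH) => u _; rewrite big_cons Pi.
Qed.

(** Along the segment from [v] to [u] the real and imaginary parts have derivative 0. Identities
    between exponentials are deduced from this. *)
Lemma qder0_cst (f : C -> C) u v : (forall z, qder f z 0) -> f u = f v.
Proof.
move=> hf.
have H (phi : C -> R) : (forall x, `|phi x| <= nrm x) ->
    (forall x y, phi (x - y) = phi x - phi y) -> phi (f u) = phi (f v).
  move=> p1 pB; pose g (t : R) := phi (f (v + ofR t * (u - v))).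
  suff -> : phi (f u) = g 1.
    suff -> : phi (f v) = g 0.
      apply: (@is_derive_0_is_cst R g 1 0) => t.
      suff h : (fun h : R => h^-1 *: (g (h *: 1 + t) - g t)) @ 0^' --> (0 : R).
        by split; [apply/cvg_ex; exists 0|exact: cvg_lim].
      have [K [r [r0 hr]]] := hf (v + ofR t * (u - v)).
      set w := nrm (u - v); have w0 : 0 <= w := nrm_ge0 _.
      have w1 : 0 < 1 + w by lra.
      have W1 : 0 < 1 + w ^+ 2 * `|K| by rewrite ltr_wpDr // mulr_ge0 // exprn_ge0.
      apply/cvgr0Pnorm_le => e e0; near=> h.
      have h0 : h != 0 by near: h; exact: nbhs_dnbhs_neq.
      have hl : `|h| < Num.min (r / (1 + w)) (e / (1 + w ^+ 2 * `|K|)).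
        by near: h; apply: dnbhs0_lt; rewrite lt_min !divr_gt0.
      move: hl; rewrite lt_min => /andP[].
      rewrite ltr_pdivlMr // ltr_pdivlMr // => h1 h2.
      have E : v + ofR (h *: 1 + t) * (u - v) - (v + ofR t * (u - v)) = ofR h * (u - v).
        by rewrite /GRing.scale /= mulr1 ofRD; ring.
      have hw : nrm (ofR h * (u - v)) = `|h| * w by rewrite nrmM nrm_ofR.
      have := hr (v + ofR (h *: 1 + t) * (u - v)); rewrite E hw mulr0 subr0 => H.
      have {}H := H ltac:(have := normr_ge0 h; nra).
      rewrite normrZ normfV ler_pdivrMl ?normr_gt0 //.
      have -> : g (h *: 1 + t) - g t =
          phi (f (v + ofR (h *: 1 + t) * (u - v)) - f (v + ofR t * (u - v))) by rewrite pB.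
      apply: le_trans (p1 _) _; apply: le_trans H _.
      rewrite exprMn -mulrA expr2 -mulrA ler_wpM2l // .
      apply: le_trans (_ : `|h| * (1 + w ^+ 2 * `|K|) <= _); last exact: ltW.
      rewrite ler_wpM2l //; have : w ^+ 2 * K <= w ^+ 2 * `|K|.
        by rewrite ler_wpM2l ?exprn_ge0 // ler_norm.
      lra.
    by rewrite /g ofR0 mul0r addr0.
  by rewrite /g ofR1 mul1r addrC subrK.
apply: complex_ext.
  exact: (H (fun x => complex.Re x) (@Re_nrm R) (fun x y => etrans (cReD _ _) (congr1 _ (cReN _)))).
exact: (H (fun x => complex.Im x) (@Im_nrm R) (fun x y => etrans (cImD _ _) (congr1 _ (cImN _)))).
Unshelve. all: by end_near. Qed.

Definition mqder m n (F : C -> 'M[C]_(m, n)) z (d : 'M[C]_(m, n)) :=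
  forall i j, qder (fun w => F w i j) z (d i j).

Lemma mqder_eq m n (F G : C -> 'M[C]_(m, n)) z d d' : (forall w, F w = G w) -> d = d' ->
  mqder F z d -> mqder G z d'.
Proof.
by move=> e <- h i j; apply: (@qder_local _ _ _ _ 1 ltr01) (h i j) => u _; rewrite e.
Qed.

Lemma mqder_cst m n (A : 'M[C]_(m, n)) z : mqder (fun=> A) z 0.
Proof. by move=> i j; rewrite mxE; exact: qder_cst. Qed.

Lemma mqderM m n p (F : C -> 'M[C]_(m, n)) (G : C -> 'M[C]_(n, p)) z d e :
  mqder F z d -> mqder G z e ->
  mqder (fun w => F w *m G w) z (d *m G z + F z *m e).
Proof.
move=> hF hG i j; rewrite !mxE -big_split /=.
apply: (@qder_local (fun w => \sum_l F w i l * G w l j) _ _ _ 1 ltr01).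
  by move=> u _; rewrite mxE.
by apply: qder_sum => l _; exact: qderM.
Qed.

Lemma mqderZ m n (f : C -> C) (F : C -> 'M[C]_(m, n)) z a d :
  qder f z a -> mqder F z d -> mqder (fun w => f w *: F w) z (a *: F z + f z *: d).
Proof.
move=> hf hF i j; rewrite !mxE.
apply: (@qder_local (fun w => f w * F w i j) _ _ _ 1 ltr01).
  by move=> u _; rewrite mxE.
exact: qderM.
Qed.

Lemma mqder_comp m n (F : C -> 'M[C]_(m, n)) g z d b :
  mqder F (g z) d -> qder g z b -> mqder (fun w => F (g w)) z (b *: d).
Proof.
by move=> hF hg i j; rewrite mxE mulrC; exact: (qder_comp (hF i j) hg).
Qed.

Lemma mqder0_cst m n (F : C -> 'M[C]_(m, n)) u v :
  (forall z, mqder F z 0) -> F u = F v.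
Proof.
move=> h; apply/matrixP => i j; apply: (@qder0_cst (fun w => F w i j)) => z.
by have := h z i j; rewrite mxE.
Qed.

Lemma mx_norm_le m n (M : 'M[C]_(m, n)) (e : R) : 0 <= e ->
  (forall i j, nrm (M i j) <= e) -> `|M| <= ofR e.
Proof.
move=> e0 h; have [->|] := eqVneq `|M| 0; first by rewrite -ofR0 ler_ofR.
by move/mx_norm_neq0 => [[i j] E]; rewrite (E : `|M| = _) /= normE ler_ofR.
Qed.

Lemma le_mx_norm m n (M : 'M[C]_(m, n)) (e : R) i j :
  `|M| <= ofR e -> nrm (M i j) <= e.
Proof.
move=> h; apply/ler_addgt0Pr => d d0.
have : ball_ (fun x : 'M[C]_(m, n) => `|x|) 0 (ofR (e + d)) M.
  by rewrite /ball_ /= sub0r normrN; apply: le_lt_trans h _; rewrite ltr_ofR; lra.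
rewrite -mx_norm_ball => -[_ /(_ i j)]; rewrite -ball_normE /ball_ /= mxE sub0r normrN.
by rewrite normE ltr_ofR => /ltW.
Qed.

(** The passage from quadratic remainders to the derivatives of the statement: finitely many entries
    share one constant and one radius. *)
Lemma mqder_derivable m n (F : C -> 'M[C]_(m, n)) z d : mqder F z d ->
  derivable F z 1 /\ derive1 F z = d.
Proof.
move=> hF.
suff h : (fun h : C => h^-1 *: (F (h + z) - F z)) @ 0^' --> d.
  split; last by apply: cvg_lim h; exact: norm_hausdorff.
  by apply/cvg_ex; exists d; move: h; under eq_fun do rewrite -[X in F (X + _)]mulr1.
have [K hK] : exists K : R, exists r : R, [/\ 0 < r, 0 <= K & forall i j u, nrm (u - z) <= r ->
    nrm (F u i j - F z i j - (u - z) * d i j) <= nrm (u - z) ^+ 2 * K].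
  have hc ij : exists Kr : R * R, 0 < Kr.2 /\ forall u, nrm (u - z) <= Kr.2 ->
    nrm (F u ij.1 ij.2 - F z ij.1 ij.2 - (u - z) * d ij.1 ij.2) <= nrm (u - z) ^+ 2 * Kr.1.
    by have [K [r h]] := hF ij.1 ij.2; exists (K, r).
  have [kr hkr] := choice hc.
  exists (\sum_(ij : 'I_m * 'I_n) `|(kr ij).1|), (\big[Num.min/1]_(ij : 'I_m * 'I_n) (kr ij).2).
  split; first by apply/bigmin_gtP; split=> // ij _; exact: (hkr ij).1.
    by rewrite sumr_ge0.
  move=> i j u /bigmin_geP[_ hu].
  apply: le_trans ((hkr (i, j)).2 u (hu (i, j) isT)) _.
  rewrite ler_wpM2l ?exprn_ge0 ?nrm_ge0 //; apply: le_trans (ler_norm _) _.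
  by rewrite (bigD1 (i, j)) //= lerDl sumr_ge0.
case: hK => r [r0 K0 hK].
apply/cvgrPdist_le => e e0.
have eE : e = ofR (complex.Re e) by apply/esym/RRe_real/gtr0_real.
have e0' : 0 < complex.Re e by rewrite -ltr_ofR -eE.
have K1 : 0 < 1 + K by lra.
near=> h.
have h0 : h != 0 by near: h; exact: nbhs_dnbhs_neq.
have hl : `|h| < ofR (Num.min r (complex.Re e / (1 + K))).
  by near: h; apply: dnbhs0_lt; rewrite -ofR0 ltr_ofR lt_min r0 divr_gt0.
rewrite normE ltr_ofR lt_min ltr_pdivlMr // in hl; case/andP: hl => h1 h2.
have nh : 0 < nrm h.
  by rewrite lt_neqAle nrm_ge0 andbT eq_sym; apply: contraNneq h0 => /nrm_eq0 ->.
rewrite eE; apply: mx_norm_le => [|i j]; first exact: ltW.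
rewrite !mxE nrmBC.
have -> : h^-1 * (F (h + z) i j - F z i j) - d i j =
    h^-1 * (F (h + z) i j - F z i j - (h + z - z) * d i j).
  by rewrite addrK [RHS]mulrBr mulKf.
rewrite nrmM nrmV ler_pdivrMl //.
have := hK i j (h + z); rewrite addrK => /(_ (ltW h1)) H; apply: le_trans H _.
rewrite expr2 -mulrA ler_wpM2l ?nrm_ge0 //; nra.
Unshelve. all: by end_near. Qed.

End ComplexDerivative.

(** * Matrix exponentials *)

Section MatrixExponential.
Variable R : realType.
Notation C := (Cx R).

Lemma ball_weight (r : R) : weight [set z : C | nrm z <= r] (fun _ _ => 1).
Proof. by []. Qed.

Lemma cls_id (r : R) :
  cls [set z : C | nrm z <= r] (fun _ _ => 1) 0 (Num.max r 1) id (fun=> 1).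
Proof.
have r1 : 1 <= Num.max r 1 by rewrite le_max lexx orbT.
split=> [|z hz|z hz|u z hu hz|u z hu hz]; rewrite ?expr0 ?mulr1.
- by rewrite (le_trans _ r1).
- by rewrite le_max hz.
- by rewrite nrm1.
- by rewrite ler_peMr ?nrm_ge0.
- by rewrite subrr nrm0 mulr_ge0 ?exprn_ge0 ?nrm_ge0 // (le_trans _ r1).
Qed.

(** Each application of [clsM] costs a factor 3; the factorials of the exponential series absorb
    it. *)
Lemma cls_pow (r : R) k :
  cls [set z : C | nrm z <= r] (fun _ _ => 1) 0 ((3 * Num.max r 1) ^+ k)
    (fun z => z ^+ k) (fun z => k%:R * z ^+ k.-1).
Proof.
elim: k => [|k IH].
  have := @cls_cst R [set z : C | nrm z <= r] (fun _ _ => 1) 1; rewrite nrm1 expr0.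
  by apply: cls_eq => z _; rewrite ?expr0 ?mul0r.
have := clsM (ball_weight r) (cls_id r) IH; rewrite exprS.
apply: cls_eq => z _; first by rewrite exprS.
case: k {IH} => [|k] /=; first by rewrite mul0r mulr0 addr0.
by rewrite [in RHS]exprS -(natr1 k.+1) exprS; ring.
Qed.

Lemma entry_pow_bound n (A : 'M[C]_n) (a : R) k i j : (forall i j, nrm (A i j) <= a) ->
  nrm ((A ^+ k) i j) <= (n%:R * a) ^+ k.
Proof.
move=> hA; elim: k i j => [|k IH] i j.
  by rewrite expr0 mxE; case: eqP; rewrite ?nrm1 ?nrm0.
rewrite exprSr mxE; apply: le_trans (nrm_sum _ _ _) _.
apply: le_trans (_ : \sum_(l < n) (n%:R * a) ^+ k * a <= _).
  by apply: ler_sum => l _; rewrite nrmM; apply: ler_pM; rewrite ?nrm_ge0.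
rewrite sumr_const card_ord -mulr_natl exprSr le_eqVlt; apply/orP; left; apply/eqP; ring.
Qed.

Lemma exp_partial_sum_bound (x : R) : 0 <= x ->
  exists B, forall n, \sum_(k < n) x ^+ k / k`!%:R <= B.
Proof.
move=> x0; exists (expR x) => n.
have -> : \sum_(k < n) x ^+ k / k`!%:R = series (exp_coeff x) n.
  by rewrite seriesEord; apply: eq_bigr.
apply: nondecreasing_cvgn_le; last exact: is_cvg_series_exp_coeff.
by apply: nondecreasing_series => k _ _; exact: exp_coeff_ge0.
Qed.

Lemma entry_max n (A : 'M[C]_n) : exists2 a : R, 0 <= a & forall i j, nrm (A i j) <= a.
Proof.
exists (\sum_(ij : 'I_n * 'I_n) nrm (A ij.1 ij.2)).
  by rewrite sumr_ge0 // => *; exact: nrm_ge0.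
move=> i j; rewrite (bigD1 (i, j)) //= lerDl sumr_ge0 // => *; exact: nrm_ge0.
Qed.

Let term n (A : 'M[C]_n) i j k (w : C) : C := (k`!%:R^-1 * (A ^+ k) i j) * w ^+ k.
Let term' n (A : 'M[C]_n) i j k (w : C) : C :=
  (k`!%:R^-1 * (A ^+ k) i j) * (k%:R * w ^+ k.-1).

Lemma exp_entry_series n (A : 'M[C]_n) (r : R) i j :
  exists B g g', [/\ cls [set z : C | nrm z <= r] (fun _ _ => 1) 0 B g g',
    forall z, nrm z <= r -> clim (fun N => \sum_(k < N) term A i j k z) (g z) &
    forall z, nrm z <= r -> clim (fun N => \sum_(k < N) term' A i j k z) (g' z)].
Proof.
have [a a0 ha] := entry_max A; set c := 3 * Num.max r 1.
have c0 : 0 <= c by rewrite mulr_ge0 // le_max ler01 orbT.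
have X0 : 0 <= n%:R * a * c := mulr_ge0 (mulr_ge0 (ler0n R n) a0) c0.
have [B hB] := exp_partial_sum_bound X0; exists B.
apply: (cls_series (ball_weight r) (b := fun k => (n%:R * a * c) ^+ k / k`!%:R)) => // k.
apply: (cls_le (ball_weight r) _ (clsZ (k`!%:R^-1 * (A ^+ k) i j) (cls_pow r k))).
rewrite nrmM nrmV nrm_nat -/c; move: (c) c0 => {X0 hB}c c0; rewrite [(_ * _ * c) ^+ k]exprMn.
rewrite [leRHS](_ : _ = k`!%:R^-1 * (n%:R * a) ^+ k * c ^+ k); last by ring.
by rewrite ler_wpM2r ?exprn_ge0 // ler_wpM2l ?invr_ge0 // entry_pow_bound.
Qed.

Lemma mulmx_expr n (A : 'M[C]_n) k : A *m A ^+ k = A ^+ k.+1.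
Proof. by rewrite exprS. Qed.

Lemma scalemx_expr n (A : 'M[C]_n) w k : (w *: A) ^+ k = w ^+ k *: A ^+ k.
Proof.
elim: k => [|k IH]; first by rewrite !expr0 scale1r.
by rewrite -!mulmx_expr IH -scalemxAl -scalemxAr scalerA exprS.
Qed.

Lemma expmx_entry n (A : 'M[C]_n) (w : C) i j :
  clim (fun N => \sum_(k < N) term A i j k w) (expmx (w *: A) i j).
Proof.
have H ij : exists l, clim (fun N => \sum_(k < N) term A ij.1 ij.2 k w) l.
  have [B [g [g' [_ h _]]]] := exp_entry_series A (nrm w) ij.1 ij.2.
  by exists (g w); apply: h.
have [l hl] := choice H.
suff -> : expmx (w *: A) = \matrix_(i, j) l (i, j) by rewrite mxE; exact: (hl (i, j)).
apply: cvg_lim; first exact: norm_hausdorff.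
apply/cvgrPdist_le => e e0.
have eE : e = ofR (complex.Re e) by apply/esym/RRe_real/gtr0_real.
have e0' : 0 < complex.Re e by rewrite -ltr_ofR -eE.
have [N hN] : exists N, forall ij m, (N <= m)%N ->
    nrm (\sum_(k < m) term A ij.1 ij.2 k w - l ij) <= complex.Re e.
  have [N hN] := choice (fun ij => hl ij _ e0'); exists (\max_ij N ij)%N => ij m h.
  by apply: hN; apply: leq_trans h; exact: leq_bigmax.
near=> m; rewrite eE; apply: mx_norm_le => [|a b]; first exact: ltW.
have Nm : (N <= m)%N by near: m; exact: nbhs_infty_ge.
rewrite [X in nrm X](_ : _ = l (a, b) - \sum_(k < m) term A a b k w).
  by rewrite nrmBC; exact: (hN (a, b) m Nm).
rewrite mxE; congr (_ + _); rewrite mxE //; congr (- _).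
rewrite seriesEord summxE; apply: eq_bigr => k _.
by rewrite mxE scalemx_expr mxE /term; ring.
Unshelve. all: by end_near. Qed.

Lemma mqder_expmx n (A : 'M[C]_n) z :
  mqder (fun w => expmx (w *: A)) z (A *m expmx (z *: A)).
Proof.
move=> i j; have [B [g [g' [hc hg hg']]]] := exp_entry_series A (nrm z + 1) i j.
have zz : nrm z <= nrm z + 1 by lra.
have gE u : nrm u <= nrm z + 1 -> g u = expmx (u *: A) i j.
  by move=> hu; apply: clim_uniq (hg u hu) (expmx_entry A u i j).
have inb u : nrm (u - z) <= 1 -> nrm u <= nrm z + 1.
  by move=> h; have := nrmD (u - z) z; rewrite subrK; lra.
have g'E : g' z = (A *m expmx (z *: A)) i j.
  rewrite mxE.
  have h1 : clim (fun N => \sum_l A i l * \sum_(k < N) term A l j k z)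
      (\sum_l A i l * expmx (z *: A) l j).
    by apply: clim_sum => l; apply: climZ; exact: expmx_entry.
  (* The derivative of the constant term is 0, so [m + 1] differentiated terms match [m] terms of
     [A] times the exponential. *)
  apply: clim_uniq h1 => e e0; have [N hN] := hg' z zz e e0.
  exists N => m Nm; have := hN m.+1 (leqW Nm).
  congr (nrm (_ - _) <= _); rewrite big_ord_recl /= {1}/term' mul0r mulr0 add0r.
  under [RHS]eq_bigr do rewrite mulr_sumr.
  rewrite exchange_big; apply: eq_bigr => k _ /=.
  rewrite /term' /bump /= add1n -mulmx_expr mxE /= mulr_sumr mulr_suml.
  apply: eq_bigr => l _; rewrite /term factS natrM invfM.
  have k0 : k.+1%:R != 0 :> C by rewrite pnatr_eq0.
  have f0 : k`!%:R != 0 :> C by rewrite pnatr_eq0 -lt0n fact_gt0.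
  move: k0 f0; move: (k.+1%:R : C) (k`!%:R : C) => x y k0 f0.
  by field; rewrite k0 f0.
rewrite -g'E; apply: (@qder_local _ g _ _ _ 1 ltr01) => [u hu|].
  by apply: gE; exact: inb.
apply: (cls_qder (ball_weight (nrm z + 1)) hc zz ltr01) => u; exact: inb.
Qed.

Lemma expmx0 n : expmx (0 : 'M[C]_n) = 1%:M.
Proof.
apply/matrixP => i j; apply: (clim_uniq (u := fun N => \sum_(k < N) term 0 i j k 0)).
  by have := expmx_entry (0 : 'M[C]_n) 0 i j; rewrite scaler0.
move=> e e0; exists 1%N => -[//|N] _; rewrite big_ord_recl big1 ?addr0 => [|k _].
  by rewrite /term !expr0 fact0 invr1 mul1r mulr1 subrr nrm0 ltW.
by rewrite /term [X in _ * X]expr0n mulr0.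
Qed.

(** True on powers, hence on partial sums. It covers commutation, with [A = B], and the relation
    [z^D R_(l) = z^-l R_(l) z^D], with [B = A - l]. *)
Lemma expmx_intertwine n (A B M : 'M[C]_n) w : A *m M = M *m B ->
  expmx (w *: A) *m M = M *m expmx (w *: B).
Proof.
move=> h; have hk k : A ^+ k *m M = M *m B ^+ k.
  elim: k => [|k IH]; first by rewrite !expr0 mul1mx mulmx1.
  by rewrite -mulmx_expr -mulmxA IH mulmxA h -mulmxA mulmx_expr.
apply/matrixP => i j; rewrite !mxE.
have h1 : clim (fun N => \sum_l M i l * \sum_(k < N) term B l j k w)
    (\sum_l M i l * expmx (w *: B) l j).
  by apply: clim_sum => l; apply: climZ; exact: expmx_entry.
have h2 : clim (fun N => \sum_l M l j * \sum_(k < N) term A i l k w)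
    (\sum_l M l j * expmx (w *: A) i l).
  by apply: clim_sum => l; apply: climZ; exact: expmx_entry.
under eq_bigr do rewrite mulrC.
apply: clim_uniq h2 _; move: h1; congr clim; apply/funext => N.
under eq_bigr do rewrite mulr_sumr; under [RHS]eq_bigr do rewrite mulr_sumr.
rewrite exchange_big [RHS]exchange_big; apply: eq_bigr => k _ /=.
have /matrixP/(_ i j) := hk k; rewrite !mxE => E.
rewrite /term; transitivity ((k`!%:R^-1 * w ^+ k) * \sum_l M i l * (B ^+ k) l j).
  by rewrite mulr_sumr; apply: eq_bigr => l _; ring.
by rewrite -E mulr_sumr; apply: eq_bigr => l _; ring.
Qed.

Lemma expmx_comm n (A : 'M[C]_n) w : A *m expmx (w *: A) = expmx (w *: A) *m A.
Proof. by apply/esym/expmx_intertwine. Qed.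

(** The product has derivative 0 and value 1 at the origin; no product of series is formed. The next
    shift formula is proved in the same way. *)
Lemma expmx_mulN n (A : 'M[C]_n) w : expmx (w *: A) *m expmx (w *: - A) = 1%:M.
Proof.
have -> : 1%:M = expmx (0 *: A) *m expmx (0 *: - A) by rewrite !scale0r expmx0 mulmx1.
apply: (@mqder0_cst _ _ _ (fun w => expmx (w *: A) *m expmx (w *: - A))) => z.
apply: mqder_eq (mqderM (mqder_expmx A z) (mqder_expmx (- A) z)) => //.
by rewrite expmx_comm mulNmx mulmxN mulmxA subrr.
Qed.

Lemma expmx_unit n (A : 'M[C]_n) w : expmx (w *: A) \in unitmx.
Proof. exact: (mulmx1_unit (expmx_mulN A w)).1. Qed.

Lemma expmx_shift n (A : 'M[C]_n) c w :
  expmx (w *: (A - c%:M)) = cexp (- (c * w)) *: expmx (w *: A).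
Proof.
have K0 : expmx (w *: - A) *m (cexp (c * w) *: expmx (w *: (A - c%:M))) = 1%:M.
  have -> : 1%:M = expmx (0 *: - A) *m (cexp (c * 0) *: expmx (0 *: (A - c%:M))).
    by rewrite !scale0r expmx0 mulr0 cexp0 scale1r mulmx1.
  apply: (@mqder0_cst _ _ _ (fun w => expmx (w *: - A) *m
    (cexp (c * w) *: expmx (w *: (A - c%:M))))) => z.
  have hq : qder (fun w : C => cexp (c * w)) z (cexp (c * z) * c).
    apply: qder_comp (qder_cexp _) _.
    by have := qderM (qder_cst c z) (qder_id z); rewrite mul0r add0r mulr1.
  have := mqderM (mqder_expmx (- A) z) (mqderZ hq (mqder_expmx (A - c%:M) z)).
  apply: mqder_eq => //; set E := expmx (z *: _); set F := expmx _.
  have E1 : - A *m E = E *m - A by rewrite /E expmx_comm.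
  have F1 : (A - c%:M) *m F = A *m F - c *: F by rewrite mulmxBl mul_scalar_mx.
  rewrite E1 F1 -mulmxA -mulmxDr mulNmx -scalemxAr scalerBr scalerA.
  by rewrite [_ *: F + _]addrCA subrr addr0 addNr mulmx0.
have := congr1 (mulmx (expmx (w *: A))) K0; rewrite mulmxA expmx_mulN mul1mx mulmx1 => <-.
by rewrite scalerA -cexpD addNr cexp0 scale1r.
Qed.

End MatrixExponential.

(** * Solutions on half-plane-like domains *)

Section InversePowers.
Variable R : realType.
Notation C := (Cx R).
Variables (l : C -> R) (N : R).
Hypotheses (N1 : 1 <= N) (lnrm : forall z, l z <= nrm z).

Let D := lset l N.
Let q := lq l.
Let wq := lq_weight l N1 : weight (lset l N) (lq l).

Lemma lset_nrm z : D z -> N <= nrm z.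
Proof. by move=> h; exact: le_trans (lnrm z). Qed.

Lemma lset_neq0 z : D z -> z != 0.
Proof.
move=> /lset_nrm h; apply/eqP => z0; move: h; rewrite z0 nrm0.
by have := N1; lra.
Qed.

Lemma lq_nrm u z : D u -> D z -> (nrm u)^-1 <= q u z /\ (nrm z)^-1 <= q u z.
Proof.
move=> hu hz; have pos x : D x -> 0 < l x by move=> h; have := N1; have := (h : N <= l x); lra.
have m0 : 0 < Num.min (l u) (l z) by rewrite lt_min !pos.
rewrite /q /lq !lef_pV2 ?posrE //; do ?[exact: lt_le_trans (pos _ _) (lnrm _)].
by split; apply: le_trans (lnrm _); rewrite ge_min lexx ?orbT.
Qed.

Lemma cls_inv : cls D q 1 1 (fun z => z^-1) (fun z => - (z^-1 * z^-1)).
Proof.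
have le1 u z : D u -> D z -> q u z <= 1 by move=> hu hz; exact: (wle1 wq).

have i0 (z : C) : 0 <= (nrm z)^-1 by rewrite invr_ge0 nrm_ge0.
split=> [//|z hz|z hz|u z hu hz|u z hu hz]; rewrite expr1 mul1r.
- by rewrite nrmV; case: (lq_nrm hz hz).
- rewrite nrmN nrmM nrmV; have [h _] := lq_nrm hz hz.
  by rewrite -[leRHS]mulr1 ler_pM // (le_trans h) // le1.
- have [hu' hz'] := lq_nrm hu hz.
  have -> : u^-1 - z^-1 = (z - u) * (u^-1 * z^-1).
    by field; rewrite !lset_neq0.
  rewrite !nrmM !nrmV nrmBC ler_wpM2l ?nrm_ge0 // -[leRHS]mulr1 ler_pM //.
  by rewrite (le_trans hz') // le1.
- have [hu' hz'] := lq_nrm hu hz.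
  have -> : u^-1 - z^-1 - (u - z) * - (z^-1 * z^-1) = (u - z) ^+ 2 * (u^-1 * (z^-1 * z^-1)).
    by field; rewrite !lset_neq0.
  rewrite nrmM nrmX !nrmM !nrmV ler_wpM2l ?exprn_ge0 ?nrm_ge0 // -[leRHS]mulr1 ler_pM //.
    by rewrite mulr_ge0.
  by rewrite -[leRHS]mulr1 ler_pM // (le_trans hz') // le1.
Qed.

Lemma cls_invX k : cls D q k (3 ^+ k) (fun z => z^-1 ^+ k) (fun z => - k%:R * z^-1 ^+ k.+1).
Proof.
elim: k => [|k IH].
  have := @cls_cst R D q 1; rewrite nrm1 expr0.
  by apply: cls_eq => z _; rewrite ?expr0 ?oppr0 ?mul0r.
have := clsM wq cls_inv IH; rewrite mulr1 -exprS.
apply: cls_eq => z _; first by rewrite exprS.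
by rewrite -natr1 [in RHS]exprS [in RHS]exprS [in LHS]exprS; ring.
Qed.

(** On the domain [q <= 1/N], so surplus decay can be traded for powers of [1/N]; this makes the
    tail of a power series summable at a fixed order. *)
Lemma cls_weakN j i M f f' : cls D q (i + j) M f f' -> cls D q j (M * N^-1 ^+ i) f f'.
Proof.
have Np : 0 < N := lt_le_trans ltr01 N1.
move=> [h0 h1 h2 h3 h4].
have hq u z : D u -> D z -> q u z <= N^-1.
  move=> hu hz; rewrite /q /lq lef_pV2 ?posrE // ?le_min ?hu ?hz //.
  by rewrite lt_min !(lt_le_trans Np).
have hm u z : D u -> D z -> M * q u z ^+ (i + j) <= M * N^-1 ^+ i * q u z ^+ j.
  move=> hu hz; rewrite exprD mulrA ler_wpM2r ?(wXge0 wq) // ler_wpM2l //.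
  by rewrite lerXn2r ?nnegrE ?(wge0u wq) ?invr_ge0 ?(ltW Np) ?hq.
split=> [|z hz|z hz|u z hu hz|u z hu hz].
- by rewrite mulr_ge0 // exprn_ge0 // invr_ge0 ltW.
- exact: le_trans (h1 z hz) (hm _ _ hz hz).
- exact: le_trans (h2 z hz) (hm _ _ hz hz).
- apply: le_trans (h3 u z hu hz) _.
  by rewrite ler_wpM2l ?nrm_ge0 ?hm.
- apply: le_trans (h4 u z hu hz) _.
  by rewrite ler_wpM2l ?exprn_ge0 ?nrm_ge0 ?hm.
Qed.

Definition psum (X : nat -> C) (z : C) : C := Clim (fun n => \sum_(j < n) X j * z^-1 ^+ j).

Variables (Ka rho : R).
Hypotheses (Ka0 : 0 <= Ka) (rho0 : 0 <= rho) (rhoN : 6 * rho <= N).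

(** [cls_invX] puts [3^(j+K)] in front of the terms, so the tail is geometric with ratio at most
    [3 rho / N]. The bound [6 rho <= N] makes this at most [1/2], and the sum of the series gives
    the factor 2. *)
Lemma psum_tail (X : nat -> C) K : (forall j, nrm (X j) <= Ka * rho ^+ j) ->
  (exists f', cls D q K (2 * Ka * N ^+ K)
    (fun z => psum X z - \sum_(j < K) X j * z^-1 ^+ j) f') /\
  forall z, D z -> clim (fun n => \sum_(j < n) X j * z^-1 ^+ j) (psum X z).
Proof.
move=> hX; have Np : 0 < N := lt_le_trans ltr01 N1.
pose b j := Ka * N ^+ K * (1 / 2) ^+ j.
have ht j : cls D q K (b j) (fun z => X (j + K)%N * z^-1 ^+ (j + K))
    (fun z => X (j + K)%N * (- (j + K)%:R * z^-1 ^+ (j + K).+1)).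
  apply: (cls_le wq _ (cls_weakN (clsZ _ (cls_invX (j + K))))).
  apply: le_trans (_ : Ka * rho ^+ (j + K) * 3 ^+ (j + K) * N^-1 ^+ j <= _).
    by rewrite !ler_wpM2r ?exprn_ge0 ?invr_ge0 ?(ltW Np).
  rewrite [leLHS](_ : _ = Ka * ((rho * 3) ^+ K * (rho * 3 * N^-1) ^+ j)); last first.
    by rewrite !exprMn !exprD; ring.
  rewrite /b -[leRHS]mulrA ler_wpM2l //.

  apply: ler_pM; rewrite ?exprn_ge0 ?mulr_ge0 ?invr_ge0 ?(ltW Np) //.
    by rewrite lerXn2r ?nnegrE ?(ltW Np) //; have := rhoN; have := rho0; lra.
  rewrite lerXn2r ?nnegrE ?mulr_ge0 ?invr_ge0 ?(ltW Np) //.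
  by rewrite ler_pdivrMr //; have := rhoN; have := rho0; lra.
have hb n : \sum_(j < n) b j <= 2 * Ka * N ^+ K.
  have C0 : 0 <= Ka * N ^+ K by rewrite mulr_ge0 // exprn_ge0 // ltW.
  rewrite /b -mulr_sumr.
  have -> : \sum_(i < n) (1 / 2) ^+ i = 2 - 2 * (1 / 2) ^+ n :> R.
    elim: n => [|n IH]; first by rewrite big_ord0 expr0; ring.
    by rewrite big_ord_recr /= IH exprS; field.

  by rewrite -[leRHS]mulrA [leRHS]mulrC ler_wpM2l // gerBl mulr_ge0.
have [g [g' [hg h1 h2]]] := cls_series wq ht hb.
have hlim z : D z -> clim (fun n => \sum_(j < n) X j * z^-1 ^+ j)
    (g z + \sum_(j < K) X j * z^-1 ^+ j).
  move=> hz e e0; have [M hM] := h1 z hz e e0; exists (K + M)%N => n hn.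
  have := hM (n - K)%N ltac:(lia); congr (nrm _ <= _).
  have -> : \sum_(j < n) X j * z^-1 ^+ j = \sum_(j < K) X j * z^-1 ^+ j +
      \sum_(j < n - K) X (j + K)%N * z^-1 ^+ (j + K).
    have : n = (K + (n - K))%N by lia.
    move: (n - K)%N => m ->; rewrite big_split_ord /=; congr (_ + _).
    by apply: eq_bigr => j _; rewrite addnC.
  by ring.
have hp z : D z -> psum X z = g z + \sum_(j < K) X j * z^-1 ^+ j.
  by move=> hz; apply: clim_uniq (ClimP (hlim z hz)) (hlim z hz).
split; last by move=> z hz; rewrite hp //; exact: hlim.
by exists g'; apply: cls_eq hg => z hz //; rewrite hp // addrK.
Qed.

End InversePowers.

Lemma sum_triangle (V : zmodType) (g : nat -> nat -> V) K :
  \sum_(j < K.+1) \sum_(k < K.+1 | (j + k <= K)%N) g j k =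
  \sum_(m < K.+1) \sum_(j < m.+1) g j (m - j)%N.
Proof.
have -> : \sum_(m < K.+1) \sum_(j < m.+1) g j (m - j)%N =
    \sum_(m < K.+1) \sum_(j < K.+1 | (j < m.+1)%N) g j (m - j)%N.
  by apply: eq_bigr => m _; rewrite (big_ord_widen K.+1 (fun j => g j (m - j)%N)).
rewrite [RHS](exchange_big_dep xpredT) //=; apply: eq_bigr => j _.
have -> : \sum_(k < K.+1 | (j + k <= K)%N) g j k = \sum_(k < K.+1 - j) g j k.
  rewrite (big_ord_widen K.+1 (g j)) ?leq_subr //.
  by apply: eq_bigl => k; have := ltn_ord j; lia.
have -> : \sum_(m < K.+1 | (j < m.+1)%N) g j (m - j)%N = \sum_(j <= m < K.+1) g j (m - j)%N.
  by rewrite (big_nat_widenl j 0) // big_mkord.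
move: (nat_of_ord j) => i; rewrite -[X in \sum_(X <= m < _) _]add0n big_addn big_mkord.
by apply: eq_bigr => k _; rewrite addnK.
Qed.

Section ClassExistential.
Variable R : realType.
Notation C := (Cx R).
Variables (D : set C) (q : C -> C -> R) (wq : weight D q).

(** The derivative is hidden but the constant stays visible, because it has to be uniform in the
    weight. *)
Definition clsE k (M : R) (f : C -> C) := exists f', cls D q k M f f'.

Lemma clsE_eq k M f g : (forall z, D z -> f z = g z) -> clsE k M f -> clsE k M g.
Proof. by move=> e [f' h]; exists f'; apply: cls_eq h. Qed.

Lemma clsE_le k M M' f : M <= M' -> clsE k M f -> clsE k M' f.
Proof. by move=> e [f' h]; exists f'; exact: cls_le h. Qed.

Lemma clsE_weak j k M f : (j <= k)%N -> clsE k M f -> clsE j M f.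
Proof. by move=> e [f' h]; exists f'; exact: cls_weak h. Qed.

Lemma clsE_D k M N f g : clsE k M f -> clsE k N g -> clsE k (M + N) (fun z => f z + g z).
Proof. by move=> [f' h] [g' h']; eexists; exact: clsD h h'. Qed.

Lemma clsE_N k M f : clsE k M f -> clsE k M (fun z => - f z).
Proof. by move=> [f' h]; eexists; exact: clsN h. Qed.

Lemma clsE_Z k M c f : clsE k M f -> clsE k (nrm c * M) (fun z => c * f z).
Proof. by move=> [f' h]; eexists; exact: clsZ h. Qed.

Lemma clsE_M j k M N f g : clsE j M f -> clsE k N g ->
  clsE (j + k) (3 * M * N) (fun z => f z * g z).
Proof. by move=> [f' h] [g' h']; eexists; exact: clsM h h'. Qed.

Lemma clsE_sum (I : Type) (r : seq I) (P : pred I) k (M : I -> R) (f : I -> C -> C) :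
  (forall i, P i -> clsE k (M i) (f i)) ->
  clsE k (\sum_(i <- r | P i) M i) (fun z => \sum_(i <- r | P i) f i z).
Proof.
move=> h; have /choice[f' hf'] : forall i, exists f', P i -> cls D q k (M i) (f i) f'.
  by move=> i; case: (boolP (P i)) => [/h[f' hf']|]; [exists f'|exists (f i)].
by eexists; exact: cls_sum hf'.
Qed.

End ClassExistential.

(** * The gauge equation [G' = A G - G B] on a domain [N <= l] *)

Section Gauge.
Variable R : realType.
Notation C := (Cx R).
Variables (n : nat) (lam : 'I_n -> C) (At Bt F : nat -> 'M[C]_n) (Ka rho c N : R).
Hypotheses (Ka0 : 0 <= Ka) (rho0 : 0 <= rho) (c0 : 0 < c) (N1 : 1 <= N) (rhoN : 6 * rho <= N).
Hypothesis hA : forall j a b, nrm (At j a b) <= Ka * rho ^+ j.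
Hypothesis hB : forall j a b, nrm (Bt j a b) <= Ka * rho ^+ j.
Hypothesis A0 : forall a b, At 0%N a b = lam a *+ (a == b).
Hypothesis B0 : forall a b, Bt 0%N a b = lam a *+ (a == b).
Hypothesis Frec : forall k, \sum_(j < k.+1)
   (At j *m F (k - j)%N - F (k - j)%N *m Bt j) + k.-1%:R *: F k.-1 = 0.

Definition psum_mx (X : nat -> 'M[C]_n) (z : C) : 'M[C]_n :=
  \matrix_(a, b) psum (fun j => X j a b) z.

Definition partial_mx (X : nat -> 'M[C]_n) K (z : C) : 'M[C]_n :=
  \sum_(k < K.+1) z^-1 ^+ k *: X k.

Definition partial_mx' (X : nat -> 'M[C]_n) K (z : C) : 'M[C]_n :=
  \sum_(k < K.+1) (- k%:R * z^-1 ^+ k.+1) *: X k.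

(** The defect of the truncated series, expanded so that every term is visibly of order at least
    [K + 1]. *)
Definition residual K (z : C) : 'M[C]_n :=
  \sum_(j < K.+1) \sum_(k < K.+1 | ~~ (j + k <= K)%N)
      z^-1 ^+ (j + k) *: (At j *m F k - F k *m Bt j)
  + (K%:R * z^-1 ^+ K.+1) *: F K
  + (psum_mx At z - partial_mx At K z) *m partial_mx F K z
  - partial_mx F K z *m (psum_mx Bt z - partial_mx Bt K z).

(** Orders up to [K] cancel by [Frec]. Differentiating the last term produces [K z^-(K+1) F_K],
    which has no partner at those orders and stays in the residual. *)
Lemma residualE K z : psum_mx At z *m partial_mx F K z - partial_mx F K z *m psum_mx Bt z
  - partial_mx' F K z = residual K z.
Proof.
set x := z^-1; pose g j k := x ^+ (j + k) *: (At j *m F k - F k *m Bt j).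
have E1 : partial_mx At K z *m partial_mx F K z - partial_mx F K z *m partial_mx Bt K z =
    \sum_(j < K.+1) \sum_(k < K.+1) g j k.
  rewrite /partial_mx mulmx_suml mulmx_sumr -sumrB; apply: eq_bigr => j _.
  rewrite mulmx_sumr mulmx_suml -sumrB; apply: eq_bigr => k _.
  rewrite /g -/x -!scalemxAl -!scalemxAr !scalerA scalerBr exprD.
  by rewrite [x ^+ k * x ^+ j]mulrC.
have E2 : \sum_(j < K.+1) \sum_(k < K.+1 | (j + k <= K)%N) g j k =
    - \sum_(m < K.+1) (m.-1%:R * x ^+ m) *: F m.-1.
  rewrite sum_triangle -sumrN; apply: eq_bigr => m _.
  have -> : \sum_(j < m.+1) g j (m - j)%N = x ^+ m *: \sum_(j < m.+1)
      (At j *m F (m - j)%N - F (m - j)%N *m Bt j).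
    rewrite scaler_sumr; apply: eq_bigr => j _; rewrite /g subnKC //.
    by rewrite -ltnS ltn_ord.
  have := Frec m => /eqP; rewrite addr_eq0 => /eqP ->.
  by rewrite scalerN scalerA mulrC.
have E3 : partial_mx' F K z = - (\sum_(m < K.+1) (m.-1%:R * x ^+ m) *: F m.-1)
    - (K%:R * x ^+ K.+1) *: F K.
  rewrite -opprD /partial_mx' -/x big_ord_recr [in RHS]big_ord_recl /= mul0r scale0r add0r.
  rewrite opprD -sumrN mulNr scaleNr; congr (_ - _); apply: eq_bigr => k _.
  by rewrite mulNr scaleNr.
have E4 : \sum_(j < K.+1) \sum_(k < K.+1) g j k =
    \sum_(j < K.+1) \sum_(k < K.+1 | (j + k <= K)%N) g j k +
    \sum_(j < K.+1) \sum_(k < K.+1 | ~~ (j + k <= K)%N) g j k.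
  rewrite -big_split; apply: eq_bigr => j _.
  by rewrite (bigID (fun k : 'I_K.+1 => (j + k <= K)%N)).
rewrite E2 in E4; rewrite E4 in E1; rewrite /residual -/x mulmxBl mulmxBr.
rewrite -[X in X + _ + _ - _](addKr (- \sum_(m < K.+1) (m.-1%:R * x ^+ m) *: F m.-1)) -E1 E3.
rewrite !opprD !opprK.
move: (psum_mx At z *m _) (_ *m psum_mx Bt z) (\sum_(m < K.+1) _) (_ *: F K) => a b u v.
move: (partial_mx At K z *m _) (_ *m partial_mx Bt K z) => a' b'.
by apply/matrixP => i j; rewrite !mxE; ring.
Qed.

(* [e a b] is the direction of integration for the entry [(a, b)]. *)
Definition admissible (l : C -> R) (e : 'I_n -> 'I_n -> C) :=
  [/\ forall z, l z <= nrm z, forall a b, nrm (e a b) <= 1,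
      forall a b z r, 0 <= r -> l z + c * r <= l (z + ofR r * e a b) &
      forall a b, 0 <= complex.Re ((lam a - lam b) * e a b)].

(** The decay of the error plays the part of an initial condition at infinity. *)
Definition gauge_solution (l : C -> R) K M (G G' : C -> 'M[C]_n) :=
  (forall a b, cls (lset l N) (lq l) K M (fun z => (G z - partial_mx F K z) a b)
      (fun z => (G' z - partial_mx' F K z) a b)) /\
  forall z, lset l N z -> G' z = psum_mx At z *m G z - G z *m psum_mx Bt z.

Lemma partial_cls (X : nat -> 'M[C]_n) K a b : exists M, forall l, (forall z, l z <= nrm z) ->
  clsE (lset l N) (lq l) 0 M (fun z => partial_mx X K z a b).
Proof.
eexists => l hl; have wl := lq_weight l N1.
apply: (@clsE_eq _ _ _ _ _ (fun z => \sum_(k < K.+1) X k a b * z^-1 ^+ k)).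
  by move=> z _; rewrite /partial_mx summxE; apply: eq_bigr => k _; rewrite mxE mulrC.
apply: clsE_sum => k _; apply: clsE_Z; apply: (clsE_weak wl (leq0n k)).
by eexists; exact: (cls_invX N1 hl).
Qed.

Lemma residual_cls K a b : exists M, forall l, (forall z, l z <= nrm z) ->
  clsE (lset l N) (lq l) K.+1 M (fun z => residual K z a b).
Proof.
have [MF hF] : exists M, forall a b l, (forall z, l z <= nrm z) ->
    clsE (lset l N) (lq l) 0 (M a b) (fun z => partial_mx F K z a b).
  have /choice[M hM] := fun ab : 'I_n * 'I_n => partial_cls F K ab.1 ab.2.
  by exists (fun a b => M (a, b)) => a' b'; exact: (hM (a', b')).
eexists => l hl; have wl := lq_weight l N1.
have tail (X : nat -> 'M[C]_n) p p' : (forall j a b, nrm (X j a b) <= Ka * rho ^+ j) ->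
    clsE (lset l N) (lq l) K.+1 (2 * Ka * N ^+ K.+1)
      (fun z => (psum_mx X z - partial_mx X K z) p p').
  move=> hX; have [h _] := psum_tail N1 hl Ka0 rho0 rhoN K.+1 (fun j => hX j p p').
  apply: clsE_eq h => z _; rewrite !mxE /partial_mx summxE; congr (_ - _).
  by apply: eq_bigr => j _; rewrite mxE mulrC.
have pw k : clsE (lset l N) (lq l) k (3 ^+ k) (fun z => z^-1 ^+ k).
  by eexists; exact: (cls_invX N1 hl).
apply: (@clsE_eq _ _ _ _ _ (fun z =>
  \sum_(j < K.+1) \sum_(k < K.+1 | ~~ (j + k <= K)%N)
     (At j *m F k - F k *m Bt j) a b * z^-1 ^+ (j + k)
  + (K%:R * F K a b) * z^-1 ^+ K.+1
  + \sum_p (psum_mx At z - partial_mx At K z) a p * partial_mx F K z p b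
  + - \sum_p partial_mx F K z a p * (psum_mx Bt z - partial_mx Bt K z) p b)).
  have addE (X Y : 'M[C]_n) : (X + Y) a b = X a b + Y a b by rewrite mxE.
  have oppE (X : 'M[C]_n) : (- X) a b = - X a b by rewrite mxE.
  have mulE (X Y : 'M[C]_n) : (X *m Y) a b = \sum_p X a p * Y p b by rewrite mxE.
  move=> z _; rewrite /residual !addE oppE !mulE; congr (_ + _ + _ + _).
  2: by rewrite mxE mulrAC.
  rewrite summxE; apply: eq_bigr => j _; rewrite summxE; apply: eq_bigr => k _.
  by rewrite [RHS]mxE mulrC.
apply: clsE_D; [apply: clsE_D; [apply: clsE_D|]|].
- apply: clsE_sum => j _; apply: clsE_sum => k; rewrite -ltnNge => jk.
  by apply: clsE_Z; apply: (clsE_weak wl jk (pw _)).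
- by apply: clsE_Z; exact: pw.
- apply: clsE_sum => p _; rewrite -[K.+1]addn0.
  by apply: (clsE_M wl (tail _ _ _ hA) (hF p b l hl)).
- apply: clsE_N; apply: clsE_sum => p _.
  by apply: (clsE_M wl (hF a p l hl) (tail _ _ _ hB)).
Qed.

(** The matrix of [X |-> (A - A_0) X - X (B - B_0)] on index pairs; the diagonal leading part goes
    into the exponents [lam i.1 - lam i.2]. *)
Let co (i j : 'I_n * 'I_n) (z : C) : C :=
  (j.2 == i.2)%:R * (psum_mx At z - At 0%N) i.1 j.1
  - (j.1 == i.1)%:R * (psum_mx Bt z - Bt 0%N) j.2 i.2.

Lemma commutator_system (X : 'M[C]_n) z i :
  (lam i.1 - lam i.2) * X i.1 i.2 + \sum_j co i j z * X j.1 j.2 =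
  (psum_mx At z *m X - X *m psum_mx Bt z) i.1 i.2.
Proof.
case: i => a b /=.
have delta (f : 'I_n -> C) p0 : \sum_p (p == p0)%:R * f p = f p0.
  rewrite (bigD1 p0) //= eqxx mul1r big1 ?addr0 // => p /negPf ->.
  by rewrite mul0r.
have -> : \sum_j co (a, b) j z * X j.1 j.2 =
    \sum_p (psum_mx At z - At 0%N) a p * X p b - \sum_p X a p * (psum_mx Bt z - Bt 0%N) p b.
  rewrite -(pair_bigA _ (fun p r => co (a, b) (p, r) z * X p r)) /=.
  under eq_bigr => p _ do under eq_bigr => r _ do rewrite /co /= mulrBl -!mulrA.
  under eq_bigr do rewrite sumrB delta -mulr_sumr.
  rewrite sumrB (delta (fun p => \sum_r (psum_mx Bt z - Bt 0%N) r b * X p r)); congr (_ - _).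
  by apply: eq_bigr => r _; rewrite mulrC.
have EA : \sum_p At 0%N a p * X p b = lam a * X a b.
  rewrite -(delta (fun p => lam a * X p b)); apply: eq_bigr => p _.
  by rewrite A0 [a == p]eq_sym; case: (p == a); rewrite ?mulr1n ?mulr0n ?mul1r ?mul0r.
have EB : \sum_p X a p * Bt 0%N p b = lam b * X a b.
  rewrite -(delta (fun p => lam p * X a p)); apply: eq_bigr => p _.
  by rewrite B0; case: (p == b); rewrite ?mulr1n ?mulr0n ?mul1r ?mul0r ?mulr0 // mulrC.
have -> : \sum_p (psum_mx At z - At 0%N) a p * X p b =
    \sum_p psum_mx At z a p * X p b - lam a * X a b.
  rewrite -EA -sumrB; apply: eq_bigr => p _; rewrite -mulrBl; congr (_ * _).
  by rewrite [LHS]mxE; congr (_ + _); rewrite mxE.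
have -> : \sum_p X a p * (psum_mx Bt z - Bt 0%N) p b =
    \sum_p X a p * psum_mx Bt z p b - lam b * X a b.
  rewrite -EB -sumrB; apply: eq_bigr => p _; rewrite -mulrBr; congr (_ * _).
  by rewrite [LHS]mxE; congr (_ + _); rewrite mxE.
rewrite [RHS]mxE [X in _ = _ + X]mxE [X in _ = X + _]mxE [X in _ = _ - X]mxE.
by ring.
Qed.

(** Two tails, of [A] and of [B], each bounded by [psum_tail] at order 1. *)
Let Ca := 2 * (2 * Ka * N).

Lemma Ca_ge0 : 0 <= Ca.
Proof. by rewrite /Ca !mulr_ge0 // (le_trans ler01). Qed.

Lemma co_cls l : (forall z, l z <= nrm z) ->
  exists co' : 'I_n * 'I_n -> 'I_n * 'I_n -> C -> C,
    forall i j, cls (lset l N) (lq l) 1 Ca (co i j) (co' i j).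
Proof.
move=> hl; have wl := lq_weight l N1.
have tail (X : nat -> 'M[C]_n) p p' : (forall j a b, nrm (X j a b) <= Ka * rho ^+ j) ->
    clsE (lset l N) (lq l) 1 (2 * Ka * N) (fun z => (psum_mx X z - X 0%N) p p').
  move=> hX; have [h _] := psum_tail N1 hl Ka0 rho0 rhoN 1 (fun j => hX j p p').
  rewrite expr1 in h; apply: clsE_eq h => z _; rewrite big_ord1 expr0 mulr1.
  by rewrite !mxE.
have bZ (b : bool) M f : clsE (lset l N) (lq l) 1 M f ->
    clsE (lset l N) (lq l) 1 M (fun z => b%:R * f z).
  move=> hf; have M0 : 0 <= M by case: hf => f' /clsge0.
  apply: (clsE_le wl _ (clsE_Z b%:R hf)); case: b; rewrite ?nrm1 ?nrm0; lra.
have h ij : clsE (lset l N) (lq l) 1 Ca (co ij.1 ij.2).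
  rewrite /Ca mulrDl mul1r; apply: clsE_D; first exact: bZ (tail _ _ _ hA).
  by apply: clsE_N; exact: bZ (tail _ _ _ hB).
have [co' hco] := choice h; by exists (fun i j => co' (i, j)) => i j; exact: (hco (i, j)).
Qed.

Lemma order_exists : exists k0, forall k, (k0 <= k)%N ->
  (#|{: 'I_n * 'I_n}|%:R * (3 * Ca)) / (c * k.+1%:R) <= 1 / 2.
Proof.
set X := _%:R * _; exists (Num.truncn `|2 * X / c|) => k hk.
rewrite ler_pdivrMr ?mulr_gt0 //.
have : 2 * X / c <= k.+1%:R.
  apply: le_trans (ler_norm _) _; apply: le_trans (ltW (truncnS_gt _)) _.
  by rewrite ler_nat.
by rewrite ler_pdivrMr // => h; lra.
Qed.

Lemma partial_mx_der K z i j : partial_mx' F K z i j =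
  \sum_(k < K.+1) F k i j * (- k%:R * z^-1 ^+ k.+1).
Proof. by rewrite /partial_mx' summxE; apply: eq_bigr => k _; rewrite mxE mulrC. Qed.

Lemma partial_mx_entry K z i j : partial_mx F K z i j =
  \sum_(k < K.+1) F k i j * z^-1 ^+ k.
Proof. by rewrite /partial_mx summxE; apply: eq_bigr => k _; rewrite mxE mulrC. Qed.

(** The last term of the longer partial sum is moved into the error. *)
Lemma gauge_weak1 L M : exists M', forall l G G', (forall z, l z <= nrm z) ->
  gauge_solution l L.+2 M G G' -> gauge_solution l L.+1 M' G G'.
Proof.
pose f := fun ab : 'I_n * 'I_n => nrm (F L.+2 ab.1 ab.2) * 3 ^+ L.+2.
have f0 ab : 0 <= f ab by rewrite mulr_ge0 ?nrm_ge0 // exprn_ge0.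
exists (M + \sum_ab f ab) => l G G' hl [h ode]; split=> // a b.
have wl := lq_weight l N1.
have h1 := cls_weak wl (leqnSn _) (clsD (h a b) (clsZ (F L.+2 a b) (cls_invX N1 hl L.+2))).
apply: (@cls_le _ _ _ wl _ (M + f (a, b))).
  by rewrite lerD2l (bigD1 (a, b)) //= lerDl sumr_ge0.
apply: cls_eq h1 => z _; rewrite !mxE.
  by rewrite !partial_mx_entry [in LHS]big_ord_recr /=; ring.
by rewrite !partial_mx_der [in LHS]big_ord_recr /=; ring.
Qed.

Lemma gauge_weak K L M : (K <= L)%N -> exists M', forall l G G', (forall z, l z <= nrm z) ->
  gauge_solution l L.+1 M G G' -> gauge_solution l K.+1 M' G G'.
Proof.
move=> /subnKC <-; elim: (L - K)%N M => [|i IH] M; first by exists M; rewrite addn0.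
have [M1 h1] := gauge_weak1 (K + i) M; have [M2 h2] := IH M1.
by exists M2 => l G G' hl; rewrite addnS => h; apply: h2 => //; exact: h1.
Qed.

Section Order.
Variable k0 : nat.
Hypothesis hk0 : forall k, (k0 <= k)%N ->
  (#|{: 'I_n * 'I_n}|%:R * (3 * Ca)) / (c * k.+1%:R) <= 1 / 2.

(** Truncation at [K + 1] leaves a residual of order [K + 2], corrected by a ray solution of order
    [K + 1]. The bound is chosen before [l] and [e], since it has to serve a whole family of
    weights. *)
Lemma gauge_exists K : (k0 <= K)%N -> exists M, forall l e, admissible l e ->
  exists G G', gauge_solution l K.+1 M G G'.
Proof.
move=> hK; have [MS hS] : exists M, forall a b l, (forall z, l z <= nrm z) ->
    clsE (lset l N) (lq l) K.+2 M (fun z => residual K.+1 z a b).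
  have /choice[M hM] := fun ab : 'I_n * 'I_n => residual_cls K.+1 ab.1 ab.2.
  exists (\sum_ab `|M ab|) => a b l hl.
  apply: (clsE_le (lq_weight l N1) _ (hM (a, b) l hl)).
  by apply: le_trans (ler_norm _) _; rewrite (bigD1 (a, b)) //= lerDl sumr_ge0.
exists (2 * (MS / (c * K.+1%:R))) => l e [hl e1 hle hre].
have [co' hco] := co_cls hl.
have /choice[s' hs'] := fun ab : 'I_n * 'I_n => hS ab.1 ab.2 l hl.
have [x [x' hx]] := @system_solution R l c N c0 N1 ('I_n * 'I_n)%type
  (fun i => lam i.1 - lam i.2) (fun i => e i.1 i.2) co co' Ca
  (fun i => e1 i.1 i.2) (fun i => hle i.1 i.2) (fun i => hre i.1 i.2) hco
  K MS _ s' (hk0 hK) hs'.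
pose H z : 'M[C]_n := \matrix_(a, b) x (a, b) z.
pose H' z : 'M[C]_n := \matrix_(a, b) x' (a, b) z.
exists (fun z => partial_mx F K.+1 z + H z), (fun z => partial_mx' F K.+1 z + H' z).
split=> [a b|z hz].
  by apply: cls_eq (hx (a, b)).1 => z _; rewrite addrAC subrr add0r mxE.
apply/matrixP => a b; have := (hx (a, b)).2 z hz.
have -> : \sum_j co (a, b) j z * x j z = \sum_j co (a, b) j z * H z j.1 j.2.
  by apply: eq_bigr => -[p r] _; rewrite mxE.
have -> : x (a, b) z = H z (a, b).1 (a, b).2 by rewrite mxE.
rewrite commutator_system /= -residualE => E.
rewrite [LHS]mxE [H' z a b]mxE E mulmxDr mulmxDl opprD addrACA.
have addE (X Y : 'M[C]_n) : (X + Y) a b = X a b + Y a b by rewrite mxE.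
have oppE (X : 'M[C]_n) : (- X) a b = - X a b by rewrite mxE.
by rewrite !addE !oppE; ring.
Qed.

Lemma gauge_unique l e M1 M2 G1 G1' G2 G2' : admissible l e ->
  gauge_solution l k0.+2 M1 G1 G1' -> gauge_solution l k0.+2 M2 G2 G2' ->
  forall z, lset l N z -> G1 z = G2 z.
Proof.
move=> [hl e1 hle hre] [c1 o1] [c2 o2] z hz.
have [co' hco] := co_cls hl.
pose x (i : 'I_n * 'I_n) z := (G1 z - G2 z) i.1 i.2.
pose x' (i : 'I_n * 'I_n) z := (G1' z - G2' z) i.1 i.2.
have hx i : cls (lset l N) (lq l) k0.+2 (M1 + M2) (x i) (x' i).
  apply: cls_eq (clsD (c1 i.1 i.2) (clsN (c2 i.1 i.2))) => u _; rewrite /x /x' !mxE.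
    by ring.
  by ring.
have hk : (#|{: 'I_n * 'I_n}|%:R * Ca) / (c * k0.+2%:R) <= 1 / 2.
  apply: le_trans (hk0 (leqnSn k0)); rewrite ler_wpM2r ?invr_ge0 ?mulr_ge0 ?(ltW c0) //.
  by rewrite ler_wpM2l //; have := Ca_ge0; lra.
have ode i u : lset l N u ->
    x' i u = (lam i.1 - lam i.2) * x i u + \sum_j co i j u * x j u.
  move=> hu; rewrite /x commutator_system /x' o1 // o2 //.
  by congr (fun_of_matrix _ _ _); rewrite mulmxBr mulmxBl !opprD !opprK addrACA.
have := @system_unique R l c N c0 N1 ('I_n * 'I_n)%type
  (fun i => lam i.1 - lam i.2) (fun i => e i.1 i.2) co co' Ca
  (fun i => e1 i.1 i.2) (fun i => hle i.1 i.2) (fun i => hre i.1 i.2) hco Ca_ge0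
  k0 (M1 + M2) x x' hk hx ode => U.
by apply/matrixP => a b; have := U (a, b) z hz; rewrite /x !mxE => /eqP; rewrite subr_eq0 => /eqP.
Qed.

(** [G] coincides with the solution built at order [L + 1], whose error is known at order [K + 1].
    As [M] precedes [l] and [G], the estimate is uniform over all admissible weights. *)
Lemma gauge_asymptotic K : exists M, forall l e M0 G G', admissible l e ->
  gauge_solution l k0.+2 M0 G G' ->
  forall z a b, lset l N z -> nrm ((G z - partial_mx F K z) a b) <= M * (l z)^-1 ^+ K.+1.
Proof.
set L := maxn K k0.+1.
have kL : (k0.+1 <= L)%N by rewrite leq_maxr.
have KL : (K <= L)%N by rewrite leq_maxl.
have [M1 h1] := gauge_exists (ltnW kL).
have [M2 h2] := gauge_weak M1 kL; have [M3 h3] := gauge_weak M1 KL.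
pose f := fun ab : 'I_n * 'I_n => nrm (F K.+1 ab.1 ab.2).
have f0 ab : 0 <= f ab := nrm_ge0 _.
exists (M3 + \sum_ab f ab) => l e M0 G G' adm hG z a b hz.
have hl : forall z, l z <= nrm z by case: adm.
have [G2 [G2' hG2]] := h1 l e adm.
rewrite (gauge_unique adm hG (h2 _ _ _ hl hG2) hz).
have [h _] := h3 _ _ _ hl hG2.
have := cls0 (h a b) hz; rewrite /lq minxx => h0.
have lp : 0 < l z by have := N1; have := (hz : N <= l z); lra.
have [hi _] := lq_nrm N1 hl hz hz; rewrite /lq minxx in hi.
(* The error is known relative to the partial sum up to [K + 1]; its last term has the order allowed
   by the claim. *)
have -> : (G2 z - partial_mx F K z) a b =
    (G2 z - partial_mx F K.+1 z) a b + F K.+1 a b * z^-1 ^+ K.+1.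
  rewrite [LHS]mxE [(G2 z - partial_mx F K.+1 z) a b]mxE.
  rewrite [(- partial_mx F K z) a b]mxE [(- partial_mx F K.+1 z) a b]mxE.
  by rewrite !partial_mx_entry [in RHS]big_ord_recr /=; ring.
apply: le_trans (nrmD _ _) _; rewrite mulrDl; apply: lerD => //.
rewrite nrmM nrmX nrmV; apply: ler_pM; rewrite ?exprn_ge0 ?invr_ge0 ?nrm_ge0 //.
  by rewrite (bigD1 (a, b)) //= lerDl sumr_ge0.
by rewrite lerXn2r ?nnegrE ?invr_ge0 ?nrm_ge0 ?(ltW lp).
Qed.

End Order.
End Gauge.

(** * The normal form and its fundamental solution *)

Section NormalForm.
Variable R : realType.
Notation C := (Cx R).
Variables (n mbar : nat) (Lambda D S : 'M[C]_n) (Rl : nat -> 'M[C]_n).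
Let L := S + \sum_(1 <= l < mbar.+1) Rl l.
Hypotheses (LD : Lambda *m D = D *m Lambda) (LL : Lambda *m L = L *m Lambda)
  (DS : D *m S = S *m D)
  (DR : forall l, (1 <= l <= mbar)%N -> D *m Rl l = Rl l *m D - l%:R *: Rl l).

Definition normal_form (z : C) : 'M[C]_n :=
  Lambda + z^-1 *: (D + S + \sum_(1 <= l < mbar.+1) z ^- l *: Rl l).

Definition normal_solution (w : C) : 'M[C]_n :=
  zpowmx D w *m zpowmx L w *m expzmx Lambda w.

Lemma cexp_natmul l (w : C) : cexp (l%:R * w) = cexp w ^+ l.
Proof.
elim: l => [|l IH]; first by rewrite mul0r cexp0.
by rewrite -natr1 mulrDl mul1r cexpD IH exprSr.
Qed.

Lemma zpow_shear w :
  zpowmx D w *m L = (S + \sum_(1 <= l < mbar.+1) (cexp w) ^- l *: Rl l) *m zpowmx D w.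
Proof.
rewrite /L mulmxDr mulmxDl /zpowmx (expmx_intertwine _ DS); congr (_ + _).
rewrite mulmx_sumr mulmx_suml; apply: eq_big_nat => l hl.
have h : D *m Rl l = Rl l *m (D - l%:R%:M).
  by rewrite DR // mulmxBr mul_mx_scalar.
by rewrite (expmx_intertwine _ h) expmx_shift cexpN cexp_natmul -scalemxAr scalemxAl.
Qed.

Lemma normal_solution_der w :
  mqder normal_solution w (cexp w *: (normal_form (cexp w) *m normal_solution w)).
Proof.
have dX : mqder (fun w => expzmx Lambda w) w (cexp w *: (Lambda *m expzmx Lambda w)).
  exact: (mqder_comp (mqder_expmx Lambda (cexp w)) (qder_cexp w)).
have := mqderM (mqderM (mqder_expmx D w) (mqder_expmx L w)) dX.
apply: mqder_eq => //; rewrite -/(zpowmx D w) -/(zpowmx L w).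
have z0 := cexp_neq0 w; set z := cexp w in z0 *.
have h1 : zpowmx L w *m Lambda = Lambda *m zpowmx L w := expmx_intertwine w (esym LL).
have h2 : zpowmx D w *m Lambda = Lambda *m zpowmx D w := expmx_intertwine w (esym LD).
have h3 := zpow_shear w; rewrite -/z in h3; rewrite /normal_solution /normal_form.
move: h1 h2 h3; set T := \sum_(1 <= l < _) _ *: _.
move: (zpowmx L w) (zpowmx D w) (expzmx Lambda w) => Y X E; move: (L) (T) => L' T' h1 h2 h3.
rewrite (mulmxA X L') h3 -(mulmxA D X Y) -(mulmxA (S + T') X Y) -scalemxAr (mulmxA _ Lambda).
rewrite -(mulmxA X Y) h1 (mulmxA X) h2 -(mulmxA Lambda).
rewrite -mulmxDl (addrA D) (mulmxDl Lambda) scalerDr [LHS]addrC -!mulmxA; congr (_ + _).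
by rewrite -scalemxAl scalerA mulfV // scale1r.
Qed.

Lemma normal_solution_unit w : normal_solution w \in unitmx.
Proof.
rewrite /normal_solution !unitmx_mul; apply/andP; split; last exact: expmx_unit.
by apply/andP; split; exact: expmx_unit.
Qed.

End NormalForm.

(** * Gluing the solutions over the subsector *)

Section SectorialGauge.
Variable R : realType.
Notation C := (Cx R).
Variables (n : nat) (lam : 'I_n -> C) (At Bt F : nat -> 'M[C]_n) (Ka rho c N : R).
Hypotheses (Ka0 : 0 <= Ka) (rho0 : 0 <= rho) (c0 : 0 < c) (N1 : 1 <= N) (rhoN : 6 * rho <= N).
Hypothesis hA : forall j a b, nrm (At j a b) <= Ka * rho ^+ j.
Hypothesis hB : forall j a b, nrm (Bt j a b) <= Ka * rho ^+ j.
Hypothesis A0 : forall a b, At 0%N a b = lam a *+ (a == b).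
Hypothesis B0 : forall a b, Bt 0%N a b = lam a *+ (a == b).
Hypothesis Frec : forall k, \sum_(j < k.+1)
   (At j *m F (k - j)%N - F (k - j)%N *m Bt j) + k.-1%:R *: F k.-1 = 0.

Lemma gauge_solution_cls l K M G G' a b : (forall z, l z <= nrm z) ->
  gauge_solution At Bt F N l K M G G' ->
  exists M', cls (lset l N) (lq l) 0 M' (fun z => G z a b) (fun z => G' z a b).
Proof.
move=> hl [h _]; have wl := lq_weight l N1.
have h1 := @cls_sum R _ _ _ (index_enum 'I_K.+1) xpredT 0 _ _ _
  (fun k _ => clsZ (F k a b) (cls_weak wl (leq0n k) (cls_invX N1 hl k))).
have bE (X Y : 'M[C]_n) : (X - Y) a b = X a b - Y a b by rewrite !mxE.
eexists; apply: cls_eq (clsD (cls_weak wl (leq0n _) (h a b)) h1) => z _ /=.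
  by rewrite bE partial_mx_entry subrK.
by rewrite bE partial_mx_der subrK.
Qed.

Variables (P : set C) (c' : R) (lw : C -> C -> R).
Hypothesis c'0 : 0 < c'.
Hypothesis lw_lip : forall w u z, lw w u - lw w z <= nrm (u - z).
Hypothesis lwP : forall w, P w -> exists2 r : R, 0 < r & forall u, nrm (u - w) <= r ->
  [/\ exists e, admissible lam c (lw u) e,
      exists e, admissible lam c (fun z => Num.min (lw u z) (lw w z)) e,
      c' * nrm (cexp u) <= lw u (cexp u) & c' * nrm (cexp u) <= lw w (cexp u)].

Lemma nrm_cexp_near (u w : C) : nrm (u - w) <= 1 / 2 -> nrm (cexp w) <= 2 * nrm (cexp u).
Proof.
move=> h; rewrite !nrm_cexp.
have t2 : complex.Re w - complex.Re u <= 1 / 2.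
  rewrite -cReN -cReD; apply: le_trans (ler_norm _) _; apply: le_trans (Re_nrm _) _.
  by rewrite nrmBC.
rewrite -[X in expR X](subrK (complex.Re u)) expRD ler_wpM2r ?expR_ge0 //.
have := expR_ge1Dx (- (complex.Re w - complex.Re u)); rewrite expRN.
move: (complex.Re w - complex.Re u) t2 => t t2; have e0 := expR_gt0 t => h1.
have : expR t * (1 - t) <= 1 by rewrite -[leRHS](mulfV (lt0r_neq0 e0)) ler_wpM2l // ltW.
nra.
Qed.

(** At [w] the solution attached to the weight [lw w] is evaluated. Near [w] the attached solutions
    agree: both restrict to the domain of the minimum of the two weights, which is again admissible,
    and uniqueness applies there. *)
Theorem sectorial_gauge : exists N' (G G' : C -> 'M[C]_n),
  [/\ forall w, P w -> N' < nrm (cexp w) -> exists2 r : R, 0 < r & forall u, nrm (u - w) <= r ->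
        [/\ N <= nrm (cexp u), mqder G u (cexp u *: G' u) &
          G' u = psum_mx At (cexp u) *m G u - G u *m psum_mx Bt (cexp u)] &
      forall K, exists M, forall w, P w -> N' < nrm (cexp w) -> forall a b,
        nrm ((G w - partial_mx F K (cexp w)) a b) <= M * (nrm (cexp w))^-1 ^+ K.+1].
Proof.
have [k0 hk0] := order_exists n Ka N c0.
have [M0 hM0] := gauge_exists Ka0 rho0 c0 N1 rhoN hA hB A0 B0 Frec hk0 (leqnSn k0).
(* The choice depends on the weight alone, so points with the same weight share one solution. *)
have /choice[gl hgl] : forall l : C -> R, exists g : (C -> 'M[C]_n) * (C -> 'M[C]_n),
    (exists e, admissible lam c l e) -> gauge_solution At Bt F N l k0.+2 M0 g.1 g.2.
  move=> l; have [[e he]|ne] := pselect (exists e, admissible lam c l e).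
    by have [G [G' h]] := hM0 l e he; exists (G, G').
  by exists (fun=> 0, fun=> 0).
pose G w := (gl (lw w)).1 (cexp w); pose G' w := (gl (lw w)).2 (cexp w).
(* The 2 compares [cexp] at points within [1/2] of each other; the added 1 keeps a unit ball around
   [cexp u] inside the domain. *)
pose N' := 2 * (N + 1) / c'.
have N'0 u w : nrm (u - w) <= 1 / 2 -> N' < nrm (cexp w) -> N + 1 <= c' * nrm (cexp u).
  move=> /nrm_cexp_near h1; rewrite /N' ltr_pdivrMr // => h2.
  have := ler_wpM2r (ltW c'0) h1; lra.
exists N', G, G'; split; last first.
  move=> K; have [M hM] := gauge_asymptotic Ka0 rho0 c0 N1 rhoN hA hB A0 B0 Frec hk0 K.
  exists (`|M| * c'^-1 ^+ K.+1) => w Pw hw a b.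
  have [r r0 hr] := lwP Pw; have := hr w; rewrite subrr nrm0 => /(_ (ltW r0)) [ex _ hl _].
  have [e he] := ex.
  have lN : N + 1 <= lw w (cexp w).
    by apply: le_trans hl; apply: (N'0 w w) => //; rewrite subrr nrm0; lra.
  have N0 := N1; have inN : lset (lw w) N (cexp w) by rewrite /lset /=; lra.
  apply: le_trans (hM _ _ _ _ _ he (hgl _ ex) _ a b inN) _.
  have n0 : 0 < nrm (cexp w) by rewrite nrm_cexp expR_gt0.
  have l0 : 0 < lw w (cexp w) by lra.
  apply: le_trans (_ : `|M| * (lw w (cexp w))^-1 ^+ K.+1 <= _).
    by rewrite ler_wpM2r ?ler_norm // exprn_ge0 // invr_ge0 ltW.
  rewrite -mulrA ler_wpM2l // -exprMn -invfM lerXn2r ?nnegrE ?invr_ge0 ?mulr_ge0 ?(ltW n0) ?(ltW l0) ?(ltW c'0) //.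
  by rewrite lef_pV2 ?posrE ?mulr_gt0.
move=> w Pw hw; have [r r0 hr] := lwP Pw.
have N0 := N1.
pose r1 := Num.min r (1 / 2).
have r10 : 0 < r1 by rewrite lt_min r0; lra.
have base u : nrm (u - w) <= r1 ->
    [/\ lset (lw u) N (cexp u), N + 1 <= lw w (cexp u) & G u = (gl (lw w)).1 (cexp u)].
  rewrite le_min => /andP[ur u2]; have [ex [em hem] h1 h2] := hr u ur.
  have N2 := N'0 u w u2 hw.
  have in1 : lset (lw u) N (cexp u) by rewrite /lset /=; lra.
  have in2 : lset (lw w) N (cexp u) by rewrite /lset /=; lra.
  split=> //; first by lra.
  have [exw _ _ _] : [/\ exists e, admissible lam c (lw w) e, True, True & True].
    by have := hr w; rewrite subrr nrm0 => /(_ (ltW r0)) [].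
  (* A smaller weight shrinks the domain and enlarges [lq], so a solution restricts with the same
     constant. *)
  have sub l l' M g g' : (forall z, l' z <= l z) ->
      gauge_solution At Bt F N l k0.+2 M g g' -> gauge_solution At Bt F N l' k0.+2 M g g'.
    move=> ll [hc ho]; split=> [a b|z hz]; last by apply: ho; exact: le_trans (ll z).
    have dsub z : lset l' N z -> lset l N z by move=> hz; exact: le_trans (ll z).
    have pos z : lset l' N z -> 0 < l' z by move=> hz; have := (hz : N <= l' z); lra.
    have qsub u' z k : lset l' N u' -> lset l' N z -> lq l u' z ^+ k <= lq l' u' z ^+ k.
      move=> hu hz; have p1 := pos _ hu; have p2 := pos _ hz.
      have p3 : 0 < Num.min (l' u') (l' z) by rewrite lt_min p1.
      have le : Num.min (l' u') (l' z) <= Num.min (l u') (l z).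
        by rewrite le_min !ge_min !ll orbT.
      rewrite /lq lerXn2r ?nnegrE ?invr_ge0 ?(ltW p3) ?(le_trans (ltW p3) le) //.
      by rewrite lef_pV2 ?posrE // (lt_le_trans p3 le).
    case: (hc a b) => q0 q1 q2 q3 q4; split=> // [z hz|z hz|u' z hu hz|u' z hu hz].
    - by apply: le_trans (q1 z (dsub z hz)) _; rewrite ler_wpM2l ?qsub.
    - by apply: le_trans (q2 z (dsub z hz)) _; rewrite ler_wpM2l ?qsub.
    - apply: le_trans (q3 _ _ (dsub _ hu) (dsub _ hz)) _.
      by rewrite ler_wpM2l ?nrm_ge0 // ler_wpM2l ?qsub.
    - apply: le_trans (q4 _ _ (dsub _ hu) (dsub _ hz)) _.
      by rewrite ler_wpM2l ?exprn_ge0 ?nrm_ge0 // ler_wpM2l ?qsub.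
  have le1 z : Num.min (lw u z) (lw w z) <= lw u z by rewrite ge_min lexx.
  have le2 z : Num.min (lw u z) (lw w z) <= lw w z by rewrite ge_min lexx orbT.
  have inm : lset (fun z => Num.min (lw u z) (lw w z)) N (cexp u).
    by rewrite /lset /= le_min in1 in2.
  exact: (gauge_unique Ka0 rho0 c0 N1 rhoN hA hB A0 B0 hk0 hem
    (sub _ _ _ _ _ le1 (hgl _ ex)) (sub _ _ _ _ _ le2 (hgl _ exw)) inm).
exists (r1 / 2) => [|u hu]; first by lra.
have hu1 : nrm (u - w) <= r1 by lra.
have [in1 lN GE] := base u hu1.
have [ex _ _ _] : [/\ exists e, admissible lam c (lw u) e, True, True & True].
  by move: hu1; rewrite le_min => /andP[/hr[ex _ _ _] _].
have [exw _ _ _] : [/\ exists e, admissible lam c (lw w) e, True, True & True].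
  by have := hr w; rewrite subrr nrm0 => /(_ (ltW r0)) [].
have [e [hl _ _ _]] := ex; have [ew [hlw _ _ _]] := exw.
split; first exact: le_trans (hl _).
  have [_ ode] := hgl _ exw; have [_ ode'] := hgl _ ex.
  have inw : lset (lw w) N (cexp u) by rewrite /lset /=; lra.
  have -> : G' u = (gl (lw w)).2 (cexp u) by rewrite (ode _ inw) -GE; exact: (ode' _ in1).
  have dG : mqder (gl (lw w)).1 (cexp u) ((gl (lw w)).2 (cexp u)).
    move=> a b; have [M' hM'] := gauge_solution_cls a b hlw (hgl _ exw).
    (* The weight is 1-Lipschitz and exceeds [N] by at least 1 at [cexp u], so the unit ball lies in
       the domain. *)
    apply: (cls_qder (lq_weight _ N1) hM' inw ltr01) => v hv.
    have := lw_lip w (cexp u) v; rewrite nrmBC /lset /= => hlip; lra.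
  have d := mqder_comp dG (qder_cexp u).
  have r20 : 0 < r1 / 2 by lra.
  move=> a b; apply: (qder_local r20 _ (d a b)) => v hv.
  have hv1 : nrm (v - w) <= r1.
    rewrite (_ : v - w = (v - u) + (u - w)); last by ring.
    by apply: le_trans (nrmD _ _) _; lra.
  by have [_ _ ->] := base v hv1.
exact: ((hgl _ ex).2 _ in1).
Qed.

End SectorialGauge.

(** * Directions and weights in a subsector *)

Section Sectors.
Variable R : realType.
Notation C := (Cx R).

Definition cis (t : R) : C := cexp (0 +i* t).

Lemma nrm_cis t : nrm (cis t) = 1.
Proof. by rewrite nrm_cexp /= expR0. Qed.

Lemma cexp_polar w : cexp w = ofR (nrm (cexp w)) * cis (complex.Im w) :> C.
Proof.
rewrite nrm_cexp; apply: complex_ext; rewrite ?ReMofR ?ImMofR /cis /Pilot.Defs.proj /=.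
  by rewrite expR0 mul1r.
by rewrite expR0 mul1r.
Qed.

(* The signed distance from [z] to the line through 0 orthogonal to [cis phi]. *)
Definition halfplane (phi : R) (z : C) : R := complex.Re (cis (- phi) * z).

Lemma halfplaneD phi u z : halfplane phi (u + z) = halfplane phi u + halfplane phi z.
Proof. by rewrite /halfplane mulrDr cReD. Qed.

Lemma halfplane_cis phi r t : halfplane phi (ofR r * cis t) = r * cos (t - phi).
Proof.
rewrite /halfplane mulrCA ReMofR -cexpD; congr (_ * _).
by rewrite /Pilot.Defs.proj /= addr0 expR0 mul1r addrC.
Qed.

Lemma halfplane_le phi z : halfplane phi z <= nrm z.
Proof.
apply: le_trans (ler_norm _) _; apply: le_trans (Re_nrm _) _.
by rewrite nrmM nrm_cis mul1r.
Qed.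

Lemma halfplane_lip phi u z : halfplane phi u - halfplane phi z <= nrm (u - z).
Proof.
by rewrite -[u in halfplane phi u](subrK z) halfplaneD addrK halfplane_le.
Qed.

Lemma halfplane_cexp phi w : halfplane phi (cexp w) = nrm (cexp w) * cos (complex.Im w - phi).
Proof. by rewrite {1}cexp_polar halfplane_cis. Qed.

Lemma halfplane_ray phi z r t :
  halfplane phi (z + ofR r * cis t) = halfplane phi z + r * cos (t - phi).
Proof. by rewrite halfplaneD halfplane_cis. Qed.

Lemma cos_lip (x y : R) : `|cos x - cos y| <= `|x - y|.
Proof.
have := @mvt_abs R (fun t => cos (y + t)) (fun t => - sin (y + t)) (x - y) 1.
rewrite /= mul1r addr0 [y + _]addrC subrK; apply=> [t|t _]; last by rewrite normrN sin_max.
have -> : (fun t : R => cos (y + t)) = cos \o (fun t => y + t) by [].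
have := @is_derive1_comp R cos (fun t => y + t) t (- sin (y + t)) 1 _ _.
rewrite mulr1; apply.
have := @is_deriveD R R R (cst y) id t 1 0 1 _ _; rewrite add0r; exact.
Qed.

Lemma cos_ge (y d : R) : 0 < d -> `|y| <= pi / 2 - d -> cos (pi / 2 - d) <= cos y.
Proof.
move=> d0 hy; have p0 := @pi_gt0 R; have y0 := normr_ge0 y.
rewrite -(cos_norm y); move: hy; rewrite le_eqVlt => /predU1P[->//|hy].
by apply/ltW; rewrite ltr_cos // in_itv /=; apply/andP; split; lra.
Qed.

Variables (s : nat) (p : 'I_s -> nat) (lambda : 'I_s -> C).
Notation n := (\sum_(i < s) p i)%N.
Let lam (a : 'I_n) : C := lambda (tagnat.sig1 a).

(* [lw w] is the weight used near the point of [P] with logarithm [w]; admissibility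
   of the minimum of two of them is what lets the solutions be compared. *)
Definition sector_weights (P : set C) (c c' : R) (lw : C -> C -> R) :=
  [/\ 0 < c, 0 < c', forall w u z, lw w u - lw w z <= nrm (u - z) &
  forall w, P w -> exists2 r : R, 0 < r & forall u, nrm (u - w) <= r ->
  [/\ exists e, admissible lam c (lw u) e,
      exists e, admissible lam c (fun z => Num.min (lw u z) (lw w z)) e,
      c' * nrm (cexp u) <= lw u (cexp u) & c' * nrm (cexp u) <= lw w (cexp u)]].

(** All exponents vanish, so any direction is allowed, and the half-plane centred at the argument of
    [w] can be used at [w]. Directions at most [1/2] apart have cosine at least [1/2], which makes
    neighbouring half-planes comparable. *)
Lemma sector_weights_single (P : set C) : s = 1%N ->
  sector_weights P (1 / 2) (1 / 2) (fun w => halfplane (complex.Im w)).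
Proof.
move=> s1; split; [by lra|by lra|by move=> *; exact: halfplane_lip|].
have lamE a b : lam a = lam b.
  by rewrite /lam; congr lambda; apply: val_inj; case: (tagnat.sig1 a) (tagnat.sig1 b) =>
    i hi [j hj] /=; move: hi hj; rewrite s1; case: i => //; case: j.
move=> w _; exists (1 / 2) => [|u hu]; first by lra.
have hI : `|complex.Im u - complex.Im w| <= 1 / 2.
  by rewrite -cImN -cImD; exact: le_trans (Im_nrm _) hu.
have hcos (x : R) : `|x| <= 1 / 2 -> 1 / 2 <= cos x.
  move=> hx; have := cos_quad x; rewrite -(real_normK (num_real x)) => h.
  have := ler_norm (1 - cos x); rewrite distrC; have := normr_ge0 x; nra.
have nn := nrm_ge0 (cexp u).
split.
- exists (fun _ _ => cis (complex.Im u)); split=> [z|a b|a b z r r0|a b].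
  + exact: halfplane_le.
  + by rewrite nrm_cis.
  + by rewrite halfplane_ray subrr cos0; lra.
  + by rewrite (lamE a b) subrr mul0r.
- exists (fun _ _ => cis (complex.Im w)); split=> [z|a b|a b z r r0|a b].
  + by rewrite ge_min halfplane_le.
  + by rewrite nrm_cis.
  + rewrite !halfplane_ray subrr cos0 mulr1 le_min; apply/andP; split.
      apply: lerD; first by rewrite ge_min lexx.
      by rewrite mulrC ler_wpM2l // hcos // distrC.
    apply: lerD; first by rewrite ge_min lexx orbT.
    lra.
  + by rewrite (lamE a b) subrr mul0r.
- by rewrite halfplane_cexp subrr cos0 mulr1; lra.
- by rewrite halfplane_cexp mulrC ler_wpM2l // hcos.
Qed.

Lemma stokes_cis (t : R) j k : j != k ->
  complex.Re ((lambda j - lambda k) * cis t) = 0 -> stokes_directions lambda t.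
Proof. by move=> jk h; exists (0 +i* t); split=> //; exists j, k. Qed.

Lemma Re_cis (a : C) t : complex.Re (a * cis t) = complex.Re a * cos t - complex.Im a * sin t.
Proof. by rewrite cReM /cis /Pilot.Defs.proj /= expR0 !mul1r. Qed.

Variable tau : int -> R.
Hypothesis htau : stokes_labelling lambda tau.

Lemma no_stokes_between nu (t : R) : tau nu < t < tau (nu + 1) -> ~ stokes_directions lambda t.
Proof.
have [mono rng] := htau; move=> /andP[h1 h2]; rewrite -rng => -[m _ E]; rewrite -{}E in h1 h2.
have [h|h] := leP m nu.
  have : tau m <= tau nu by move: h; rewrite le_eqVlt => /predU1P[->//|/mono/ltW].
  by rewrite leNgt h1.
have {}h : nu + 1 <= m by rewrite lezD1.
have : tau (nu + 1) <= tau m by move: h; rewrite le_eqVlt => /predU1P[->//|/mono/ltW].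
by rewrite leNgt h2.
Qed.

(** The opposite of a Stokes ray is a Stokes ray, so [tau nu + pi] cannot lie strictly between
    consecutive directions. *)
Lemma stokes_gap nu : 0 < tau (nu + 1) - tau nu <= pi.
Proof.
have [mono rng] := htau; have lt1 : tau nu < tau (nu + 1) by apply: mono; rewrite ltzD1.
rewrite subr_gt0 lt1 /= leNgt; apply/negP => h.
have : stokes_directions lambda (tau nu) by rewrite -rng; exists nu.
move=> [w [E [j [k [jk hw]]]]].
apply: (@no_stokes_between nu (tau nu + pi)); first by have := @pi_gt0 R; lra.
apply: (stokes_cis jk); rewrite Re_cis.
move: hw; rewrite cexp_polar mulrCA ReMofR -/(arg w) -E Re_cis.
move/eqP; rewrite mulf_eq0 => /orP[|/eqP h0].
  by rewrite nrm_cexp expR_eq0.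
by rewrite cosDpi sinDpi; lra.
Qed.

(** Between consecutive Stokes directions the real part has no zero, hence a constant sign. Since
    [t2] is opposite to a direction in this gap, it sees the other sign. *)
Lemma stokes_sign nu (t1 t2 : R) j k : j != k -> tau nu < t1 < tau (nu + 1) ->
  tau nu < t2 + pi < tau (nu + 1) ->
  0 <= complex.Re ((lambda j - lambda k) * cis t1) \/
  0 <= complex.Re ((lambda j - lambda k) * cis t2).
Proof.
move=> jk h1 h2; have [|h3] := leP 0 (complex.Re ((lambda j - lambda k) * cis t1)); first by left.
right; rewrite leNgt; apply/negP => h4.
pose f (t : R) := complex.Re ((lambda j - lambda k) * cis t).
have fE : f = fun t => complex.Re (lambda j - lambda k) * cos t - complex.Im (lambda j - lambda k) * sin t.
  by apply/funext => t; rewrite /f Re_cis.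
have fc (a b : R) : {within `[a, b], continuous f}.
  apply: continuous_subspaceT => t; rewrite fE; apply: cvgB; apply: cvgM; try exact: cvg_cst.
    exact: continuous_cos.
  exact: continuous_sin.
have f2 : 0 < f (t2 + pi).
  by move: h4; rewrite -/(f t2) fE cosDpi sinDpi; lra.
have no t : tau nu < t < tau (nu + 1) -> f t <> 0.
  by move=> ht ft; exact: (no_stokes_between ht (stokes_cis jk ft)).
have [le12|/ltW le21] := leP t1 (t2 + pi).
  have [|t] := IVT le12 (fc _ _) (v := 0).
    by rewrite ge_min le_max (ltW h3) (ltW f2) orbT.
  rewrite in_itv /= => /andP[ht1 ht2]; apply: no.
  by move: h1 h2 => /andP[? _] /andP[_ ?]; lra.
have [|t] := IVT le21 (fc _ _) (v := 0).
  by rewrite ge_min le_max (ltW h3) (ltW f2) orbT.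
rewrite in_itv /= => /andP[ht1 ht2]; apply: no.
by move: h1 h2 => /andP[_ ?] /andP[? _]; lra.
Qed.

(** A single weight serves the whole subsector: the larger of two half-plane distances. Each
    direction used raises both distances at rate at least [c], hence also their maximum. *)
Lemma sector_weights_stokes nu (alpha beta : R) :
  tau nu - pi < alpha -> beta < tau (nu + 1) ->
  exists c c' lw, sector_weights (closed_sector alpha beta) c c' lw.
Proof.
move=> ha hb; have /andP[k0 kpi] := stokes_gap nu; have p0 := @pi_gt0 R.
set t0 := tau nu in ha k0 kpi *; set t1 := tau (nu + 1) in hb k0 kpi *.
(* Half of the smallest of three margins: the two ends of the subsector and the gap. All angles
   below then stay within [pi/2 - eta/2] of a normal. *)
pose eta := Num.min ((alpha - t0 + pi) / 2) (Num.min ((t1 - beta) / 2) ((t1 - t0) / 2)).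
have eta0 : 0 < eta by rewrite !lt_min; apply/and3P; split; lra.
have e1 : eta <= (alpha - t0 + pi) / 2 by rewrite ge_min lexx.
have e2 : eta <= (t1 - beta) / 2 by rewrite !ge_min lexx orbT.
have e3 : eta <= (t1 - t0) / 2 by rewrite !ge_min lexx !orbT.
(* The half-planes span the arguments from [t0 - pi + eta] to [t0 + eta] and from [t1 - pi - eta] to
   [t1 - eta]; together they cover the subsector, the first serving up to [t0]. *)
pose phi1 := t0 - pi / 2 + eta; pose phi2 := t1 - eta - pi / 2.
(* [th1] and [th2 + pi] both lie in the gap, as [stokes_sign] requires. *)
pose th1 := t0 + eta / 2; pose th2 := t1 - pi - eta / 2.
pose c := cos (pi / 2 - eta / 2).
have c0 : 0 < c by apply: cos_gt0_pihalf; lra.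
have cg (y : R) : - (pi / 2 - eta / 2) <= y <= pi / 2 - eta / 2 -> c <= cos y.
  by rewrite -ler_norml => h; apply: cos_ge => //; lra.
pose l z := Num.max (halfplane phi1 z) (halfplane phi2 z).
have lE : (fun z => Num.min (l z) (l z)) = l by apply/funext => z; rewrite minxx.
have adm : exists e, admissible lam c l e.
  pose th a b := if 0 <= complex.Re ((lam a - lam b) * cis th1) then th1 else th2.
  exists (fun a b => cis (th a b)); split=> [z|a b|a b z r r0|a b].
  - by rewrite ge_max !halfplane_le.
  - by rewrite nrm_cis.
  - have h1 : c <= cos (th a b - phi1).
      by apply: cg; rewrite /th; case: ifP => _; rewrite /th1 /th2 /phi1; lra.
    have h2 : c <= cos (th a b - phi2).
      by apply: cg; rewrite /th; case: ifP => _; rewrite /th1 /th2 /phi2; lra.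
    rewrite /l !halfplane_ray -lerBrDr ge_max; apply/andP; split; rewrite lerBrDr.
      by rewrite le_max lerD2l mulrC ler_wpM2l.
    by rewrite le_max lerD2l [c * r]mulrC ler_wpM2l // orbT.
  - rewrite /th; case: ifP => // /negbT h.
    have [E|ne] := eqVneq (tagnat.sig1 a) (tagnat.sig1 b).
      by rewrite /lam E subrr mul0r.
    have [] := @stokes_sign nu th1 th2 _ _ ne.
    + by rewrite -/t0 -/t1 /th1; lra.
    + by rewrite -/t0 -/t1 /th2; lra.
    + by move=> h'; rewrite h' in h.
    + by [].
exists c, (c / 2), (fun _ => l); split=> // [|w u z|w Pw]; first by lra.
  rewrite /l lerBlDr ge_max; apply/andP; split.
    have := halfplane_lip phi1 u z; have : halfplane phi1 z <= l z by rewrite /l le_max lexx.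
    by rewrite /l; lra.
  have := halfplane_lip phi2 u z; have : halfplane phi2 z <= l z by rewrite /l le_max lexx orbT.
  by rewrite /l; lra.
exists (c / 2) => [|u hu]; first by lra.
have hI : `|complex.Im u - complex.Im w| <= c / 2.
  by rewrite -cImN -cImD; exact: le_trans (Im_nrm _) hu.
have lu : c / 2 * nrm (cexp u) <= l (cexp u).
  have cl phi : c <= cos (complex.Im w - phi) -> c / 2 <= cos (complex.Im u - phi).
    move=> h; have := cos_lip (complex.Im u - phi) (complex.Im w - phi).
    rewrite opprB addrA subrK => h'; have := ler_norm (- (cos (complex.Im u - phi) - cos (complex.Im w - phi))).
    rewrite normrN; lra.
  rewrite /l le_max !halfplane_cexp mulrC.
  have /andP[wa wb] : alpha <= complex.Im w <= beta := Pw.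
  have [h|/ltW h] := leP (complex.Im w) t0.
    by rewrite ler_wpM2l ?nrm_ge0 // cl // cg // /phi1; lra.
  by rewrite [X in _ || X]ler_wpM2l ?nrm_ge0 ?orbT // cl // cg // /phi2; lra.
by split=> //; rewrite ?lE.
Qed.

End Sectors.

(** * Invertibility, coefficient bounds and the final assembly *)

Section Assembly.
Variable R : realType.
Notation C := (Cx R).

Lemma near_of_ball (P : C -> Prop) w (r : R) : 0 < r ->
  (forall u, nrm (u - w) <= r -> P u) -> \forall u \near w, P u.
Proof.
move=> r0 h; apply/nbhs_normP; exists (ofR r); first by rewrite /= -ofR0 ltr_ofR.
by move=> u /=; rewrite /ball_ distrC normE ltr_ofR => /ltW; exact: h.
Qed.

Lemma mqder_ddz m n (G : C -> 'M[C]_(m, n)) w d : mqder G w (cexp w *: d) -> ddz G w = d.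
Proof.
move=> /mqder_derivable[_ h]; rewrite /ddz h scalerA mulVf ?scale1r //; exact: cexp_neq0.
Qed.

Lemma mx_clim m n (U : nat -> 'M[C]_(m, n)) (L : 'M[C]_(m, n)) i j : U @ \oo --> L ->
  clim (fun k => U k i j) (L i j).
Proof.
move=> /cvgrPdist_le h e e0; have [N _ hN] := h (ofR e) ltac:(by rewrite -ofR0 ltr_ofR).
exists N => k Nk; have := le_mx_norm i j (hN k Nk).
by rewrite mxE [(- U k) i j]mxE nrmBC.
Qed.

Lemma clim_terms_bounded (a : nat -> C) L : clim (fun n => \sum_(k < n) a k) L ->
  exists2 M : R, 0 <= M & forall k, nrm (a k) <= M.
Proof.
move=> h; have [N hN] := h 1 ltr01.
exists (2 + \sum_(k < N) nrm (a k)) => [|k].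
  by rewrite addr_ge0 // sumr_ge0 // => *; exact: nrm_ge0.
have [kN|Nk] := ltnP k N.
  rewrite (bigD1 (Ordinal kN)) //= addrCA lerDl addr_ge0 // sumr_ge0 // => *; exact: nrm_ge0.
have h1 := hN _ Nk; have h2 := hN _ (leqW Nk).
have -> : a k = (\sum_(i < k.+1) a i - L) - (\sum_(i < k) a i - L).
  by rewrite big_ord_recr /=; ring.
have s0 : 0 <= \sum_(k < N) nrm (a k) by rewrite sumr_ge0 // => *; exact: nrm_ge0.
have := nrmB (\sum_(i < k.+1) a i - L) (\sum_(i < k) a i - L); lra.
Qed.

(** A left kernel vector satisfies [v = - v (X - 1)], so its largest entry is at most [n e < 1]
    times itself. *)
Lemma near_one_unit n (X : 'M[C]_n) (e : R) : n%:R * e < 1 ->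
  (forall a b, nrm ((X - 1%:M) a b) <= e) -> X \in unitmx.
Proof.
move=> ne hX; rewrite -row_free_unit -kermx_eq0; apply/rowV0P => v /sub_kermxP vX.
have vE : v = - (v *m (X - 1%:M)) by rewrite mulmxBr vX mulmx1 sub0r opprK.
case: n X ne hX v vX vE => [|n] X ne hX v vX vE; first by apply/matrixP => ? [].
pose m := \big[Num.max/0]_(a < n.+1) nrm (v 0 a).
have m0 : 0 <= m by apply: bigmax_ge_id.
have hm a : nrm (v 0 a) <= m by exact: le_bigmax.
have e0 : 0 <= e by apply: le_trans (hX 0 0); exact: nrm_ge0.
have hm' a : nrm (v 0 a) <= n.+1%:R * e * m.
  rewrite vE mxE nrmN mxE; apply: le_trans (nrm_sum _ _ _) _.
  apply: le_trans (_ : \sum_(b < n.+1) m * e <= _).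
    by apply: ler_sum => b _; rewrite nrmM; apply: ler_pM; rewrite ?nrm_ge0.
  by rewrite sumr_const card_ord -[leLHS]mulr_natl [m * e]mulrC mulrA.
have mm : m <= n.+1%:R * e * m.
  by apply/bigmax_leP; split=> [|a _]; rewrite ?mulr_ge0.
have mz : m = 0 by apply/eqP; rewrite eq_le m0 andbT; nra.
apply/matrixP => i a; rewrite ord1 mxE; apply: nrm_eq0; apply/eqP.
by rewrite eq_le nrm_ge0 andbT -mz hm.
Qed.

Lemma psum_mx_finite n (X : nat -> 'M[C]_n) m z : (forall j, (m <= j)%N -> X j = 0) ->
  psum_mx X z = \sum_(j < m) z^-1 ^+ j *: X j.
Proof.
move=> hX; apply/matrixP => a b; rewrite mxE summxE.
have h : clim (fun k => \sum_(j < k) X j a b * z^-1 ^+ j) (\sum_(j < m) X j a b * z^-1 ^+ j).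
  move=> e e0; exists m => k mk.
  have -> : \sum_(j < k) X j a b * z^-1 ^+ j = \sum_(j < m) X j a b * z^-1 ^+ j.
    rewrite (big_ord_widen k (fun j => X j a b * z^-1 ^+ j) mk) [RHS]big_mkcond /=.
    by apply: eq_bigr => j _; case: ltnP => // /hX ->; rewrite mxE mul0r.
  by rewrite subrr nrm0 ltW.
rewrite /psum (clim_uniq (ClimP h) h); apply: eq_bigr => j _.
by rewrite mxE mulrC.
Qed.

Lemma mxdiag_mul s (p : 'I_s -> nat) (A B : forall i, 'M[C]_(p i)) :
  \mxdiag_i A i *m \mxdiag_i B i = \mxdiag_i (A i *m B i).
Proof.
rewrite [LHS]mul_mxdiag_mxblock; apply: eq_mxblock => i j.
case: eqVneq => [E|_]; last by rewrite mulmx0.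
by case: _ / E; rewrite !conform_mx_id.
Qed.

Lemma mxdiag_scalar_entry s (p : 'I_s -> nat) (l : 'I_s -> C) a b :
  (\mxdiag_(i < s) ((l i)%:M : 'M[C]_(p i))) a b = l (tagnat.sig1 a) *+ (a == b).
Proof.
have [<-{b}|ab] := eqVneq a b; first by rewrite mxE eqxx conform_mx_id mxE eqxx.
have /is_diag_mxP : is_diag_mx (\mxdiag_(i < s) ((l i)%:M : 'M[C]_(p i))).
  apply/is_diag_mxblockP; split=> [i j /negPf ij|i]; first by rewrite ij.
  by rewrite eqxx conform_mx_id scalar_mx_is_diag.
by apply.
Qed.

Lemma resonant_eq0 p (d : jordan_data R p) l m M : resonant_of_order d l M ->
  max_integer_difference (jordan_mx d) m -> (m < l)%N -> M = 0.
Proof.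
move=> hr [_ hm] ml.
have h0 : castmx (esym (jsize_sum d), esym (jsize_sum d)) M = 0.
  apply/mxblockP => a b; rewrite submxblock0; apply/eqP/negPn/negP => nz.
  have := hr a b nz => /(hm _ _ _ (jordan_eigenvalue b) (jordan_eigenvalue a)).
  by rewrite leqNgt ml.
have := congr1 (castmx (jsize_sum d, jsize_sum d)) h0.
by rewrite castmxKV /= castmx_const.
Qed.

Lemma entry_bound_mul n (U V : 'M[C]_n) (X : nat -> 'M[C]_n) (r : R) : 0 <= r ->
  (forall a b, exists2 M : R, 0 <= M & forall j, nrm (X j a b) <= M * r ^+ j) ->
  exists2 M : R, 0 <= M & forall j a b, nrm ((U *m X j *m V) a b) <= M * r ^+ j.
Proof.
move=> r0 hX.
have /choice[f hf] : forall ab : 'I_n * 'I_n, exists M : R, 0 <= M /\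
    forall j, nrm (X j ab.1 ab.2) <= M * r ^+ j.
  by move=> [a b]; have [M M0 hM] := hX a b; exists M.
have [u u0 hu] := entry_max U; have [v v0 hv] := entry_max V.
pose Mt := \sum_(q : 'I_n) \sum_(p' : 'I_n) u * f (p', q) * v.
have Mt0 : 0 <= Mt.
  by rewrite !sumr_ge0 // => q _; rewrite sumr_ge0 // => p' _; rewrite !mulr_ge0 ?(hf _).1.
exists Mt => // j a b; rewrite mxE; apply: le_trans (nrm_sum _ _ _) _.
rewrite /Mt mulr_suml; apply: ler_sum => q _; rewrite nrmM mxE mulr_suml.
apply: le_trans (ler_wpM2r (nrm_ge0 _) (nrm_sum _ _ _)) _; rewrite mulr_suml.
apply: ler_sum => p' _; rewrite nrmM mulrAC.

rewrite [leRHS](_ : _ = u * (f (p', q) * r ^+ j) * v); last by ring.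
rewrite mulrAC; apply: ler_pM; rewrite ?mulr_ge0 ?nrm_ge0 //.
by apply: ler_pM; rewrite ?nrm_ge0 //; exact: (hf (p', q)).2.
Qed.

End Assembly.

Theorem theorem4p1 (R : realType)
  (s : nat) (hs : (0 < s)%N)
  (p : 'I_s -> nat) (hp : forall i, (0 < p i)%N)
  (lambda : 'I_s -> Cx R) (hlambda : injective lambda)
  (m : nat) (N0 eps0 : R) (hN0 : 0 < N0) (heps0 : 0 < eps0)
  (A : Cx R * 'rV[Cx R]_m -> 'M[Cx R]_(\sum_(i < s) p i))
  (Aj : nat -> 'rV[Cx R]_m -> 'M[Cx R]_(\sum_(i < s) p i))
  (hA : forall (z : Cx R) (t : 'rV[Cx R]_m), ofR N0 <= `|z| -> `|t| <= ofR eps0 ->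
     \forall q \near (z, t), differentiable A q)
  (hAj : forall (z : Cx R) (t : 'rV[Cx R]_m), ofR N0 <= `|z| -> `|t| <= ofR eps0 ->
     series (fun j : nat => z ^- j *: Aj j t) @ \oo --> A (z, t))
  (hA0 : Aj 0%N 0 = \mxdiag_(i < s) ((lambda i)%:M : 'M[Cx R]_(p i)))
  (tau : int -> R) (htau : (1 < s)%N -> stokes_labelling lambda tau)
  (nu : int) (alpha beta : R) (hab : alpha <= beta)
  (hsub : closed_sector alpha beta `<=` stokes_sector s tau nu) :
  let Lambda : 'M[Cx R]_(\sum_(i < s) p i) := \mxdiag_(i < s) ((lambda i)%:M : 'M[Cx R]_(p i)) in
  exists (Delta0 : 'M[Cx R]_(\sum_(i < s) p i))
         (G : Cx R -> 'M[Cx R]_(\sum_(i < s) p i))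
         (F : nat -> 'M[Cx R]_(\sum_(i < s) p i))
         (N : R)
         (Jd : forall i, jordan_data R (p i))
         (Di Si : forall i, 'M[Cx R]_(p i))
         (mi : 'I_s -> nat)
         (Rli : nat -> forall i, 'M[Cx R]_(p i)),
    let U := closed_sector_end N alpha beta in
    let J : 'M[Cx R]_(\sum_(i < s) p i) := \mxdiag_(i < s) jordan_mx (Jd i) in
    let mbar := (\max_(i < s) mi i)%N in
    let Rl (l : nat) : 'M[Cx R]_(\sum_(i < s) p i) := \mxdiag_(i < s) Rli l i in
    let D : 'M[Cx R]_(\sum_(i < s) p i) := \mxdiag_(i < s) Di i in
    let S : 'M[Cx R]_(\sum_(i < s) p i) := \mxdiag_(i < s) Si i in
    let L : 'M[Cx R]_(\sum_(i < s) p i) := S + \sum_(1 <= l < mbar.+1) Rl l in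
    let A0 (z : Cx R) : 'M[Cx R]_(\sum_(i < s) p i) := A (z, 0) in
    let B (z : Cx R) : 'M[Cx R]_(\sum_(i < s) p i) :=
      Lambda + z^-1 *: (J + \sum_(1 <= l < mbar.+1) z ^- l *: Rl l) in
    let Y (w : Cx R) : 'M[Cx R]_(\sum_(i < s) p i) :=
      zpowmx D w *m zpowmx L w *m expzmx Lambda w in
    (* the data J_i, D_i, S_i, m_i, R_(l),i *)
    (forall i, similar_in unitmx (submxblock (Aj 1%N 0) i i) (jordan_mx (Jd i)))
    /\ (forall i, integer_part_decomposition (jordan_mx (Jd i)) (Di i) (Si i))
    /\ (forall i, max_integer_difference (jordan_mx (Jd i)) (mi i))
    /\ (forall (l : nat) i, (1 <= l <= mbar)%N ->
          ((mi i < l)%N -> Rli l i = 0) /\ resonant_of_order (Jd i) l (Rli l i))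
    (* Delta_0 *)
    /\ block_diagonal Delta0
    /\ Delta0 \in unitmx
    /\ (forall i, submxblock (invmx Delta0 *m Aj 1%N 0 *m Delta0) i i
                  = jordan_mx (Jd i))
    (* G *)
    /\ N0 <= N
    /\ holomorphic_on U G
    /\ asymptotic_id_series U G F
    (* the gauge transformation and the fundamental solutions *)
    /\ gauge_transforms U (fun w => Delta0 *m G w) A0 B
    /\ fundamental_solution setT B Y
    /\ fundamental_solution U A0 (fun w => Delta0 *m G w *m Y w).
Proof.
move=> Lambda.
pose n := (\sum_(i < s) p i)%N.
pose Jd i := sval (cid (jordan_form (submxblock (Aj 1%N 0) i i))).
have Jsim i : similar_in unitmx (submxblock (Aj 1%N 0) i i) (jordan_mx (Jd i)) :=
  svalP (cid (jordan_form (submxblock (Aj 1%N 0) i i))).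
pose Pm i := s2val (cid2 (Jsim i)).
have Pu i : Pm i \in unitmx := s2valP (cid2 (Jsim i)).
have PJ i : Pm i *m submxblock (Aj 1%N 0) i i = jordan_mx (Jd i) *m Pm i.
  by have := s2valP' (cid2 (Jsim i)) => /(similarP (Pu i)).
have exDS i := cid (jordan_integer_part (Jd i)).
pose Di i := sval (exDS i); pose Si i := sval (cid (svalP (exDS i))).
have hDS i : [/\ integer_part_decomposition (jordan_mx (Jd i)) (Di i) (Si i),
    Di i *m Si i = Si i *m Di i & forall l M, resonant_of_order (Jd i) l M ->
    Di i *m M = M *m Di i - l%:R *: M] := svalP (cid (svalP (exDS i))).
pose mi i := sval (cid (jordan_max_difference (Jd i) (hp i))).
have hmi i : max_integer_difference (jordan_mx (Jd i)) (mi i) :=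
  svalP (cid (jordan_max_difference (Jd i) (hp i))).
(* The similarity reads [P A = J P], so the gauge matrix is made of the inverses. *)
pose Delta0 : 'M[Cx R]_n := \mxdiag_(i < s) invmx (Pm i).
pose Delta1 : 'M[Cx R]_n := \mxdiag_(i < s) Pm i.
have D10 : Delta1 *m Delta0 = 1%:M.
  by rewrite mxdiag_mul -mxdiagZ; apply: eq_mxdiag => i; rewrite mulmxV.
have D0u : Delta0 \in unitmx := (mulmx1_unit D10).2.
have D01 : Delta0 *m Delta1 = 1%:M by exact: mulmx1C.
have D1E : invmx Delta0 = Delta1.
  by rewrite -[LHS]mul1mx -D10 -mulmxA mulmxV // mulmx1.
pose At j : 'M[Cx R]_n := Delta1 *m Aj j 0 *m Delta0.
have At0 : At 0%N = Lambda.
  rewrite /At hA0 !mxdiag_mul; apply: eq_mxdiag => i.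
  by rewrite scalar_mxC -mulmxA mulmxV // mulmx1.
have At1 i : submxblock (At 1%N) i i = jordan_mx (Jd i).
  by rewrite submxblock_mul_diagr submxblock_mul_diagl PJ -mulmxA mulmxV // mulmx1.
have [F [Rr [F0 resR Frec]]] := formal_solution hlambda At0 At1.
pose mbar := (\max_(i < s) mi i)%N.
have Rr0 l i : (0 < l)%N -> (mi i < l)%N -> Rr l i = 0.
  by move=> l0; exact: resonant_eq0 (resR l i l0) (hmi i).
pose Bt := normal_form_coef lambda Jd Rr.
(* No integer difference of eigenvalues exceeds [mbar], so [B] is a polynomial in [1/z] of degree at
   most [mbar + 1]. *)
have Bt0 j : (mbar.+2 <= j)%N -> Bt j = 0.
  case: j => [//|[//|j]] hj; rewrite /Bt /= -[RHS]mxdiag0; apply: eq_mxdiag => i.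
  by apply: Rr0 => //; rewrite -ltnS (leq_trans _ hj) // !ltnS; exact: (leq_bigmax i).
pose lam (a : 'I_n) := lambda (tagnat.sig1 a).
have LamE a b : Lambda a b = lam a *+ (a == b) by exact: mxdiag_scalar_entry.
have At0E a b : At 0%N a b = lam a *+ (a == b) by rewrite At0.
have Bt0E a b : Bt 0%N a b = lam a *+ (a == b) by exact: LamE.
have Alim z i j : N0 <= nrm z ->
    clim (fun k => \sum_(l < k) z^-1 ^+ l * Aj l 0 i j) (A (z, 0) i j).
  move=> hz; have := mx_clim i j (hAj z 0 _ _); rewrite normE ler_ofR normr0 -ofR0 ler_ofR.
  move=> /(_ hz (ltW heps0)); congr clim; apply/funext => k.
  rewrite seriesEord summxE; apply: eq_bigr => l _.
  by rewrite mxE exprVn.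
have Abd a b : exists2 M : R, 0 <= M & forall j, nrm (Aj j 0 a b) <= M * N0 ^+ j.
  have nN0 : nrm (ofR N0) = N0 by rewrite nrm_ofR ger0_norm // ltW.
  have hN : N0 <= nrm (ofR N0) by rewrite nN0.
  (* Convergence at the single point [z = N0] bounds the terms, hence gives geometric growth of the
     coefficients without Cauchy estimates. *)
  have [M M0 hM] := @clim_terms_bounded _ (fun l => (ofR N0)^-1 ^+ l * Aj l 0 a b) _ (Alim _ a b hN).
  exists M => // j; have := hM j; rewrite nrmM nrmX nrmV nN0 exprVn.
  by rewrite ler_pdivrMl ?exprn_gt0 // mulrC.
(* At least 1, so that a constant bound on the finitely many coefficients of [B] has the same
   geometric form. *)
pose rho := Num.max N0 1.
have rho0 : 0 <= rho by rewrite le_max (ltW hN0).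
have [KA KA0 hKA] := entry_bound_mul Delta1 Delta0 (ltW hN0) Abd.
pose KB := \sum_(j < mbar.+2) \sum_(ab : 'I_n * 'I_n) nrm (Bt j ab.1 ab.2).
have KB0 : 0 <= KB.
  by rewrite sumr_ge0 // => j _; rewrite sumr_ge0 // => ab _; exact: nrm_ge0.
pose Ka := KA + KB.
have Ka0 : 0 <= Ka by exact: addr_ge0.
have bdA j a b : nrm (At j a b) <= Ka * rho ^+ j.
  apply: le_trans (hKA j a b) _; apply: ler_pM; rewrite ?exprn_ge0 ?(ltW hN0) //.
    by rewrite lerDl.
  by rewrite lerXn2r ?nnegrE ?(ltW hN0) // le_max lexx.
have bdB j a b : nrm (Bt j a b) <= Ka * rho ^+ j.
  have r1 : 1 <= rho ^+ j by rewrite exprn_ege1 // le_max lexx orbT.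
  apply: le_trans (_ : KB <= _); last first.
    by apply: le_trans (ler_peMr _ r1); rewrite ?lerDr.
  have [jm|/Bt0 ->] := ltnP j mbar.+2; last by rewrite mxE nrm0.
  rewrite /KB (bigD1 (Ordinal jm)) //= (bigD1 (a, b)) //= -addrA lerDl addr_ge0 //.
    by rewrite sumr_ge0 // => ab _; exact: nrm_ge0.
  by rewrite sumr_ge0 // => i _; rewrite sumr_ge0 // => ab _; exact: nrm_ge0.
have [c [c' [lw [c0 c'0 lwlip lwP]]]] : exists c c' lw,
    sector_weights p lambda (closed_sector alpha beta) c c' lw.
  have [s1|s2] := leqP s 1.
    exists (1 / 2), (1 / 2); eexists; apply: sector_weights_single.
    by apply/eqP; rewrite eqn_leq s1.
  have open w : closed_sector alpha beta w -> tau nu - pi < arg w < tau (nu + 1).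
    by move/hsub; rewrite /stokes_sector; case: eqP => [E|//]; rewrite E in s2.
  (* The two bounding rays belong to the closed subsector; its inclusion in an open sector becomes
     strict inequalities at [alpha] and [beta]. *)
  have ha : closed_sector alpha beta (0 +i* alpha) by rewrite /closed_sector /arg /= lexx.
  have hb : closed_sector alpha beta (0 +i* beta) by rewrite /closed_sector /arg /= hab lexx.
  move: (open _ ha) (open _ hb); rewrite /arg /= => /andP[ha' _] /andP[_ hb'].
  exact: (sector_weights_stokes p (htau s2) ha' hb').
pose N := Num.max 1 (6 * rho).
have N1 : 1 <= N by rewrite le_max lexx.
have rN : 6 * rho <= N by rewrite le_max lexx orbT.
have N0N : N0 <= N.
  have : N0 <= rho by rewrite le_max lexx.
  by have := rho0; lra.
have [N' [G [G' [hG asG]]]] := sectorial_gauge Ka0 rho0 c0 N1 rN bdA bdB At0E Bt0E Frec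
  c'0 lwlip lwP.
have [M1 hM1] := asG 0%N.
(* The expansion at [K = 0] bounds the entries of [G - 1] by [|M1| / |z|]; the last bound brings [n]
   times this below 1, so that [G] is invertible. *)
pose NN := Num.max (Num.max N N') (2 * n%:R * `|M1|).
pose U := closed_sector_end NN alpha beta.
have Unrm w : U w -> NN < nrm (cexp w) by rewrite /U /closed_sector_end /= normE ltr_ofR => -[].
have UN' w : U w -> N' < nrm (cexp w).
  by move/Unrm; apply: le_lt_trans; rewrite !le_max lexx orbT.
have UP w : U w -> closed_sector alpha beta w by case.
have Gu w : U w -> G w \in unitmx.
  move=> Uw; have z0 : 0 < nrm (cexp w) by rewrite nrm_cexp expR_gt0.
  apply: (@near_one_unit _ _ _ (`|M1| * (nrm (cexp w))^-1)).
    rewrite mulrA ltr_pdivrMr // mul1r.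
    have := Unrm w Uw; rewrite /NN !gt_max => /andP[_ h].
    have : 0 <= n%:R * `|M1| by rewrite mulr_ge0.
    by have := z0; move: h; rewrite -mulrA; lra.
  move=> a b; have := hM1 w (UP w Uw) (UN' w Uw) a b.
  rewrite /partial_mx big_ord1 expr0 scale1r F0 expr1 => h; apply: le_trans h _.
  by rewrite ler_wpM2r ?ler_norm // invr_ge0 ltW.
pose mRl l : 'M[Cx R]_n := \mxdiag_(i < s) Rr l i.
pose mD : 'M[Cx R]_n := \mxdiag_(i < s) Di i.
pose mS : 'M[Cx R]_n := \mxdiag_(i < s) Si i.
pose mJ : 'M[Cx R]_n := \mxdiag_(i < s) jordan_mx (Jd i).
pose B (z : Cx R) : 'M[Cx R]_n := Lambda + z^-1 *: (mJ + \sum_(1 <= l < mbar.+1) z ^- l *: mRl l).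
have BE z : psum_mx Bt z = B z.
  rewrite (psum_mx_finite z Bt0) big_ord_recl expr0 scale1r big_ord_recl /= expr1 /B.
  congr (_ + _); rewrite scalerDr; congr (_ + _).
  rewrite big_add1 /= big_mkord scaler_sumr; apply: eq_bigr => l _.
  by rewrite scalerA -exprVn -exprS.
have AE z : N <= nrm z -> psum_mx At z = Delta1 *m A (z, 0) *m Delta0.
  move=> hz; apply/matrixP => a b; rewrite mxE.
  (* Here only the convergence of the series matters, so the modulus itself is taken as weight, on
     the whole exterior of the disk. *)
  have [_ h] := psum_tail (l := @nrm R) N1 (fun _ => lexx _) Ka0 rho0 rN 0 (fun j => bdA j a b).
  apply: clim_uniq (h z hz) _; rewrite [X in clim _ X]mxE.
  have H : clim (fun k => \sum_q \sum_r Delta0 q b * (Delta1 a r * \sum_(l < k) z^-1 ^+ l * Aj l 0 r q))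
      (\sum_q \sum_r Delta0 q b * (Delta1 a r * A (z, 0) r q)).
    apply: clim_sum => q; apply: clim_sum => r; apply: climZ; apply: climZ.
    by apply: Alim; exact: le_trans hz.
  have -> : \sum_q (Delta1 *m A (z, 0)) a q * Delta0 q b =
      \sum_q \sum_r Delta0 q b * (Delta1 a r * A (z, 0) r q).
    by apply: eq_bigr => q _; rewrite mxE mulr_suml; apply: eq_bigr => r _; rewrite mulrC.
  move: H; congr clim; apply/funext => k.
  under [RHS]eq_bigr => j _.
    rewrite /At mxE mulr_suml.
    under eq_bigr => q _ do rewrite mxE !mulr_suml.
    over.
  rewrite [RHS]exchange_big; apply: eq_bigr => q _ /=.
  rewrite [RHS]exchange_big; apply: eq_bigr => r _ /=.
  by rewrite !mulr_sumr; apply: eq_bigr => j _; ring.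
have JDS : mJ = mD + mS.
  by rewrite -mxdiagD; apply: eq_mxdiag => i; case: (hDS i) => -[].
have Lcomm (X : forall i, 'M[Cx R]_(p i)) : Lambda *m \mxdiag_i X i = \mxdiag_i X i *m Lambda.
  by rewrite !mxdiag_mul; apply: eq_mxdiag => i; rewrite scalar_mxC.
have LL : Lambda *m (mS + \sum_(1 <= l < mbar.+1) mRl l) =
    (mS + \sum_(1 <= l < mbar.+1) mRl l) *m Lambda.
  rewrite mulmxDr mulmxDl Lcomm mulmx_sumr mulmx_suml; congr (_ + _).
  by apply: eq_bigr => l _; exact: Lcomm.
have mDS : mD *m mS = mS *m mD.
  by rewrite !mxdiag_mul; apply: eq_mxdiag => i; case: (hDS i).
have mDR l : (1 <= l <= mbar)%N -> mD *m mRl l = mRl l *m mD - l%:R *: mRl l.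
  move=> /andP[l1 _]; rewrite -mul_scalar_mx -mxdiagZ !mxdiag_mul -mxdiagB.
  by apply: eq_mxdiag => i; rewrite mul_scalar_mx; case: (hDS i) => _ _; apply; exact: resR.
pose Y := normal_solution mbar Lambda mD mS mRl.
have Yd w : mqder Y w (cexp w *: (B (cexp w) *m Y w)).
  rewrite /B JDS; exact: normal_solution_der (Lcomm Di) LL mDS mDR w.
have Yu w : Y w \in unitmx by exact: normal_solution_unit.
have hT w : U w -> exists2 r : R, 0 < r & forall u, nrm (u - w) <= r ->
    mqder G u (cexp u *: G' u) /\
    Delta0 *m G' u = A (cexp u, 0) *m (Delta0 *m G u) - Delta0 *m G u *m B (cexp u).
  move=> Uw; have [r r0 hr] := hG w (UP w Uw) (UN' w Uw); exists r => // u /hr[Nu dG E].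
  split; first exact: dG.
  rewrite E (AE _ Nu) BE; move: (A _) (B _) (G u) => a b g.
  by rewrite mulmxBr !mulmxA D01 mul1mx.
have Tder u : mqder G u (cexp u *: G' u) ->
    mqder (fun w => Delta0 *m G w) u (cexp u *: (Delta0 *m G' u)).
  move=> dG; have := mqderM (mqder_cst Delta0 u) dG.
  by apply: mqder_eq => //; rewrite mul0mx add0r scalemxAr.
have Tu w : U w -> Delta0 *m G w \in unitmx by move=> /Gu h; rewrite unitmx_mul D0u.
exists Delta0, G, F, NN, Jd, Di, Si, mi, Rr.
rewrite -/mbar.
split; first exact: Jsim.
split; first by move=> i; case: (hDS i).
split; first exact: hmi.
split; first by move=> l i /andP[l1 _]; split; [exact: Rr0|exact: resR].
split; first by move=> i j ij; rewrite mxblockK (negPf ij).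
split; first exact: D0u.
split; first by move=> i; rewrite D1E; exact: At1.
split; first by apply: le_trans N0N _; rewrite 2!le_max lexx.
split.
  move=> w Uw; have [r r0 hr] := hT w Uw; apply: (near_of_ball r0) => u /hr[dG _].
  exact: (mqder_derivable dG).1.
split.
  move=> K; have [M hM] := asG K; exists `|M|, 0 => w Uw _.
  have z0 : 0 < nrm (cexp w) by rewrite nrm_cexp expR_gt0.
  have -> : 1%:M + \sum_(1 <= k < K.+1) cexp w ^- k *: F k = partial_mx F K (cexp w).
    rewrite /partial_mx big_ord_recl expr0 scale1r F0 big_add1 /= big_mkord; congr (_ + _).
    by apply: eq_bigr => k _; rewrite exprVn.
  rewrite normE -ofRX -ofRV -ofRM -exprVn; apply: mx_norm_le => [|a b]; last first.
    apply: le_trans (hM w (UP w Uw) (UN' w Uw) a b) _.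
    by rewrite ler_wpM2r ?ler_norm // exprn_ge0 // invr_ge0 ltW.
  by rewrite mulr_ge0 // exprn_ge0 // invr_ge0 ltW.
split.
  split.
    move=> w Uw; have [r r0 hr] := hT w Uw; apply: (near_of_ball r0) => u /hr[dG _].
    exact: (mqder_derivable (Tder u dG)).1.
  move=> w Uw; split; first exact: Tu.
  have [r r0 hr] := hT w Uw; have [|dG E] := hr w; first by rewrite subrr nrm0 ltW.
  rewrite -[LHS]/(B (cexp w)) (mqder_ddz (Tder w dG)) E; move: (Tu w Uw); move: (B _) (Delta0 *m G w) => b T Tw.
  by rewrite mulmxBr opprB !mulmxA mulVmx // mul1mx addrCA subrr addr0.
split.
  split; first by move=> w _; apply: (near_of_ball ltr01) => u _; exact: (mqder_derivable (Yd u)).1.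
  by move=> w _; split; [exact: mqder_ddz (Yd w)|exact: Yu].
split.
  move=> w Uw; have [r r0 hr] := hT w Uw; apply: (near_of_ball r0) => u /hr[dG _].
  exact: (mqder_derivable (mqderM (Tder u dG) (Yd u))).1.
move=> w Uw; split; last by rewrite unitmx_mul Tu //= Yu.
have [r r0 hr] := hT w Uw; have [|dG E] := hr w; first by rewrite subrr nrm0 ltW.
apply: mqder_ddz; apply: mqder_eq (mqderM (Tder w dG) (Yd w)) => //.
by rewrite E -scalemxAl -scalemxAr -scalerDr mulmxBl !mulmxA subrK.
Qed.
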